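(* Let $\ell$ be a commutative unital ring with involution, let $E$ be a row-finite graph, and let $H$ be a functor from the category of $*$-algebras over $\ell$ to abelian groups which is $M_\infty$-stable, additive and preserves filtering colimits. Let $\widetilde{E}$ be the covering of $E$ associated to the constant weight $\omega:E^1\to\mathbb{Z}$, $\omega(e)=1$. Then there is a $\mathbb{Z}[\sigma]$-module isomorphism $$H(L(\widetilde{E}))\cong\mathfrak{BF}_{\mathrm{gr}}(E)\otimes_{\mathbb{Z}}H(\ell).$$
   Context: A graph $E$ has vertices $E^0$, edges $E^1$ and source/range maps $s,r$. It is row-finite if each $s^{-1}(v)$ is finite; $v$ is regular if $0<\#s^{-1}(v)<\infty$, and $\mathrm{reg}(E)$ is the set of regular vertices. $A_E\in\mathbb{Z}^{\mathrm{reg}(E)\times E^0}$ has $(v,w)$ entry the number of edges from $v$ to $w$; $I_{v,w}=\delta_{v,w}$ in $\mathbb{Z}^{E^0\times\mathrm{reg}(E)}$. $\mathbb{Z}[\sigma]$ is the group ring of the infinite cyclic group $\langle\sigma\rangle$, and $\mathfrak{BF}_{\mathrm{gr}}(E)=\mathrm{coker}(I-\sigma A_E^t:\mathbb{Z}[\sigma]^{(\mathrm{reg}(E))}\to\mathbb{Z}[\sigma]^{(E^0)})$. The covering $\widetilde{E}$ has vertices $v_n$ ($v\in E^0,n\in\mathbb{Z}$) and edges $e_n$ ($e\in E^1,n\in\mathbb{Z}$) with $s(e_n)=s(e)_n$, $r(e_n)=r(e)_{n+1}$. The action of $\sigma$ on $H(L(\widetilde{E}))$ is induced by the $*$-automorphism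 $v_n\mapsto v_{n+1}$, $e_n\mapsto e_{n+1}$ of $L(\widetilde{E})$. For a graph $F$, the Leavitt path algebra $L(F)$ is the $\ell$-algebra generated by $v\in F^0$, $e,e^*$ ($e\in F^1$) with relations $vw=\delta_{v,w}v$, $s(e)e=e=e\,r(e)$, $r(e)e^*=e^*=e^*s(e)$, $e^*f=\delta_{e,f}r(e)$, and $v=\sum_{s(e)=v}ee^*$ for $v$ regular; its involution is semilinear over that of $\ell$, fixes vertices and sends $e\mapsto e^*$. $*$-algebras are associative, not necessarily unital $\ell$-algebras with an additive involution with $(ab)^*=b^*a^*$, $(\mu a)^*=\mu^*a^*$ for $\mu\in\ell$. $H$ is $M_\infty$-stable if it sends the corner inclusions $A\to M_\infty A$, $a\mapsto\varepsilon_{x,x}\otimes a$, to isomorphisms, where $M_\infty A$ is the $*$-algebra of finitely supported $\mathbb{N}\times\mathbb{N}$-matrices over $A$ with conjugate-transpose involution. $H$ is additive if $H(A\times B)\to H(A)\oplus H(B)$ is an isomorphism for all $A,B$. *)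

(* Defs.v *)
From HB Require Import structures.
From mathcomp Require Import all_boot all_order all_algebra.
From mathcomp Require Import finmap.
From mathcomp Require Import boolp classical_sets functions cardinality fsbigop.
From mathcomp Require Import monalg.

Set Implicit Arguments.
Unset Strict Implicit.
Unset Printing Implicit Defensive.

Import GRing.Theory.
Local Open Scope ring_scope.
Local Open Scope quotient_scope.

Section FreeLift.
Variables (K : choiceType) (G M : zmodType).
Implicit Types (c : K -> G -> M) (x y : {malg G[K]}).

Definition lin c x : M := \sum_(k <- msupp x) c k x@_k.

Lemma malg_ind (P : {malg G[K]} -> Prop) :
  P 0 -> (forall x y, P x -> P y -> P (x + y)) ->
  (forall z k, P << z *g k >>) -> forall x, P x.
Proof. by move=> P0 PD PU x; rewrite [x]monalgE; apply: (big_ind P). Qed.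

Lemma linDc c1 c2 x : lin (fun k z => c1 k z + c2 k z) x = lin c1 x + lin c2 x.
Proof. exact: big_split. Qed.

Lemma eq_lin c1 c2 x : (forall k z, c1 k z = c2 k z) -> lin c1 x = lin c2 x.
Proof. by move=> c12; apply: eq_bigr. Qed.

Variable c : K -> G -> M.
Hypothesis cD : forall k, {morph c k : z z' / z + z'}.

Let c0 k : c k 0 = 0.
Proof. by apply: (addIr (c k 0)); rewrite -cD addr0 add0r. Qed.

Lemma linEw (D : {fset K}) x :
  (msupp x `<=` D)%fset -> lin c x = \sum_(k <- D) c k x@_k.
Proof.
move=> xD; apply: big_fset_incl => // k _ kx.
by rewrite mcoeff_outdom.
Qed.

Lemma lin0 : lin c 0 = 0.
Proof. by rewrite /lin msupp0 big_seq_fset0. Qed.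

Lemma linD : {morph lin c : x y / x + y}.
Proof.
move=> x y; have xyD := msuppD_le x y.
rewrite (linEw xyD) (linEw (fsubsetUl (msupp x) (msupp y))).
rewrite (linEw (fsubsetUr (msupp x) (msupp y))) -big_split /=.
by apply: eq_bigr => k _; rewrite mcoeffD cD.
Qed.

Lemma linN : {morph lin c : x / - x}.
Proof. by move=> x; apply: (addIr (lin c x)); rewrite -linD !addNr lin0. Qed.

Lemma linU k z : lin c << z *g k >> = c k z.
Proof. by rewrite (linEw msuppU_le) big_seq_fset1 mcoeffUU. Qed.

End FreeLift.

Section Bilin.
Variables (K K' : choiceType) (G G' M : zmodType).
Variable c : K -> G -> K' -> G' -> M.
Hypothesis cDl : forall k z1 z2 k' z',
  c k (z1 + z2) k' z' = c k z1 k' z' + c k z2 k' z'.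
Hypothesis cDr : forall k z k' z1 z2,
  c k z k' (z1 + z2) = c k z k' z1 + c k z k' z2.

Definition bilin (x : {malg G[K]}) (y : {malg G'[K']}) : M :=
  lin (fun k z => lin (c k z) y) x.

Let cD1 y k : {morph (fun z => lin (c k z) y) : z1 z2 / z1 + z2}.
Proof. by move=> z1 z2; rewrite -linDc; apply: eq_lin => k' z'. Qed.

Let cD2 k z k' : {morph c k z k' : z1 z2 / z1 + z2}.
Proof. by move=> z1 z2; rewrite cDr. Qed.

Lemma bilinDl x1 x2 y : bilin (x1 + x2) y = bilin x1 y + bilin x2 y.
Proof. by rewrite /bilin linD //; exact: cD1. Qed.

Lemma bilinDr x y1 y2 : bilin x (y1 + y2) = bilin x y1 + bilin x y2.
Proof.
rewrite /bilin -linDc; apply: eq_lin => k z.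
by rewrite linD //; exact: cD2.
Qed.

Lemma bilin0l y : bilin 0 y = 0.
Proof. by rewrite /bilin lin0. Qed.

Lemma bilin0r x : bilin x 0 = 0.
Proof. by apply: (addIr (bilin x 0)); rewrite -bilinDr addr0 add0r. Qed.

Lemma bilinU k z k' z' : bilin << z *g k >> << z' *g k' >> = c k z k' z'.
Proof. by rewrite /bilin (linU (fun k => cD1 _ k)) (linU (cD2 k z)). Qed.

End Bilin.

(* The group ring Z[G] of a commutative group G that is written additively:  *)
(* the image of g : G in it is << g >>, so << g >> * << h >> = << g + h >>.  *)
Definition groupRing (G : zmodType) : Type := {malg int[G]}.

Section GroupRing.
Variable G : zmodType.

HB.instance Definition _ := GRing.Zmodule.on (groupRing G).

Implicit Types x y z : groupRing G.

Definition grmul : groupRing G -> groupRing G -> groupRing G :=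
  bilin (fun g a h b => << a * b *g g + h >>).

Definition grone : groupRing G := << 1 *g 0 >>.

Let cDl (g : G) (a1 a2 : int) (h : G) (b : int) :
  << (a1 + a2) * b *g g + h >> = << a1 * b *g g + h >> + << a2 * b *g g + h >>.
Proof. by rewrite mulrDl monalgUD. Qed.

Let cDr (g : G) (a : int) (h : G) (b1 b2 : int) :
  << a * (b1 + b2) *g g + h >> = << a * b1 *g g + h >> + << a * b2 *g g + h >>.
Proof. by rewrite mulrDr monalgUD. Qed.

Lemma grmulDl : left_distributive grmul +%R.
Proof. by move=> x y z; exact: bilinDl. Qed.

Lemma grmulDr : right_distributive grmul +%R.
Proof. by move=> x y z; exact: bilinDr. Qed.

Let mul0 y : grmul 0 y = 0. Proof. exact: bilin0l. Qed.
Let mulr0 x : grmul x 0 = 0. Proof. exact: bilin0r. Qed.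

Lemma grmulU (g h : G) (a b : int) :
  grmul << a *g g >> << b *g h >> = << a * b *g g + h >>.
Proof. exact: bilinU. Qed.

Lemma grmulC : commutative grmul.
Proof.
move=> x y; elim/malg_ind: x => [|x1 x2 IH1 IH2|a g]; first by rewrite mul0 mulr0.
  by rewrite grmulDl grmulDr IH1 IH2.
elim/malg_ind: y => [|y1 y2 IH1 IH2|b h]; first by rewrite mul0 mulr0.
  by rewrite grmulDl grmulDr IH1 IH2.
by rewrite !grmulU mulrC addrC.
Qed.

Lemma grmulA : associative grmul.
Proof.
move=> x y z; elim/malg_ind: x => [|x1 x2 IH1 IH2|a g]; first by rewrite !mul0.
  by rewrite !grmulDl IH1 IH2.
elim/malg_ind: y => [|y1 y2 IH1 IH2|b h]; first by rewrite mul0 mulr0 mul0.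
  by rewrite grmulDl !grmulDr grmulDl IH1 IH2.
elim/malg_ind: z => [|z1 z2 IH1 IH2|d k]; first by rewrite !mulr0.
  by rewrite !grmulDr IH1 IH2.
by rewrite !grmulU mulrA addrA.
Qed.

Lemma grmul1 : left_id grone grmul.
Proof.
elim/malg_ind => [|x1 x2 IH1 IH2|a g]; first by rewrite mulr0.
  by rewrite grmulDr IH1 IH2.
by rewrite grmulU mul1r add0r.
Qed.

Lemma grone_neq0 : grone != 0.
Proof. by rewrite monalgU_eq0 oner_eq0. Qed.

HB.instance Definition _ := GRing.Zmodule_isComNzRing.Build (groupRing G)
  grmulA grmulC grmul1 grmulDl grone_neq0.

End GroupRing.

Record groupAction (G M : zmodType) := GroupAction {
  gact :> G -> {additive M -> M};
  gact0 : forall m, gact 0 m = m;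
  gactD : forall g h m, gact (g + h) m = gact g (gact h m)
}.

Definition actMod (G M : zmodType) (rho : groupAction G M) : Type := M.

Section ActMod.
Variables (G M : zmodType) (rho : groupAction G M).

HB.instance Definition _ := GRing.Zmodule.on (actMod rho).

Definition actscale (x : groupRing G) (m : actMod rho) : actMod rho :=
  lin (fun g a => (rho g m *~ a : M)) x.

Let cD m (g : G) : {morph (fun a => rho g m *~ a) : a b / a + b}.
Proof. by move=> a b; rewrite mulrzDr. Qed.

Lemma actscaleDl m : {morph actscale^~ m : x y / x + y}.
Proof. by move=> x y; apply: linD; exact: cD. Qed.

Lemma actscaleDr : right_distributive actscale +%R.
Proof.
move=> x m n; rewrite /actscale -linDc; apply: eq_lin => g a.
by rewrite raddfD mulrzDl.
Qed.

Lemma actscaleU g a m : actscale << a *g g >> m = rho g m *~ a.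
Proof. by apply: linU; exact: cD. Qed.

Let scale0 m : actscale 0 m = 0. Proof. exact: lin0. Qed.
Let scaler0 x : actscale x 0 = 0.
Proof. by apply: (addIr (actscale x 0)); rewrite -actscaleDr addr0 add0r. Qed.

Lemma actscaleA x y m : actscale x (actscale y m) = actscale (x * y) m.
Proof.
elim/malg_ind: x => [|x1 x2 IH1 IH2|a g]; first by rewrite mul0r !scale0.
  by rewrite mulrDl !actscaleDl IH1 IH2.
elim/malg_ind: y => [|y1 y2 IH1 IH2|b h]; first by rewrite mulr0 scale0 scaler0.
  by rewrite mulrDr !actscaleDl actscaleDr IH1 IH2.
rewrite [_ * _]grmulU !actscaleU gactD raddfMz.
by rewrite -mulrzA mulrC.
Qed.

Lemma actscale1 : left_id 1 actscale.
Proof. by move=> m; rewrite actscaleU gact0. Qed.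

HB.instance Definition _ := GRing.Zmodule_isLmodule.Build (groupRing G)
  (actMod rho) actscaleA actscale1 actscaleDr actscaleDl.

End ActMod.

(* {malg R[I]} is the free module R^(I), with basis the << i >>. This is the *)
(* linear map with matrix A when the columns of A have finite support, see   *)
(* mxactE; the sum over j is 0 for a column that has infinite support.       *)
Definition mxact (R : comNzRingType) (I J : choiceType) (A : J -> I -> R)
    (x : {malg R[I]}) : {malg R[J]} :=
  \sum_(i <- msupp x) x@_i *: \sum_(j \in [set: J]) << A j i *g j >>.

Section MxAct.
Variables (R : comNzRingType) (I J : choiceType) (A : J -> I -> R).

Lemma mxact_linear : linear (mxact A).
Proof.
pose c i (r : R) : {malg R[J]} := r *: \sum_(j \in [set: J]) << A j i *g j >>.
have cD i : {morph c i : z z' / z + z'} by move=> z z'; rewrite /c scalerDl.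
have mxactE x : mxact A x = lin c x by [].
move=> r x y; rewrite !mxactE linD //; congr (_ + _).
elim/malg_ind: x => [|x1 x2 IH1 IH2|a i]; first by rewrite scaler0 lin0 scaler0.
  by rewrite scalerDr !linD // IH1 IH2 scalerDr.
have -> : r *: << a *g i >> = << r * a *g i >> :> {malg R[I]}.
  by apply/malgP => k; rewrite mcoeffZ !mcoeffU mulrnAr.
by rewrite !linU // /c scalerA.
Qed.

HB.instance Definition _ :=
  GRing.isLinear.Build R {malg R[I]} {malg R[J]} _ (mxact A) mxact_linear.

Lemma mxactE (x : {malg R[I]}) (j : J) :
  (forall i, finite_set [set j | A j i != 0]%classic) ->
  (mxact A x)@_j = \sum_(i <- msupp x) A j i * x@_i.
Proof.
move=> Afin; rewrite raddf_sum; apply: eq_bigr => i _.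
rewrite /= mcoeffZ mulrC; congr (_ * _).
rewrite (fsbigTE (fset_set [set j | A j i != 0]%classic)) => [|k]; last first.
  by rewrite in_fset_set // notin_setE /= => /negP; rewrite negbK => /eqP ->;
    rewrite monalgU0.
rewrite raddf_sum /=; have [/eqP Aji|Aji] := boolP (A j i == 0).
  rewrite Aji big1 // => k _; rewrite mcoeffU.
  by case: eqP => // ->; rewrite Aji.
rewrite (big_fsetD1 j) /=; last by rewrite in_fset_set // inE.
rewrite mcoeffUU big1_fset ?addr0 // => k; rewrite in_fsetD1 => /andP[kj _] _.
by rewrite mcoeffU (negbTE kj).
Qed.

End MxAct.

Definition im_pred (R : pzRingType) (U V : lmodType R) (f : {linear U -> V}) :
  {pred V} := [pred y | `[< exists x, y = f x >]].

Section Coker.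
Variables (R : pzRingType) (U V : lmodType R) (f : {linear U -> V}).

Lemma im_zmod_closed : zmod_closed (im_pred f).
Proof.
split=> [|x y]; first by apply/asboolP; exists 0; rewrite linear0.
move=> /asboolP[a ->] /asboolP[b ->]; apply/asboolP; exists (a - b).
by rewrite linearB.
Qed.

HB.instance Definition _ := GRing.isZmodClosed.Build V (im_pred f) im_zmod_closed.

Definition coker : Type := Quotient.quot (im_pred f).

HB.instance Definition _ := GRing.Zmodule.on coker.

Definition coker_scale (r : R) (x : coker) : coker := \pi_coker (r *: repr x).

Lemma coker_eqP (x y : V) :
  reflect (exists u, x - y = f u) (\pi_coker x == \pi_coker y).
Proof. by rewrite -Quotient.idealrBE; exact: asboolP. Qed.

Lemma coker_scaleE r x : coker_scale r (\pi_coker x) = \pi_coker (r *: x).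
Proof.
have /coker_eqP[u xu] : \pi_coker (repr (\pi_coker x)) == \pi_coker x.
  by rewrite reprK.
by apply/eqP/coker_eqP; exists (r *: u); rewrite -scalerBr xu linearZ.
Qed.

Let piD x y : \pi_coker x + \pi_coker y = \pi_coker (x + y).
Proof. by rewrite [RHS]raddfD. Qed.

Lemma coker_scaleA a b x : coker_scale a (coker_scale b x) = coker_scale (a * b) x.
Proof. by elim/quotW: x => x; rewrite (coker_scaleE b) !coker_scaleE scalerA. Qed.

Lemma coker_scale1 : left_id 1 coker_scale.
Proof. by elim/quotW => x; rewrite coker_scaleE scale1r. Qed.

Lemma coker_scaleDr : right_distributive coker_scale +%R.
Proof.
move=> a; elim/quotW => x; elim/quotW => y.
by rewrite piD !coker_scaleE scalerDr piD.
Qed.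

Lemma coker_scaleDl x : {morph coker_scale^~ x : a b / a + b}.
Proof. by move=> a b; elim/quotW: x => x; rewrite !coker_scaleE scalerDl piD. Qed.

HB.instance Definition _ := GRing.Zmodule_isLmodule.Build R coker
  coker_scaleA coker_scale1 coker_scaleDr coker_scaleDl.

End Coker.

(* M (x)_Z A as an R-module, with R acting on M: the free abelian group on  *)
(* M * A modulo the subgroup generated by the biadditivity relations.       *)
Section Tensor.
Variables (R : pzRingType) (M : lmodType R) (A : zmodType).

Let F := {malg int[(M * A)%type]}.

Inductive tens_rel : F -> Prop :=
| tens_rel0 : tens_rel 0
| tens_relB x y : tens_rel x -> tens_rel y -> tens_rel (x - y)
| tens_relDl m m' a :
    tens_rel (<< (m + m', a) >> - << (m, a) >> - << (m', a) >>)
| tens_relDr m a a' :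
    tens_rel (<< (m, a + a') >> - << (m, a) >> - << (m, a') >>).

Definition tens_pred : {pred F} := [pred x | `[< tens_rel x >]].

Lemma tens_zmod_closed : zmod_closed tens_pred.
Proof.
split=> [|x y]; first by apply/asboolP; exact: tens_rel0.
by move=> /asboolP xr /asboolP yr; apply/asboolP; exact: tens_relB.
Qed.

HB.instance Definition _ := GRing.isZmodClosed.Build F tens_pred tens_zmod_closed.

Definition tensor : Type := Quotient.quot tens_pred.

HB.instance Definition _ := GRing.Zmodule.on tensor.

Definition tens (m : M) (a : A) : tensor := \pi_tensor << (m, a) >>.

Lemma tensor_eqP (x y : F) :
  reflect (tens_rel (x - y)) (\pi_tensor x == \pi_tensor y).
Proof. by rewrite -Quotient.idealrBE; exact: asboolP. Qed.

Definition free_scale (r : R) : F -> F :=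
  lin (fun k (z : int) => << z *g (r *: k.1, k.2) >>).

Let cD r (k : (M * A)%type) :
  {morph (fun z : int => << z *g (r *: k.1, k.2) >> : F) : z z' / z + z'}.
Proof. by move=> z z'; rewrite monalgUD. Qed.

Let fsD r : {morph free_scale r : x y / x + y}.
Proof. exact: linD (cD r). Qed.
Let fsN r : {morph free_scale r : x / - x}.
Proof. exact: linN (cD r). Qed.
Let fsB r : {morph free_scale r : x y / x - y}.
Proof. by move=> x y; rewrite fsD fsN. Qed.
Let fs0 r : free_scale r 0 = 0.
Proof. exact: lin0. Qed.
Let fsU r k z : free_scale r << z *g k >> = << z *g (r *: k.1, k.2) >>.
Proof. exact: linU (cD r) _ _. Qed.

Lemma tens_rel_scale r x : tens_rel x -> tens_rel (free_scale r x).
Proof.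
elim=> [|{}x y _ xr _ yr|m m' a|m a a'].
- by rewrite fs0; exact: tens_rel0.
- by rewrite fsB; exact: tens_relB.
- by rewrite !fsB !fsU /= scalerDr; exact: tens_relDl.
- by rewrite !fsB !fsU /=; exact: tens_relDr.
Qed.

Definition tensor_scale (r : R) (x : tensor) : tensor :=
  \pi_tensor (free_scale r (repr x)).

Lemma tensor_scaleE r x : tensor_scale r (\pi_tensor x) = \pi_tensor (free_scale r x).
Proof.
have /tensor_eqP xr : \pi_tensor (repr (\pi_tensor x)) == \pi_tensor x.
  by rewrite reprK.
by apply/eqP/tensor_eqP; rewrite -fsB; exact: tens_rel_scale.
Qed.

Let piD x y : \pi_tensor (x + y) = \pi_tensor x + \pi_tensor y.
Proof. by rewrite [LHS]raddfD. Qed.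

Lemma tensor_scaleA a b x : tensor_scale a (tensor_scale b x) = tensor_scale (a * b) x.
Proof.
elim/quotW: x => x; rewrite (tensor_scaleE b) !tensor_scaleE; congr (\pi_tensor _).
elim/malg_ind: x => [|x1 x2 IH1 IH2|z k]; first by rewrite !fs0.
  by rewrite !fsD IH1 IH2.
by rewrite !fsU /= scalerA.
Qed.

Lemma tensor_scale1 : left_id 1 tensor_scale.
Proof.
elim/quotW => x; rewrite tensor_scaleE; congr (\pi_tensor _).
elim/malg_ind: x => [|x1 x2 IH1 IH2|z [m a]]; first by rewrite fs0.
  by rewrite fsD IH1 IH2.
by rewrite fsU scale1r.
Qed.

Lemma tensor_scaleDr : right_distributive tensor_scale +%R.
Proof.
move=> r; elim/quotW => x; elim/quotW => y.
by rewrite -piD !tensor_scaleE fsD piD.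
Qed.

Lemma tensDl m m' a : tens (m + m') a = tens m a + tens m' a.
Proof.
rewrite /tens -piD; apply/eqP/tensor_eqP.
by rewrite opprD addrA; exact: tens_relDl.
Qed.

Lemma tensDr m a a' : tens m (a + a') = tens m a + tens m a'.
Proof.
rewrite /tens -piD; apply/eqP/tensor_eqP.
by rewrite opprD addrA; exact: tens_relDr.
Qed.

Lemma pi_tensorU z k : \pi_tensor << z *g k >> = tens k.1 k.2 *~ z.
Proof.
have -> : << z *g k >> = << k >> *~ z :> F.
  by rewrite -(raddfMz (mkmalgU k)) intz.
by rewrite raddfMz /tens -surjective_pairing.
Qed.

Lemma tensor_scaleDl x : {morph tensor_scale^~ x : a b / a + b}.
Proof.
move=> a b; elim/quotW: x => x; rewrite !tensor_scaleE.
elim/malg_ind: x => [|x1 x2 IH1 IH2|z k]; first by rewrite !fs0 -piD addr0.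
  by rewrite !fsD [LHS]piD IH1 IH2 !piD addrACA.
by rewrite !fsU !pi_tensorU /= scalerDl tensDl mulrzDl.
Qed.

HB.instance Definition _ := GRing.Zmodule_isLmodule.Build R tensor
  tensor_scaleA tensor_scale1 tensor_scaleDr tensor_scaleDl.

Lemma tensorZ r m a : r *: tens m a = tens (r *: m) a.
Proof. by rewrite [LHS]tensor_scaleE fsU. Qed.

End Tensor.

Record invRing := InvRing {
  inv_ring :> comPzRingType;
  conj : {rmorphism inv_ring -> inv_ring};
  conjK : involutive conj
}.
Arguments conj {i}.

Record starAlg (l : invRing) := StarAlg {
  carrier :> lmodType l;
  amul : carrier -> carrier -> carrier;
  astar : carrier -> carrier;
  amulA : associative amul;
  amulDl : left_distributive amul +%R;
  amulDr : right_distributive amul +%R;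
  amulZl : forall a x y, amul (a *: x) y = a *: amul x y;
  amulZr : forall a x y, amul x (a *: y) = a *: amul x y;
  astarK : involutive astar;
  astarD : {morph astar : x y / x + y};
  astarZ : forall a x, astar (a *: x) = conj a *: astar x;
  astarM : forall x y, astar (amul x y) = amul (astar y) (astar x)
}.

Record starHom (l : invRing) (A B : starAlg l) := StarHom {
  shom_fun :> A -> B;
  shom_linear : linear shom_fun;
  shomM : forall x y, shom_fun (amul x y) = amul (shom_fun x) (shom_fun y);
  shom_star : forall x, shom_fun (astar x) = astar (shom_fun x)
}.

HB.instance Definition _ (l : invRing) (A B : starAlg l) (f : starHom A B) :=
  GRing.isLinear.Build l A B _ (shom_fun f) (@shom_linear l A B f).

Lemma starHom_eq (l : invRing) (A B : starAlg l) (f g : starHom A B) :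
  (forall x, f x = g x) -> f = g.
Proof.
case: f => f f1 f2 f3; case: g => g g1 g2 g3 /= /funext fg; subst g.
by congr StarHom; exact: Prop_irrelevance.
Qed.

Lemma additive_eq (M N : zmodType) (f g : {additive M -> N}) :
  (forall x, f x = g x) -> f = g.
Proof.
case: f => f [[f1]]; case: g => g [[g1]] /= /funext fg; subst g.
by rewrite (Prop_irrelevance f1 g1).
Qed.

Record category := Category {
  ob :> Type;
  hom : ob -> ob -> Type;
  idm : forall a, hom a a;
  comp : forall a b c, hom b c -> hom a b -> hom a c;
  comp1m : forall a b (f : hom a b), comp (idm b) f = f;
  compm1 : forall a b (f : hom a b), comp f (idm a) = f;
  compA : forall a b c d (h : hom c d) (g : hom b c) (f : hom a b),
    comp h (comp g f) = comp (comp h g) f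
}.
Arguments hom {_}.
Arguments idm {_}.
Arguments comp {_ _ _ _}.

Record functor (C D : category) := Functor {
  fob :> C -> D;
  fmap : forall a b, hom a b -> hom (fob a) (fob b);
  fmap1 : forall a, fmap (idm a) = idm (fob a);
  fmapM : forall a b c (g : hom b c) (f : hom a b),
    fmap (comp g f) = comp (fmap g) (fmap f)
}.
Arguments fmap {_ _} _ {_ _}.

Section FunctorComp.
Variables (B C D : category) (G : functor C D) (F : functor B C).

Let fc_map a b (f : hom a b) : hom (G (F a)) (G (F b)) := fmap G (fmap F f).

Lemma fc_map1 a : fc_map (idm a) = idm (G (F a)).
Proof. by rewrite /fc_map !fmap1. Qed.

Lemma fc_mapM a b c (g : hom b c) (f : hom a b) :
  fc_map (comp g f) = comp (fc_map g) (fc_map f).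
Proof. by rewrite /fc_map !fmapM. Qed.

Definition functor_comp : functor B D := Functor fc_map1 fc_mapM.
End FunctorComp.

Definition is_cocone (I C : category) (D : functor I C) (c : C)
    (k : forall i, hom (D i) c) : Prop :=
  forall i j (f : hom i j), comp (k j) (fmap D f) = k i.

Definition is_colimit (I C : category) (D : functor I C) (c : C)
    (k : forall i, hom (D i) c) : Prop :=
  is_cocone k /\
  forall (c' : C) (k' : forall i, hom (D i) c'), is_cocone k' ->
    exists! u : hom c c', forall i, comp u (k i) = k' i.

Definition filtering (I : category) : Prop :=
  [/\ inhabited I,
      forall i j : I, exists k, inhabited (hom i k) /\ inhabited (hom j k)
    & forall (i j : I) (f g : hom i j),
        exists k (h : hom j k), comp h f = comp h g].

(* choiceType stands for sets as opposed to classes: its universe is the one *)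
(* of the underlying types of algebras, groups and graphs. A bare category I *)
(* could be as large as the category of algebras.                            *)
Definition small (I : category) : Prop :=
  (exists (T : choiceType) (f : I -> T), injective f) /\
  forall i j : I, exists (T : choiceType) (f : hom i j -> T), injective f.

Definition preserves_filtering_colimits (C D : category) (H : functor C D) :
    Prop :=
  forall (I : category) (F : functor I C) (c : C) (k : forall i, hom (F i) c),
    small I -> filtering I -> is_colimit k ->
    is_colimit (D := functor_comp H F) (fun i => fmap H (k i)).

Section AbCat.

Definition Ab_id (M : zmodType) : {additive M -> M} := idfun.
Definition Ab_comp (M N P : zmodType) (g : {additive N -> P})
  (f : {additive M -> N}) : {additive M -> P} := g \o f.

Definition Ab : category.
refine (@Category zmodType (fun M N => {additive M -> N}) Ab_id Ab_comp _ _ _);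
  by move=> *; exact: additive_eq.
Defined.

End AbCat.

Section StarAlgCat.
Variable l : invRing.

Definition starHom_id (A : starAlg l) : starHom A A.
Proof. by exists (idfun : A -> A) => //; exact: linearP. Defined.

Definition starHom_comp (A B C : starAlg l) (g : starHom B C)
  (f : starHom A B) : starHom A C.
Proof.
exists (g \o f : A -> C).
- exact: linearP.
- by move=> x y; rewrite /= !shomM.
- by move=> x; rewrite /= !shom_star.
Defined.

Definition starAlgCat : category.
refine (@Category (starAlg l) (@starHom l) starHom_id starHom_comp _ _ _);
  by move=> *; exact: starHom_eq.
Defined.

Definition base_alg : starAlg l.
Proof.
refine (@StarAlg l l^o (fun x y => x * y) conj _ _ _ _ _ _ _ _ _).
- exact: mulrA.
- exact: mulrDl.
- exact: mulrDr.
- by move=> a x y; rewrite -[a *: x]/(a * x) -mulrA.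
- by move=> a x y; rewrite -[a *: y]/(a * y) mulrCA.
- exact: conjK.
- exact: rmorphD.
- by move=> a x; rewrite -[a *: x]/(a * x) rmorphM.
- by move=> x y; rewrite mulrC rmorphM.
Defined.

Definition prod_alg (A B : starAlg l) : starAlg l.
Proof.
refine (@StarAlg l (A * B)%type
  (fun x y => (amul x.1 y.1, amul x.2 y.2))
  (fun x => (astar x.1, astar x.2)) _ _ _ _ _ _ _ _ _).
- by move=> x y z; rewrite /= !amulA.
- by move=> x y z; rewrite /= !amulDl.
- by move=> x y z; rewrite /= !amulDr.
- by move=> a x y; rewrite /= !amulZl.
- by move=> a x y; rewrite /= !amulZr.
- by case=> x y; rewrite /= !astarK.
- by move=> x y; rewrite /= !astarD.
- by move=> a x; rewrite /= !astarZ.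
- by move=> x y; rewrite /= !astarM.
Defined.

Definition prod_fst (A B : starAlg l) : starHom (prod_alg A B) A.
Proof. by exists (fun x : prod_alg A B => x.1). Defined.

Definition prod_snd (A B : starAlg l) : starHom (prod_alg A B) B.
Proof. by exists (fun x : prod_alg A B => x.2). Defined.

End StarAlgCat.

(* << s *g (i, j) >> is the matrix with s as entry (i, j) and 0 elsewhere.   *)
Definition Minf (l : invRing) (A : starAlg l) : Type :=
  {malg A[(nat * nat)%type]}.

Section Minf.
Variables (l : invRing) (A : starAlg l).

HB.instance Definition _ := GRing.Zmodule.on (Minf A).

Implicit Types x y z : Minf A.

Definition Minf_scale (a : l) : Minf A -> Minf A :=
  lin (fun ij s => << a *: s *g ij >>).

Definition Minf_mul : Minf A -> Minf A -> Minf A :=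
  bilin (fun ij s kh t =>
    if ij.2 == kh.1 then << amul s t *g (ij.1, kh.2) >> else 0).

Definition Minf_star : Minf A -> Minf A :=
  lin (fun ij s => << astar s *g (ij.2, ij.1) >>).

Let scD a (ij : nat * nat) : {morph (fun s : A => << a *: s *g ij >>) : s t / s + t}.
Proof. by move=> s t; rewrite scalerDr monalgUD. Qed.

Let stD (ij : nat * nat) :
  {morph (fun s : A => << astar s *g (ij.2, ij.1) >>) : s t / s + t}.
Proof. by move=> s t; rewrite astarD monalgUD. Qed.

Let mDl (ij : nat * nat) (s1 s2 : A) (kh : nat * nat) (t : A) :
  (if ij.2 == kh.1 then << amul (s1 + s2) t *g (ij.1, kh.2) >> else 0) =
  (if ij.2 == kh.1 then << amul s1 t *g (ij.1, kh.2) >> else 0) +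
  (if ij.2 == kh.1 then << amul s2 t *g (ij.1, kh.2) >> else 0) :> Minf A.
Proof. by case: ifP => _; rewrite ?addr0 // amulDl monalgUD. Qed.

Let mDr (ij : nat * nat) (s : A) (kh : nat * nat) (t1 t2 : A) :
  (if ij.2 == kh.1 then << amul s (t1 + t2) *g (ij.1, kh.2) >> else 0) =
  (if ij.2 == kh.1 then << amul s t1 *g (ij.1, kh.2) >> else 0) +
  (if ij.2 == kh.1 then << amul s t2 *g (ij.1, kh.2) >> else 0) :> Minf A.
Proof. by case: ifP => _; rewrite ?addr0 // amulDr monalgUD. Qed.

Let scaleD a : {morph Minf_scale a : x y / x + y}.
Proof. exact: linD (scD a). Qed.
Let scale0 a : Minf_scale a 0 = 0. Proof. exact: lin0. Qed.

Lemma Minf_scaleU a ij s : Minf_scale a << s *g ij >> = << a *: s *g ij >>.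
Proof. exact: linU (scD a) _ _. Qed.

Lemma Minf_starD : {morph Minf_star : x y / x + y}.
Proof. exact: linD stD. Qed.
Let star0 : Minf_star 0 = 0. Proof. exact: lin0. Qed.

Lemma Minf_starU ij s : Minf_star << s *g ij >> = << astar s *g (ij.2, ij.1) >>.
Proof. exact: linU stD _ _. Qed.

Lemma Minf_mulDl : left_distributive Minf_mul +%R.
Proof. by move=> x y z; exact: bilinDl mDl _ _ _. Qed.
Lemma Minf_mulDr : right_distributive Minf_mul +%R.
Proof. by move=> x y z; exact: bilinDr mDr _ _ _. Qed.
Let mul0 x : Minf_mul 0 x = 0. Proof. exact: bilin0l. Qed.
Let mulx0 x : Minf_mul x 0 = 0. Proof. exact: bilin0r mDr _. Qed.

Lemma Minf_mulU ij s kh t : Minf_mul << s *g ij >> << t *g kh >> =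
  if ij.2 == kh.1 then << amul s t *g (ij.1, kh.2) >> else 0.
Proof. exact: bilinU mDl mDr _ _ _ _. Qed.

Lemma Minf_scaleA a b x : Minf_scale a (Minf_scale b x) = Minf_scale (a * b) x.
Proof.
elim/malg_ind: x => [|x1 x2 IH1 IH2|s ij]; first by rewrite !scale0.
  by rewrite !scaleD IH1 IH2.
by rewrite !Minf_scaleU scalerA.
Qed.

Lemma Minf_scale1 : left_id 1 Minf_scale.
Proof.
elim/malg_ind => [|x1 x2 IH1 IH2|s ij]; first by rewrite scale0.
  by rewrite scaleD IH1 IH2.
by rewrite Minf_scaleU scale1r.
Qed.

Lemma Minf_scaleDl x : {morph Minf_scale^~ x : a b / a + b}.
Proof.
move=> a b; elim/malg_ind: x => [|x1 x2 IH1 IH2|s ij].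
- by rewrite !scale0 addr0.
- by rewrite !scaleD IH1 IH2 addrACA.
- by rewrite !Minf_scaleU scalerDl monalgUD.
Qed.

HB.instance Definition _ := GRing.Zmodule_isLmodule.Build l (Minf A)
  Minf_scaleA Minf_scale1 scaleD Minf_scaleDl.

Lemma MinfZU (a : l) ij s : a *: (<< s *g ij >> : Minf A) = << a *: s *g ij >>.
Proof. exact: Minf_scaleU. Qed.

Lemma Minf_mulA : associative Minf_mul.
Proof.
move=> x y z; elim/malg_ind: x => [|x1 x2 IH1 IH2|s ij]; first by rewrite !mul0.
  by rewrite !Minf_mulDl IH1 IH2.
elim/malg_ind: y => [|y1 y2 IH1 IH2|t kh]; first by rewrite mul0 mulx0 mul0.
  by rewrite Minf_mulDl !Minf_mulDr Minf_mulDl IH1 IH2.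
elim/malg_ind: z => [|z1 z2 IH1 IH2|u mn]; first by rewrite !mulx0.
  by rewrite !Minf_mulDr IH1 IH2.
rewrite !Minf_mulU; case: ifP => e1; case: ifP => e2;
  by rewrite ?mul0 ?mulx0 // !Minf_mulU /= ?e1 ?e2 // amulA.
Qed.

Lemma Minf_mulZl a x y : Minf_mul (a *: x) y = a *: Minf_mul x y.
Proof.
elim/malg_ind: x => [|x1 x2 IH1 IH2|s ij]; first by rewrite scaler0 mul0 scaler0.
  by rewrite scalerDr !Minf_mulDl IH1 IH2 scalerDr.
elim/malg_ind: y => [|y1 y2 IH1 IH2|t kh]; first by rewrite !mulx0 scaler0.
  by rewrite !Minf_mulDr IH1 IH2 scalerDr.
rewrite MinfZU !Minf_mulU.
by case: ifP => _; rewrite ?scaler0 // MinfZU amulZl.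
Qed.

Lemma Minf_mulZr a x y : Minf_mul x (a *: y) = a *: Minf_mul x y.
Proof.
elim/malg_ind: x => [|x1 x2 IH1 IH2|s ij]; first by rewrite !mul0 scaler0.
  by rewrite !Minf_mulDl IH1 IH2 scalerDr.
elim/malg_ind: y => [|y1 y2 IH1 IH2|t kh]; first by rewrite scaler0 mulx0 scaler0.
  by rewrite scalerDr !Minf_mulDr IH1 IH2 scalerDr.
rewrite MinfZU !Minf_mulU.
by case: ifP => _; rewrite ?scaler0 // MinfZU amulZr.
Qed.

Lemma Minf_starK : involutive Minf_star.
Proof.
elim/malg_ind => [|x1 x2 IH1 IH2|s [i j]]; first by rewrite !star0.
  by rewrite !Minf_starD IH1 IH2.
by rewrite !Minf_starU astarK.
Qed.

Lemma Minf_starZ a x : Minf_star (a *: x) = conj a *: Minf_star x.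
Proof.
elim/malg_ind: x => [|x1 x2 IH1 IH2|s ij]; first by rewrite scaler0 star0 scaler0.
  by rewrite scalerDr !Minf_starD IH1 IH2 scalerDr.
by rewrite MinfZU !Minf_starU astarZ MinfZU.
Qed.

Lemma Minf_starM x y : Minf_star (Minf_mul x y) = Minf_mul (Minf_star y) (Minf_star x).
Proof.
elim/malg_ind: x => [|x1 x2 IH1 IH2|s ij]; first by rewrite mul0 star0 mulx0.
  by rewrite Minf_mulDl !Minf_starD IH1 IH2 Minf_mulDr.
elim/malg_ind: y => [|y1 y2 IH1 IH2|t kh]; first by rewrite mulx0 star0 mul0.
  by rewrite Minf_mulDr !Minf_starD IH1 IH2 Minf_mulDl.
rewrite Minf_mulU !Minf_starU Minf_mulU eq_sym /=.
by case: ifP => _; rewrite ?star0 // Minf_starU astarM.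
Qed.

Definition Minf_alg : starAlg l :=
  @StarAlg l (Minf A) Minf_mul Minf_star Minf_mulA Minf_mulDl Minf_mulDr
    Minf_mulZl Minf_mulZr Minf_starK Minf_starD Minf_starZ Minf_starM.

Definition corner (i : nat) : starHom A Minf_alg.
Proof.
exists (fun s : A => << s *g (i, i) >> : Minf A).
- by move=> a s t; rewrite MinfZU monalgUD.
- by move=> s t; rewrite [RHS]Minf_mulU /= eqxx.
- by move=> s; rewrite [RHS]Minf_starU.
Defined.

End Minf.

Section HomologyTheories.
Variables (l : invRing) (H : functor (starAlgCat l) Ab).

Definition Hob (A : starAlg l) : zmodType := H A.

Definition Hmap (A B : starAlg l) (f : starHom A B) : {additive Hob A -> Hob B} :=
  fmap H (f : @hom (starAlgCat l) A B).

Lemma Hmap1 A x : Hmap (starHom_id A) x = x.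
Proof. by rewrite /Hmap (fmap1 H A). Qed.

Lemma HmapM A B C (g : starHom B C) (f : starHom A B) x :
  Hmap (starHom_comp g f) x = Hmap g (Hmap f x).
Proof. by rewrite /Hmap (@fmapM _ _ H A B C g f). Qed.

Definition Minf_stable : Prop :=
  forall (A : starAlg l) (i : nat), bijective (Hmap (corner A i)).

Definition additive_functor : Prop :=
  forall A B : starAlg l, bijective
    (fun z => (Hmap (prod_fst A B) z, Hmap (prod_snd A B) z)).

End HomologyTheories.

Record graph := Graph {
  vert : choiceType;
  edge : choiceType;
  src : edge -> vert;
  rng : edge -> vert
}.
Arguments src {_}.
Arguments rng {_}.

Definition out_edges (E : graph) (v : vert E) : set (edge E) :=
  [set e | src e = v]%classic.

Definition row_finite (E : graph) : Prop :=
  forall v : vert E, finite_set (out_edges v).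

Definition regular_vertex (E : graph) (v : vert E) : Prop :=
  finite_set (out_edges v) /\ (out_edges v !=set0)%classic.

Record graphIso (E F : graph) := GraphIso {
  iso_vert : vert E -> vert F;
  iso_edge : edge E -> edge F;
  iso_vert_bij : bijective iso_vert;
  iso_edge_bij : bijective iso_edge;
  iso_src : forall e, src (iso_edge e) = iso_vert (src e);
  iso_rng : forall e, rng (iso_edge e) = iso_vert (rng e)
}.

(* L(E) is the type of the expressions in the generators and the operations  *)
(* of a (not necessarily unital) l-algebra, modulo the smallest congruence   *)
(* that contains the axioms of l-algebras and the defining relations.        *)
Section Leavitt.
Variables (l : invRing) (E : graph).

Inductive lterm : Type :=
| LVert of vert E
| LEdge of edge E
| LGhost of edge E
| LZero
| LAdd of lterm & lterm
| LOpp of lterm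
| LMul of lterm & lterm
| LScale of l & lterm.

Inductive lrel : lterm -> lterm -> Prop :=
| lrel_refl s : lrel s s
| lrel_sym s t : lrel s t -> lrel t s
| lrel_trans s t u : lrel s t -> lrel t u -> lrel s u
| lrel_add s s' t t' : lrel s s' -> lrel t t' -> lrel (LAdd s t) (LAdd s' t')
| lrel_opp s s' : lrel s s' -> lrel (LOpp s) (LOpp s')
| lrel_mul s s' t t' : lrel s s' -> lrel t t' -> lrel (LMul s t) (LMul s' t')
| lrel_scale a s s' : lrel s s' -> lrel (LScale a s) (LScale a s')
| lrel_addA s t u : lrel (LAdd s (LAdd t u)) (LAdd (LAdd s t) u)
| lrel_addC s t : lrel (LAdd s t) (LAdd t s)
| lrel_add0 s : lrel (LAdd LZero s) s
| lrel_addN s : lrel (LAdd (LOpp s) s) LZero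
| lrel_scaleA a b s : lrel (LScale a (LScale b s)) (LScale (a * b) s)
| lrel_scale1 s : lrel (LScale 1 s) s
| lrel_scaleDr a s t :
    lrel (LScale a (LAdd s t)) (LAdd (LScale a s) (LScale a t))
| lrel_scaleDl a b s :
    lrel (LScale (a + b) s) (LAdd (LScale a s) (LScale b s))
| lrel_mulA s t u : lrel (LMul s (LMul t u)) (LMul (LMul s t) u)
| lrel_mulDl s t u : lrel (LMul (LAdd s t) u) (LAdd (LMul s u) (LMul t u))
| lrel_mulDr s t u : lrel (LMul s (LAdd t u)) (LAdd (LMul s t) (LMul s u))
| lrel_mulZl a s t : lrel (LMul (LScale a s) t) (LScale a (LMul s t))
| lrel_mulZr a s t : lrel (LMul s (LScale a t)) (LScale a (LMul s t))
| lrel_vv v : lrel (LMul (LVert v) (LVert v)) (LVert v)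
| lrel_vw v w : v <> w -> lrel (LMul (LVert v) (LVert w)) LZero
| lrel_src_edge e : lrel (LMul (LVert (src e)) (LEdge e)) (LEdge e)
| lrel_edge_rng e : lrel (LMul (LEdge e) (LVert (rng e))) (LEdge e)
| lrel_rng_ghost e : lrel (LMul (LVert (rng e)) (LGhost e)) (LGhost e)
| lrel_ghost_src e : lrel (LMul (LGhost e) (LVert (src e))) (LGhost e)
| lrel_CK1 e : lrel (LMul (LGhost e) (LEdge e)) (LVert (rng e))
| lrel_CK1_neq e f : e <> f -> lrel (LMul (LGhost e) (LEdge f)) LZero
| lrel_CK2 v (es : seq (edge E)) :
    regular_vertex v -> uniq es -> (forall e, e \in es <-> src e = v) ->
    lrel (LVert v) (\big[LAdd/LZero]_(e <- es) LMul (LEdge e) (LGhost e)).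

HB.instance Definition _ := gen_eqMixin lterm.
HB.instance Definition _ := gen_choiceMixin lterm.

Definition lrelb : rel lterm := fun s t => `[< lrel s t >].

Lemma lrelb_equiv : equiv_class_of lrelb.
Proof.
split=> [s|s t|t s u].
- by apply/asboolP; exact: lrel_refl.
- by apply/asboolP/asboolP; exact: lrel_sym.
- by move=> /asboolP st /asboolP tu; apply/asboolP; exact: lrel_trans st tu.
Qed.

Canonical lrelb_equiv_rel := EquivRelPack lrelb_equiv.
Canonical lrelb_encModRel := defaultEncModRel lrelb.

Definition lpa : Type := {eq_quot lrelb}.

HB.instance Definition _ := Choice.on lpa.
HB.instance Definition _ : EqQuotient lterm lrelb lpa := EqQuotient.on lpa.

Lemma lpaP s t : \pi_lpa s = \pi_lpa t <-> lrel s t.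
Proof.
by split=> [/eqP|st]; [rewrite piE => /asboolP|apply/eqP; rewrite piE; exact/asboolP].
Qed.

Lemma lrel_repr s : lrel (repr (\pi_lpa s)) s.
Proof. by apply/lpaP; rewrite reprK. Qed.

Definition lpa_zero : lpa := \pi_lpa LZero.
Definition lpa_opp (x : lpa) : lpa := \pi_lpa (LOpp (repr x)).
Definition lpa_add (x y : lpa) : lpa := \pi_lpa (LAdd (repr x) (repr y)).
Definition lpa_mul (x y : lpa) : lpa := \pi_lpa (LMul (repr x) (repr y)).
Definition lpa_scale (a : l) (x : lpa) : lpa := \pi_lpa (LScale a (repr x)).

Lemma lpa_oppE s : lpa_opp (\pi_lpa s) = \pi_lpa (LOpp s).
Proof. by apply/lpaP; apply: lrel_opp; exact: lrel_repr. Qed.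
Lemma lpa_addE s t : lpa_add (\pi_lpa s) (\pi_lpa t) = \pi_lpa (LAdd s t).
Proof. by apply/lpaP; apply: lrel_add; exact: lrel_repr. Qed.
Lemma lpa_mulE s t : lpa_mul (\pi_lpa s) (\pi_lpa t) = \pi_lpa (LMul s t).
Proof. by apply/lpaP; apply: lrel_mul; exact: lrel_repr. Qed.
Lemma lpa_scaleE a s : lpa_scale a (\pi_lpa s) = \pi_lpa (LScale a s).
Proof. by apply/lpaP; apply: lrel_scale; exact: lrel_repr. Qed.

Lemma lpa_addA : associative lpa_add.
Proof.
elim/quotW => s; elim/quotW => t; elim/quotW => u.
by rewrite (lpa_addE t u) (lpa_addE s t) !lpa_addE; apply/lpaP; exact: lrel_addA.
Qed.

Lemma lpa_addC : commutative lpa_add.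
Proof.
by elim/quotW => s; elim/quotW => t; rewrite !lpa_addE; apply/lpaP; exact: lrel_addC.
Qed.

Lemma lpa_add0 : left_id lpa_zero lpa_add.
Proof. by elim/quotW => s; rewrite lpa_addE; apply/lpaP; exact: lrel_add0. Qed.

Lemma lpa_addN : left_inverse lpa_zero lpa_opp lpa_add.
Proof.
by elim/quotW => s; rewrite lpa_oppE lpa_addE; apply/lpaP; exact: lrel_addN.
Qed.

HB.instance Definition _ :=
  GRing.isZmodule.Build lpa lpa_addA lpa_addC lpa_add0 lpa_addN.

Let addE s t : \pi_lpa s + \pi_lpa t = \pi_lpa (LAdd s t).
Proof. exact: lpa_addE. Qed.

Lemma lpa_scaleA a b x : lpa_scale a (lpa_scale b x) = lpa_scale (a * b) x.
Proof.
elim/quotW: x => s; rewrite (lpa_scaleE b) !lpa_scaleE.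
by apply/lpaP; exact: lrel_scaleA.
Qed.

Lemma lpa_scale1 : left_id 1 lpa_scale.
Proof. by elim/quotW => s; rewrite lpa_scaleE; apply/lpaP; exact: lrel_scale1. Qed.

Lemma lpa_scaleDr : right_distributive lpa_scale +%R.
Proof.
move=> a; elim/quotW => s; elim/quotW => t; rewrite addE !lpa_scaleE addE.
by apply/lpaP; exact: lrel_scaleDr.
Qed.

Lemma lpa_scaleDl x : {morph lpa_scale^~ x : a b / a + b}.
Proof.
move=> a b; elim/quotW: x => s; rewrite !lpa_scaleE addE.
by apply/lpaP; exact: lrel_scaleDl.
Qed.

HB.instance Definition _ := GRing.Zmodule_isLmodule.Build l lpa
  lpa_scaleA lpa_scale1 lpa_scaleDr lpa_scaleDl.

Let scaleE a s : a *: \pi_lpa s = \pi_lpa (LScale a s).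
Proof. exact: lpa_scaleE. Qed.

Lemma lpa_mulA : associative lpa_mul.
Proof.
elim/quotW => s; elim/quotW => t; elim/quotW => u.
by rewrite (lpa_mulE t u) (lpa_mulE s t) !lpa_mulE; apply/lpaP; exact: lrel_mulA.
Qed.

Lemma lpa_mulDl : left_distributive lpa_mul +%R.
Proof.
elim/quotW => s; elim/quotW => t; elim/quotW => u; rewrite addE !lpa_mulE addE.
by apply/lpaP; exact: lrel_mulDl.
Qed.

Lemma lpa_mulDr : right_distributive lpa_mul +%R.
Proof.
elim/quotW => s; elim/quotW => t; elim/quotW => u; rewrite addE !lpa_mulE addE.
by apply/lpaP; exact: lrel_mulDr.
Qed.

Lemma lpa_mulZl a x y : lpa_mul (a *: x) y = a *: lpa_mul x y.
Proof.
elim/quotW: x => s; elim/quotW: y => t; rewrite scaleE !lpa_mulE scaleE.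
by apply/lpaP; exact: lrel_mulZl.
Qed.

Lemma lpa_mulZr a x y : lpa_mul x (a *: y) = a *: lpa_mul x y.
Proof.
elim/quotW: x => s; elim/quotW: y => t; rewrite scaleE !lpa_mulE scaleE.
by apply/lpaP; exact: lrel_mulZr.
Qed.

Fixpoint lstar (s : lterm) : lterm :=
  match s with
  | LVert v => LVert v
  | LEdge e => LGhost e
  | LGhost e => LEdge e
  | LZero => LZero
  | LAdd s t => LAdd (lstar s) (lstar t)
  | LOpp s => LOpp (lstar s)
  | LMul s t => LMul (lstar t) (lstar s)
  | LScale a s => LScale (conj a) (lstar s)
  end.

Lemma lrel_star s t : lrel s t -> lrel (lstar s) (lstar t).
Proof.
elim=> {s t} /=; try by intros; eauto using lrel.
- by move=> a b s; rewrite rmorphM; exact: lrel_scaleA.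
- by move=> s; rewrite rmorph1; exact: lrel_scale1.
- by move=> a b s; rewrite rmorphD; exact: lrel_scaleDl.
move=> v es vreg es_uniq esv.
rewrite (_ : lstar (\big[_/_]_(e <- es) _) =
  \big[LAdd/LZero]_(e <- es) LMul (LEdge e) (LGhost e)).
  exact: lrel_CK2.
by rewrite (big_morph lstar (id1 := LZero) (op1 := LAdd)).
Qed.

Definition lpa_star (x : lpa) : lpa := \pi_lpa (lstar (repr x)).

Lemma lpa_starE s : lpa_star (\pi_lpa s) = \pi_lpa (lstar s).
Proof. by apply/lpaP; apply: lrel_star; exact: lrel_repr. Qed.

Lemma lstarK : involutive lstar.
Proof. by elim=> //= [s -> t ->|s ->|s -> t ->|a s ->] //; rewrite conjK. Qed.

Lemma lpa_starK : involutive lpa_star.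
Proof. by elim/quotW => s; rewrite (lpa_starE s) lpa_starE lstarK. Qed.

Lemma lpa_starD : {morph lpa_star : x y / x + y}.
Proof. by elim/quotW => s; elim/quotW => t; rewrite addE !lpa_starE addE. Qed.

Lemma lpa_starZ a x : lpa_star (a *: x) = conj a *: lpa_star x.
Proof. by elim/quotW: x => s; rewrite scaleE !lpa_starE scaleE. Qed.

Lemma lpa_starM x y : lpa_star (lpa_mul x y) = lpa_mul (lpa_star y) (lpa_star x).
Proof.
by elim/quotW: x => s; elim/quotW: y => t; rewrite lpa_mulE !lpa_starE lpa_mulE.
Qed.

Definition leavitt : starAlg l :=
  @StarAlg l lpa lpa_mul lpa_star lpa_mulA lpa_mulDl lpa_mulDr
    lpa_mulZl lpa_mulZr lpa_starK lpa_starD lpa_starZ lpa_starM.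

End Leavitt.

Section LeavittMap.
Variables (l : invRing) (E F : graph) (phi : graphIso E F).

Fixpoint lterm_map (s : lterm l E) : lterm l F :=
  match s with
  | LVert v => LVert l (iso_vert phi v)
  | LEdge e => LEdge l (iso_edge phi e)
  | LGhost e => LGhost l (iso_edge phi e)
  | LZero => LZero l F
  | LAdd s t => LAdd (lterm_map s) (lterm_map t)
  | LOpp s => LOpp (lterm_map s)
  | LMul s t => LMul (lterm_map s) (lterm_map t)
  | LScale a s => LScale a (lterm_map s)
  end.

Lemma lrel_map s t : lrel s t -> lrel (lterm_map s) (lterm_map t).
Proof.
have vinj := bij_inj (iso_vert_bij phi); have einj := bij_inj (iso_edge_bij phi).
elim=> {s t} /=; try by intros; eauto using lrel.
- by move=> e; rewrite -iso_src; exact: lrel_src_edge.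
- by move=> e; rewrite -iso_rng; exact: lrel_edge_rng.
- by move=> e; rewrite -iso_rng; exact: lrel_rng_ghost.
- by move=> e; rewrite -iso_src; exact: lrel_ghost_src.
- by move=> e; rewrite -iso_rng; exact: lrel_CK1.
- move=> v es [_ [e0 e0v]] es_uniq esv.
  have memP e : e \in map (iso_edge phi) es <-> src e = iso_vert phi v.
    have [g ge eg] := iso_edge_bij phi.
    rewrite -[e]eg (mem_map einj) iso_src esv.
    by split=> [->|/vinj].
  rewrite (big_morph lterm_map (id1 := LZero l F) (op1 := @LAdd l F)) //=.
  rewrite -(big_map (iso_edge phi) xpredT (fun e => LMul (LEdge l e) (LGhost l e))).
  apply: lrel_CK2 => //; last by rewrite map_inj_uniq.
  split; last by exists (iso_edge phi e0); rewrite /out_edges /= iso_src e0v.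
  apply: (sub_finite_set (B := [set` map (iso_edge phi) es]%classic)); last exact: finite_seq.
  by move=> e /memP.
Qed.

Definition leavitt_map_fun (x : leavitt l E) : leavitt l F :=
  \pi_(lpa l F) (lterm_map (repr (x : lpa l E))).

Lemma leavitt_mapE s :
  leavitt_map_fun (\pi_(lpa l E) s) = \pi_(lpa l F) (lterm_map s).
Proof. by apply/lpaP; apply: lrel_map; exact: lrel_repr. Qed.

Definition leavitt_map : starHom (leavitt l E) (leavitt l F).
Proof.
exists leavitt_map_fun.
- move=> a; elim/quotW => s; elim/quotW => t.
  rewrite [a *: _]lpa_scaleE [X in leavitt_map_fun X]lpa_addE !leavitt_mapE.
  by rewrite [a *: _]lpa_scaleE [RHS]lpa_addE.
- elim/quotW => s; elim/quotW => t.
  by rewrite [amul _ _]lpa_mulE !leavitt_mapE [RHS]lpa_mulE.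
- elim/quotW => s.
  rewrite [astar _]lpa_starE !leavitt_mapE [RHS]lpa_starE; congr (\pi_(lpa l F) _).
  by elim: s => //= [s -> t ->|s ->|s -> t ->|a s ->].
Defined.

End LeavittMap.

Definition covering (E : graph) (w : edge E -> int) : graph :=
  @Graph (vert E * int)%type (edge E * int)%type
    (fun e => (src e.1, e.2)) (fun e => (rng e.1, e.2 + w e.1)).

Section Shift.
Variables (l : invRing) (E : graph) (w : edge E -> int).

Definition shift (n : int) : graphIso (covering w) (covering w).
Proof.
exists (fun v : vert (covering w) => (v.1, v.2 + n))
       (fun e : edge (covering w) => (e.1, e.2 + n)) => //=.
- by exists (fun v => (v.1, v.2 - n)) => -[v m] /=; rewrite ?addrK ?subrK.
- by exists (fun e => (e.1, e.2 - n)) => -[e m] /=; rewrite ?addrK ?subrK.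
- by move=> e; rewrite addrAC.
Defined.

Lemma leavitt_shift0 (x : leavitt l (covering w)) :
  leavitt_map l (shift 0) x = x.
Proof.
elim/quotW: x => s; rewrite [LHS]leavitt_mapE; congr (\pi_(lpa _ _) _).
by elim: s => //= [[v m]|[e m]|[e m]|s -> t ->|s ->|s -> t ->|a s ->] //=;
  rewrite addr0.
Qed.

Lemma leavitt_shiftD m n (x : leavitt l (covering w)) :
  leavitt_map l (shift (m + n)) x =
  leavitt_map l (shift m) (leavitt_map l (shift n) x).
Proof.
elim/quotW: x => s; rewrite [LHS]leavitt_mapE.
rewrite [X in _ = leavitt_map _ _ X]leavitt_mapE [RHS]leavitt_mapE.
congr (\pi_(lpa _ _) _).
by elim: s => //= [[v k]|[e k]|[e k]|s -> t ->|s ->|s -> t ->|a s ->] //=;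
  rewrite addrA addrAC.
Qed.

End Shift.

Definition Zsigma : comNzRingType := groupRing int.
Definition sigma : Zsigma := << (1 : int) *g (1 : int) >>.

(* The action of the group ring is given by the one of the group: n : int is *)
(* sigma ^ n, which acts by the map that shift n induces, see sigma_scaleE.  *)
Section HCovering.
Variables (l : invRing) (H : functor (starAlgCat l) Ab) (E : graph).

Definition unit_covering : graph := covering (fun _ : edge E => 1).

Definition HL_action : groupAction int (Hob H (leavitt l unit_covering)).
Proof.
exists (fun n => Hmap H (leavitt_map l (shift (fun _ : edge E => 1) n))).
- move=> m; rewrite -[RHS]Hmap1.
  by congr (Hmap H _ m); apply: starHom_eq => x; exact: leavitt_shift0.
- move=> g h m; rewrite -[RHS]HmapM.
  by congr (Hmap H _ m); apply: starHom_eq => x; exact: leavitt_shiftD.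
Defined.

Definition HL_covering : lmodType Zsigma := actMod HL_action.

Lemma sigma_scaleE (x : HL_covering) :
  sigma *: x = Hmap H (leavitt_map l (shift (fun _ : edge E => 1) 1)) x.
Proof. exact: actscaleU. Qed.

End HCovering.

Section BowenFranks.
Variable E : graph.

Definition reg : choiceType := {v : vert E | `[< regular_vertex v >]}.

Definition adjacency (v : reg) (w : vert E) : int :=
  (#|` fset_set [set e : edge E | src e = val v /\ rng e = w]%classic |%fset)%:Z.

Definition idmat (v : vert E) (w : reg) : int := (v == val w)%:Z.

Definition BF_matrix (w : vert E) (v : reg) : Zsigma :=
  (idmat w v)%:~R - sigma * (adjacency v w)%:~R.

Lemma BF_matrix_colfin (v : reg) :
  finite_set [set w | BF_matrix w v != 0]%classic.
Proof.
have [vfin _] := asboolP _ (valP v).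
apply: (sub_finite_set (B := ([set val v] `|` rng @` out_edges (val v))%classic)).
  move=> w; rewrite /BF_matrix /idmat /adjacency /=.
  have [->|wv] := eqVneq w (val v); first by left.
  have [[e [ev ew]]|nowv] := pselect (exists e, src e = val v /\ rng e = w).
    by right; exists e.
  rewrite (_ : [set e | _]%classic = set0) ?fset_set0 ?cardfs0.
    by rewrite !mulr0z mulr0 subr0 eqxx.
  by rewrite -subset0 => e /= ?; apply: nowv; exists e.
rewrite finite_setU; split; [exact: finite_set1|exact: finite_image].
Qed.

Definition BF_gr : lmodType Zsigma :=
  coker (mxact BF_matrix : {linear {malg Zsigma[reg]} -> {malg Zsigma[vert E]}}).

End BowenFranks.

(* Main.v *)
Require Import Defs.
From HB Require Import structures.
From mathcomp Require Import all_boot all_order all_algebra.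
From mathcomp Require Import finmap.
From mathcomp Require Import boolp classical_sets functions cardinality fsbigop.
From mathcomp Require Import monalg.
From mathcomp Require Import zify.

Set Implicit Arguments.
Unset Strict Implicit.
Unset Printing Implicit Defensive.

Import Order.TTheory GRing.Theory Num.Theory.
Local Open Scope ring_scope.
Local Open Scope quotient_scope.

(** Write F for the covering of E. Every edge of F raises the second coordinate
    of vertices, the level, by one, so F has no cycles, and L(F) is a union of
    finite direct sums of matrix algebras, one summand for each end vertex of
    certain paths. The value of H at such a sum is a sum of copies of H(l), and
    the union is filtering. The theorem computes the resulting colimit.

    In detail, a vertex v of F is a projection of L(F), hence a homomorphism
    from l to L(F), hence a map [v] : H(l) -> H(L(F)). If v is regular, then v
    is the orthogonal sum of the projections e e*, over the edges e out of v,
    and e* is a partial isometry from e e* to r(e). Additivity of H and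
    stability of H give [v] = sum_e [r(e)] (vertex_relation). The main point is
    that H(L(F)) is universal for this relation: additive maps out of H(L(F))
    are determined by what they do on the vertices (leavitt_gen), and any family
    of maps g v : H(l) -> M with g v = sum_e g (r e) comes from one of them
    (leavitt_ext).

    To prove this, fix a finite set X of vertices and a level n, and consider
    the finitely many paths that start in X and that stop at level n, or at a
    sink of level at most n. The matrix units e_(a,b), for such paths a and b
    with the same end, span a block algebra A(X,n). Prolonging a and b by the
    same path, in all ways that reach the level n', defines a homomorphism from
    A(X,n) to A(X',n'), and e_(a,b) is sent to a b* in L(F). Since L(F) is given
    by generators and relations, that L(F) is the colimit of the A(X,n) can be
    verified on universal properties (cone_colimit): a cocone on the A(X,n) has
    values at the generators of L(F), and these satisfy the relations.

    The block algebras are treated for arbitrary partial equivalence relations R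
    on an index set, with a matrix unit for each related pair. In this form
    M_oo of the block algebra of R is the block algebra of nat x R, and the
    consequences of stability become statements about injections of index
    sets: related injections induce the same map (Hmap_conj), and full corners
    induce isomorphisms (Hmap_full). For R with finite support they reduce H of
    the block algebra to a finite power of l, which additivity of H handles
    (block_gen, block_ext).

    At last, the vertex v_n of F corresponds to sigma^n v in the free module
    Z[sigma]^(E^0), and under this identification the relations of F are those
    that the columns of I - sigma A^t impose in the cokernel (bf_relation).
    This gives maps in both directions between H(L(F)) and the tensor product,
    inverse to each other, and compatible with sigma. *)

(** * Block algebras of partial equivalence relations *)

(** A partial equivalence relation encodes a subset of K, the a with R a a,
    together with a partition of it. One K then carries many index sets, and the
    matrix units are functions on all of K * K. *)
Record per (K : choiceType) := Per {
  per_rel :> rel K;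
  per_sym : symmetric per_rel;
  per_trans : transitive per_rel
}.

Lemma per_refl (K : choiceType) (R : per K) a b : R a b -> R a a.
Proof. by move=> ab; apply: (per_trans ab); rewrite per_sym. Qed.

Section Block.
Variables (l : invRing) (K : choiceType) (R : per K).

(** One matrix block for each class of R, with entries in l. *)
Definition related_pair : choiceType := {p : (K * K)%type | R p.1 p.2}.
Definition block : Type := {malg l[related_pair]}.

HB.instance Definition _ := GRing.Zmodule.on block.

End Block.

(** The matrix with x as entry (a, b) and 0 elsewhere. It is 0 for unrelated a
    and b, so that sums of entries need no side conditions. *)
HB.lock Definition entry (l : invRing) (K : choiceType) (R : per K)
    (x : l) (a b : K) : block l R :=
  if insub (a, b) is Some p then << x *g (p : related_pair R) >> else 0.
Arguments entry {l K} R x a b.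

HB.lock Definition block_lift (l : invRing) (K : choiceType) (R : per K)
    (M : zmodType) (c : l -> K -> K -> M) (x : block l R) : M :=
  lin (fun p x => c x (val p).1 (val p).2) x.

HB.lock Definition block_mul (l : invRing) (K : choiceType) (R : per K) :
    block l R -> block l R -> block l R :=
  bilin (fun p x q y => if (val p).2 == (val q).1
                        then entry R (x * y) (val p).1 (val q).2 else 0).

Section BlockAlgebra.
Variables (l : invRing) (K : choiceType) (R : per K).
Local Notation block := (block l R).
Local Notation related_pair := (related_pair R).
Local Notation entry := (@entry l K R).
Local Notation block_mul := (@block_mul l K R).
Local Notation block_lift := (@block_lift l K R _).

Lemma entryD a b : {morph (fun x => entry x a b) : x y / x + y}.
Proof.
move=> x y; rewrite entry.unlock; case: insubP => [p _ _|_]; last by rewrite addr0.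
by rewrite monalgUD.
Qed.

Lemma entry0 a b : entry 0 a b = 0.
Proof. by apply: (addIr (entry 0 a b)); rewrite -entryD !add0r. Qed.

Lemma entry_out x a b : ~~ R a b -> entry x a b = 0.
Proof. by move=> /negP nab; rewrite entry.unlock; case: insubP. Qed.

Lemma entryE x (p : related_pair) : << x *g p >> = entry x (val p).1 (val p).2.
Proof. by rewrite entry.unlock -surjective_pairing valK. Qed.

Lemma block_ind (P : block -> Prop) :
  P 0 -> (forall x y, P x -> P y -> P (x + y)) ->
  (forall x a b, R a b -> P (entry x a b)) -> forall x, P x.
Proof.
move=> P0 PD PE; apply: malg_ind => // x p; rewrite entryE; apply: PE.
exact: valP p.
Qed.

Section Lift.
Variables (M : zmodType) (c : l -> K -> K -> M).
Hypothesis cD : forall a b, {morph (fun x => c x a b) : x y / x + y}.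

Let cD' (p : related_pair) :
  {morph (fun x => c x (val p).1 (val p).2) : x y / x + y}.
Proof. by move=> x y; rewrite cD. Qed.

Lemma block_liftD : {morph block_lift c : x y / x + y}.
Proof. by rewrite block_lift.unlock; exact: linD. Qed.

Lemma block_lift0 : block_lift c 0 = 0.
Proof. by rewrite block_lift.unlock; exact: lin0. Qed.

Lemma block_liftE x a b : R a b -> block_lift c (entry x a b) = c x a b.
Proof.
move=> ab; rewrite entry.unlock; case: insubP => [p _ pE|]; last by rewrite ab.
by rewrite block_lift.unlock linU // pE.
Qed.

End Lift.

Definition block_scale (a : l) : block -> block := block_lift (fun x => entry (a * x)).
Definition block_star : block -> block := block_lift (fun x a b => entry (conj x) b a).

Let scD r a b : {morph (fun x => entry (r * x) a b) : x y / x + y}.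
Proof. by move=> x y; rewrite mulrDr entryD. Qed.

Let stD a b : {morph (fun x => entry (conj x) b a) : x y / x + y}.
Proof. by move=> x y; rewrite rmorphD entryD. Qed.

Let mDl (p : related_pair) (x1 x2 : l) (q : related_pair) (y : l) :
  (if (val p).2 == (val q).1 then entry ((x1 + x2) * y) (val p).1 (val q).2 else 0) =
  (if (val p).2 == (val q).1 then entry (x1 * y) (val p).1 (val q).2 else 0) +
  (if (val p).2 == (val q).1 then entry (x2 * y) (val p).1 (val q).2 else 0).
Proof. by case: ifP => _; rewrite ?addr0 // mulrDl entryD. Qed.

Let mDr (p : related_pair) (x : l) (q : related_pair) (y1 y2 : l) :
  (if (val p).2 == (val q).1 then entry (x * (y1 + y2)) (val p).1 (val q).2 else 0) =
  (if (val p).2 == (val q).1 then entry (x * y1) (val p).1 (val q).2 else 0) +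
  (if (val p).2 == (val q).1 then entry (x * y2) (val p).1 (val q).2 else 0).
Proof. by case: ifP => _; rewrite ?addr0 // mulrDr entryD. Qed.

Let scaleD r : {morph block_scale r : x y / x + y}.
Proof. exact: block_liftD (scD r). Qed.
Let scale0 r : block_scale r 0 = 0. Proof. exact: block_lift0. Qed.
Let scaleE r x a b : R a b -> block_scale r (entry x a b) = entry (r * x) a b.
Proof. exact: block_liftE (scD r) _ _ _. Qed.
Lemma block_starD : {morph block_star : x y / x + y}.
Proof. exact: block_liftD stD. Qed.
Lemma block_star0 : block_star 0 = 0. Proof. exact: block_lift0. Qed.
Lemma block_starE x a b : R a b -> block_star (entry x a b) = entry (conj x) b a.
Proof. exact: block_liftE stD _ _ _. Qed.
Lemma block_mulDl : left_distributive block_mul +%R.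
Proof. by move=> x y z; rewrite block_mul.unlock; exact: bilinDl mDl _ _ _. Qed.
Lemma block_mulDr : right_distributive block_mul +%R.
Proof. by move=> x y z; rewrite block_mul.unlock; exact: bilinDr mDr _ _ _. Qed.
Lemma block_mul0 x : block_mul 0 x = 0. Proof. by rewrite block_mul.unlock; exact: bilin0l. Qed.
Lemma block_mulx0 x : block_mul x 0 = 0. Proof. by rewrite block_mul.unlock; exact: bilin0r mDr _. Qed.

Lemma block_mulE x a b y c d : R a b -> R c d ->
  block_mul (entry x a b) (entry y c d) = if b == c then entry (x * y) a d else 0.
Proof.
move=> ab cd; rewrite {1 2}entry.unlock block_mul.unlock.
case: insubP => [p _ pE|]; last by rewrite ab.
case: insubP => [q _ qE|]; last by rewrite cd.
by rewrite [LHS](bilinU mDl mDr) pE qE.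
Qed.

Lemma block_scaleA r s x : block_scale r (block_scale s x) = block_scale (r * s) x.
Proof.
elim/block_ind: x => [|x y IHx IHy|x a b ab]; first by rewrite !scale0.
  by rewrite !scaleD IHx IHy.
by rewrite !scaleE // mulrA.
Qed.

Lemma block_scale1 : left_id 1 block_scale.
Proof.
elim/block_ind => [|x y IHx IHy|x a b ab]; first by rewrite scale0.
  by rewrite scaleD IHx IHy.
by rewrite scaleE // mul1r.
Qed.

Lemma block_scaleDl x : {morph block_scale^~ x : r s / r + s}.
Proof.
move=> r s; elim/block_ind: x => [|x y IHx IHy|x a b ab].
- by rewrite !scale0 addr0.
- by rewrite !scaleD IHx IHy addrACA.
- by rewrite !scaleE // mulrDl entryD.
Qed.

HB.instance Definition _ := GRing.Zmodule_isLmodule.Build l block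
  block_scaleA block_scale1 scaleD block_scaleDl.

Lemma entryZ r x a b : r *: entry x a b = entry (r * x) a b.
Proof.
have [ab|nab] := boolP (R a b); first exact: scaleE.
by rewrite !(entry_out _ nab) scaler0.
Qed.

Lemma block_mulA : associative block_mul.
Proof.
move=> x y z; elim/block_ind: x => [|x1 x2 IH1 IH2|x a b ab]; first by rewrite !block_mul0.
  by rewrite !block_mulDl IH1 IH2.
elim/block_ind: y => [|y1 y2 IH1 IH2|y c d cd]; first by rewrite block_mul0 block_mulx0 block_mul0.
  by rewrite block_mulDl !block_mulDr block_mulDl IH1 IH2.
elim/block_ind: z => [|z1 z2 IH1 IH2|z e f ef]; first by rewrite !block_mulx0.
  by rewrite !block_mulDr IH1 IH2.
rewrite !block_mulE //.
case: (eqVneq b c) => [bc|bc]; case: (eqVneq d e) => [de|de]; rewrite ?block_mul0 ?block_mulx0 //.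
- subst c e.
  by rewrite !block_mulE ?eqxx ?mulrA //; [exact: per_trans ab cd|exact: per_trans cd ef].
- subst c; rewrite block_mulE ?(negbTE de) //; exact: per_trans ab cd.
- subst e; rewrite block_mulE ?(negbTE bc) //; exact: per_trans cd ef.
Qed.

Lemma block_mulZl r x y : block_mul (r *: x) y = r *: block_mul x y.
Proof.
elim/block_ind: x => [|x1 x2 IH1 IH2|x a b ab]; first by rewrite scaler0 block_mul0 scaler0.
  by rewrite scalerDr !block_mulDl IH1 IH2 scalerDr.
elim/block_ind: y => [|y1 y2 IH1 IH2|y c d cd]; first by rewrite !block_mulx0 scaler0.
  by rewrite !block_mulDr IH1 IH2 scalerDr.
rewrite entryZ !block_mulE //.
by case: ifP => _; rewrite ?scaler0 // entryZ mulrA.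
Qed.

Lemma block_mulZr r x y : block_mul x (r *: y) = r *: block_mul x y.
Proof.
elim/block_ind: x => [|x1 x2 IH1 IH2|x a b ab]; first by rewrite !block_mul0 scaler0.
  by rewrite !block_mulDl IH1 IH2 scalerDr.
elim/block_ind: y => [|y1 y2 IH1 IH2|y c d cd]; first by rewrite scaler0 block_mulx0 scaler0.
  by rewrite scalerDr !block_mulDr IH1 IH2 scalerDr.
rewrite entryZ !block_mulE //.
by case: ifP => _; rewrite ?scaler0 // entryZ mulrCA.
Qed.

Lemma block_starK : involutive block_star.
Proof.
elim/block_ind => [|x y IHx IHy|x a b ab]; first by rewrite !block_star0.
  by rewrite !block_starD IHx IHy.
by rewrite !block_starE ?conjK // per_sym.
Qed.

Lemma block_starZ r x : block_star (r *: x) = conj r *: block_star x.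
Proof.
elim/block_ind: x => [|x1 x2 IH1 IH2|x a b ab]; first by rewrite scaler0 block_star0 scaler0.
  by rewrite scalerDr !block_starD IH1 IH2 scalerDr.
by rewrite entryZ !block_starE // rmorphM entryZ.
Qed.

Lemma block_starM x y :
  block_star (block_mul x y) = block_mul (block_star y) (block_star x).
Proof.
elim/block_ind: x => [|x1 x2 IH1 IH2|x a b ab]; first by rewrite block_mul0 block_star0 block_mulx0.
  by rewrite block_mulDl !block_starD IH1 IH2 block_mulDr.
elim/block_ind: y => [|y1 y2 IH1 IH2|y c d cd]; first by rewrite block_mulx0 block_star0 block_mul0.
  by rewrite block_mulDr !block_starD IH1 IH2 block_mulDl.
rewrite block_mulE // !block_starE // block_mulE 1?per_sym // eq_sym.
case: eqP => [bc|_]; last by rewrite block_star0.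
by subst c; rewrite block_starE ?rmorphM 1?mulrC //; exact: per_trans ab cd.
Qed.

Definition block_alg : starAlg l :=
  @StarAlg l block block_mul block_star block_mulA block_mulDl block_mulDr
    block_mulZl block_mulZr block_starK block_starD block_starZ block_starM.

Definition munit (a b : K) : block_alg := entry 1 a b.

Lemma entry_unit x a b : entry x a b = x *: munit a b.
Proof. by rewrite [RHS]entryZ mulr1. Qed.

End BlockAlgebra.

Lemma starHom_compE (l : invRing) (A B C : starAlg l) (g : starHom B C)
  (f : starHom A B) x : starHom_comp g f x = g (f x).
Proof. by []. Qed.

Section StarHomTheory.
Variables (l : invRing) (A B : starAlg l) (f : starHom A B).

Lemma shomD x y : f (x + y) = f x + f y. Proof. exact: raddfD. Qed.
Lemma shom0 : f 0 = 0. Proof. exact: raddf0. Qed.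
Lemma shomZ a x : f (a *: x) = a *: f x. Proof. exact: linearZ_LR. Qed.
Lemma shom_sum (I : Type) (r : seq I) (P : pred I) (F : I -> A) :
  f (\sum_(i <- r | P i) F i) = \sum_(i <- r | P i) f (F i).
Proof. exact: raddf_sum. Qed.

End StarHomTheory.

Section StarAlgTheory.
Variables (l : invRing) (A : starAlg l).
Implicit Types x y : A.

Lemma amul0 x : amul 0 x = 0.
Proof. by apply: (addIr (amul 0 x)); rewrite -amulDl !add0r. Qed.

Lemma amulx0 x : amul x 0 = 0.
Proof. by apply: (addIr (amul x 0)); rewrite -amulDr !add0r. Qed.

Lemma astar0 : astar (0 : A) = 0.
Proof. by apply: (addIr (astar (0 : A))); rewrite -astarD !add0r. Qed.

Lemma amul_suml (I : Type) (r : seq I) (P : pred I) (F : I -> A) y :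
  amul (\sum_(i <- r | P i) F i) y = \sum_(i <- r | P i) amul (F i) y.
Proof.
by apply: (big_morph (fun x => amul x y)) => [u v|]; rewrite ?amul0 ?amulDl.
Qed.

Lemma amul_sumr (I : Type) (r : seq I) (P : pred I) (F : I -> A) x :
  amul x (\sum_(i <- r | P i) F i) = \sum_(i <- r | P i) amul x (F i).
Proof.
by apply: (big_morph (amul x)) => [u v|]; rewrite ?amulx0 ?amulDr.
Qed.

Lemma astar_sum (I : Type) (r : seq I) (P : pred I) (F : I -> A) :
  astar (\sum_(i <- r | P i) F i) = \sum_(i <- r | P i) astar (F i).
Proof. exact: (big_morph _ (@astarD l A) astar0). Qed.

End StarAlgTheory.

Section BlockHom.
Variables (l : invRing) (K : choiceType) (R : per K) (C : starAlg l).

Lemma block_hom_eq (f g : starHom (block_alg l R) C) :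
  (forall a b, R a b -> f (munit l R a b) = g (munit l R a b)) -> f = g.
Proof.
move=> fg; apply: starHom_eq; elim/block_ind => [|x y IHx IHy|x a b ab].
- by rewrite !raddf0.
- by rewrite !raddfD /= IHx IHy.
- by rewrite entry_unit !linearZ_LR /= fg.
Qed.

(** These relations present the block algebra, as block_hom and block_hom_eq
    show. *)
Record matrix_units (m : K -> K -> C) : Prop := MatrixUnits {
  munitsM : forall a b c, R a b -> R b c -> amul (m a b) (m b c) = m a c;
  munits0 : forall a b c d,
    R a b -> R c d -> b != c -> amul (m a b) (m c d) = 0;
  munits_star : forall a b, R a b -> astar (m a b) = m b a
}.

Variable m : K -> K -> C.
Hypothesis mu : matrix_units m.

Definition block_hom_fun : block l R -> C := block_lift (fun x a b => x *: m a b).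

Let cD (a b : K) : {morph (fun x : l => x *: m a b) : x y / x + y}.
Proof. by move=> x y; rewrite scalerDl. Qed.

Let homD : {morph block_hom_fun : x y / x + y}.
Proof. exact: block_liftD. Qed.

Let homE x a b : R a b -> block_hom_fun (entry R x a b) = x *: m a b.
Proof. exact: block_liftE (fun a b => cD a b) _ _ _. Qed.

Let hom0 : block_hom_fun 0 = 0.
Proof. exact: block_lift0. Qed.

Lemma block_hom_linear : linear block_hom_fun.
Proof.
move=> r x y; rewrite homD; congr (_ + _).
elim/block_ind: x => [|x1 x2 IH1 IH2|x a b ab].
- have -> : r *: (0 : block l R) = 0 by exact: scaler0.
  by rewrite hom0 scaler0.
- by rewrite scalerDr !homD IH1 IH2 scalerDr.
by rewrite entryZ (homE _ ab) (homE x ab) scalerA.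
Qed.

Lemma block_homM x y :
  block_hom_fun (block_mul x y) = amul (block_hom_fun x) (block_hom_fun y).
Proof.
elim/block_ind: x => [|x1 x2 IH1 IH2|x a b ab].
- by rewrite block_mul0 !hom0 amul0.
- by rewrite block_mulDl !homD IH1 IH2 amulDl.
elim/block_ind: y => [|y1 y2 IH1 IH2|y c d cd].
- by rewrite block_mulx0 !hom0 amulx0.
- by rewrite block_mulDr !homD IH1 IH2 amulDr.
rewrite (block_mulE _ _ ab cd) (homE x ab) (homE y cd) amulZl amulZr.
case: (eqVneq b c) => [bc|bc]; last by rewrite (munits0 mu ab cd bc) hom0 !scaler0.
subst c; rewrite (munitsM mu ab cd) (homE _ (per_trans ab cd)) scalerA.
by [].
Qed.

Lemma block_hom_star x : block_hom_fun (block_star x) = astar (block_hom_fun x).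
Proof.
elim/block_ind: x => [|x y IHx IHy|x a b ab].
- by rewrite block_star0 hom0 astar0.
- by rewrite block_starD !homD IHx IHy astarD.
have ba : R b a by rewrite per_sym.
by rewrite (homE x ab) (block_starE _ ab) (homE _ ba) astarZ (munits_star mu ab).
Qed.

Definition block_hom : starHom (block_alg l R) C :=
  @StarHom l (block_alg l R) C _ block_hom_linear block_homM block_hom_star.

Lemma block_homE a b : R a b -> block_hom (munit l R a b) = m a b.
Proof. by move=> ab; rewrite [LHS]homE // scale1r. Qed.

End BlockHom.

Section BlockUnits.
Variables (l : invRing) (K : choiceType) (R : per K).
Local Notation e := (munit l R).

Lemma munitM a b c : R a b -> R b c -> amul (e a b) (e b c) = e a c.
Proof. by move=> ab bc; rewrite [LHS]block_mulE // eqxx mul1r. Qed.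

Lemma munit0 a b c d : R a b -> R c d -> b != c -> amul (e a b) (e c d) = 0.
Proof. by move=> ab cd /negbTE bc; rewrite [LHS]block_mulE // bc. Qed.

Lemma munit_star a b : R a b -> astar (e a b) = e b a.
Proof. by move=> ab; rewrite [LHS]block_starE // rmorph1. Qed.

End BlockUnits.

(** The maps of index sets that carry matrix units to matrix units. Injectivity
    is what preserves the orthogonality relations. *)
Record embeds (K K' : choiceType) (R : per K) (R' : per K') (j : K -> K') : Prop :=
  Embeds {
    embeds_inj : forall a b, R a a -> R b b -> j a = j b -> a = b;
    embeds_rel : forall a b, R a b -> R' (j a) (j b)
  }.

Lemma embeds_comp (K K' K'' : choiceType) (R : per K) (R' : per K') (R'' : per K'')
    (j : K -> K') (j' : K' -> K'') :
  embeds R R' j -> embeds R' R'' j' -> embeds R R'' (fun a => j' (j a)).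
Proof.
move=> je je'; split=> [a b aa bb /(embeds_inj je') jab|a b ab].
- by apply: (embeds_inj je) => //; apply: jab; exact: (embeds_rel je).
- by apply: (embeds_rel je'); exact: (embeds_rel je).
Qed.

Section BlockMap.
Variables (l : invRing) (K K' : choiceType) (R : per K) (R' : per K').
Variables (j : K -> K') (je : embeds R R' j).

Lemma block_map_units : matrix_units R (fun a b => munit l R' (j a) (j b)).
Proof.
have [jinj jR] := je; split=> [a b c ab bc|a b c d ab cd bc|a b ab].
- by rewrite munitM //; apply: jR.
- apply: munit0; rewrite ?jR //; apply: contra bc => /eqP/jinj -> //.
    by apply: (@per_refl _ _ b a); rewrite per_sym.
  exact: per_refl cd.
- by rewrite munit_star // jR.
Qed.

Definition block_map : starHom (block_alg l R) (block_alg l R') :=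
  block_hom block_map_units.

Lemma block_mapE a b : R a b -> block_map (munit l R a b) = munit l R' (j a) (j b).
Proof. exact: block_homE. Qed.

End BlockMap.

Section BlockMapHomology.
Variables (l : invRing) (H : functor (starAlgCat l) Ab).

Lemma Hmap_block_comp (K K' K'' : choiceType) (R : per K) (R' : per K')
    (R'' : per K'') (j : K -> K') (j' : K' -> K'') (j'' : K -> K'')
    (je : embeds R R' j) (je' : embeds R' R'' j') (je'' : embeds R R'' j'') :
  (forall a, R a a -> j'' a = j' (j a)) -> forall x,
  Hmap H (block_map l je'') x = Hmap H (block_map l je') (Hmap H (block_map l je) x).
Proof.
move=> jE x; rewrite -HmapM; congr (Hmap H _ x); apply: block_hom_eq => a b ab.
have ba : R b a by rewrite per_sym.
rewrite [RHS](starHom_compE (block_map l je') (block_map l je)).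
rewrite (block_mapE _ je'' ab) (block_mapE _ je ab) (block_mapE _ je' (embeds_rel je ab)).
by rewrite !jE //; [exact: per_refl ba|exact: per_refl ab].
Qed.

End BlockMapHomology.

(** * Stability in terms of index sets *)

Section Inflate.
Variables (K : choiceType) (R : per K).

(** The index set of M_oo: each class is repeated countably often. *)
Definition inflate_rel : rel (nat * K)%type := fun p q => R p.2 q.2.

Lemma inflate_sym : symmetric inflate_rel.
Proof. by move=> p q; exact: per_sym. Qed.

Lemma inflate_trans : transitive inflate_rel.
Proof. by move=> p q r; exact: per_trans. Qed.

Definition inflate : per (nat * K)%type := Per inflate_sym inflate_trans.

Lemma layer_embeds i : embeds R inflate (pair i).
Proof. by split=> [a b _ _ []|]. Qed.

End Inflate.

Section MinfCell.
Variables (l : invRing) (A : starAlg l).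

Lemma Minf_cellM i j k h (s t : A) :
  amul (<< s *g (i, j) >> : Minf_alg A) << t *g (k, h) >> =
  if j == k then << amul s t *g (i, h) >> else 0.
Proof. exact: Minf_mulU. Qed.

Lemma Minf_cell_star i j (s : A) :
  astar (<< s *g (i, j) >> : Minf_alg A) = << astar s *g (j, i) >>.
Proof. exact: Minf_starU. Qed.

Lemma Minf_cellZ i j r (s : A) :
  r *: (<< s *g (i, j) >> : Minf_alg A) = << r *: s *g (i, j) >>.
Proof. exact: MinfZU. Qed.

End MinfCell.

Section MinfBlock.
Variables (l : invRing) (K : choiceType) (R : per K).
Local Notation e := (munit l R).

(** A matrix of matrices is a matrix: this family of units identifies the block
    algebra of nat x R with M_oo of the block algebra of R. *)
Definition to_Minf_units (p q : (nat * K)%type) : Minf_alg (block_alg l R) :=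
  << (e p.2 q.2 : block_alg l R) *g (p.1, q.1) >>.

Lemma to_Minf_unitsP : matrix_units (inflate R) to_Minf_units.
Proof.
split=> [p q r pq qr|p q r s pq rs qr|p q pq].
- by rewrite /to_Minf_units Minf_cellM eqxx munitM.
- rewrite /to_Minf_units Minf_cellM; case: eqP => [qr1|//].
  rewrite munit0 ?monalgU0 //.
  by apply: contra qr => /eqP qr2; rewrite [q]surjective_pairing qr1 qr2 -surjective_pairing.
- by rewrite /to_Minf_units Minf_cell_star munit_star.
Qed.

Definition to_Minf := block_hom to_Minf_unitsP.

Lemma to_MinfE x p q : inflate R p q ->
  to_Minf (entry (inflate R) x p q) =
  (<< (entry R x p.2 q.2 : block_alg l R) *g (p.1, q.1) >> : Minf_alg _).
Proof.
move=> pq; rewrite !entry_unit.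
have -> : to_Minf (x *: munit l (inflate R) p q) = x *: to_Minf (munit l (inflate R) p q).
  exact: linearZ_LR.
by rewrite (block_homE to_Minf_unitsP pq) Minf_cellZ.
Qed.

Let cD i j a b : {morph (fun x : l => entry (inflate R) x (i, a) (j, b)) : x y / x + y}.
Proof. by move=> x y; rewrite entryD. Qed.

(** The inverse is built cell by cell, as an additive map only. *)
Definition of_cell (i j : nat) : block l R -> block l (inflate R) :=
  block_lift (fun x a b => entry (inflate R) x (i, a) (j, b)).

Let cellD (i j : nat) : {morph (of_cell i j) : x y / x + y}.
Proof. by move=> x y; exact: (block_liftD (fun a b => @cD i j a b)). Qed.

Definition of_Minf : Minf (block_alg l R) -> block l (inflate R) :=
  lin (fun ij s => of_cell ij.1 ij.2 s).

Let ofD : {morph of_Minf : x y / x + y}.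
Proof. by apply: linD => ij x y; exact: cellD. Qed.

Let of0 : of_Minf 0 = 0. Proof. exact: lin0. Qed.

Let ofE i j (s : block l R) : of_Minf << s *g (i, j) >> = of_cell i j s.
Proof. by apply: (linU (c := fun ij s => of_cell ij.1 ij.2 s)) => ij x y; exact: cellD. Qed.

Let of_cellE i j x a b :
  R a b -> of_cell i j (entry R x a b) = entry (inflate R) x (i, a) (j, b).
Proof. exact: (block_liftE (fun a b => @cD i j a b)). Qed.

Let toD x y : to_Minf (x + y) = to_Minf x + to_Minf y.
Proof. exact: raddfD. Qed.
Let to0 : to_Minf 0 = 0.
Proof. exact: raddf0. Qed.

Lemma to_MinfK : cancel to_Minf of_Minf.
Proof.
elim/block_ind => [|x y IHx IHy|x p q pq].
- by rewrite to0 of0.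
- by rewrite toD ofD IHx IHy.
by rewrite (to_MinfE x pq) ofE of_cellE // -!surjective_pairing.
Qed.

Lemma of_MinfK : cancel of_Minf to_Minf.
Proof.
elim/malg_ind => [|x y IHx IHy|s [i j]].
- by rewrite of0 to0.
- by rewrite ofD toD IHx IHy.
rewrite ofE; elim/block_ind: s => [|x y IHx IHy|x a b ab].
- by rewrite /of_cell block_lift0 to0 monalgU0.
- by rewrite cellD toD IHx IHy -monalgUD.
by rewrite of_cellE // to_MinfE.
Qed.

End MinfBlock.

Section Morita.
Variables (l : invRing) (H : functor (starAlgCat l) Ab).
Hypothesis Hst : Minf_stable H.

Lemma Hmap_bij (A B : starAlg l) (f : starHom A B) (g : B -> A) :
  cancel f g -> cancel g f -> bijective (Hmap H f).
Proof.
move=> fK gK.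
have g_lin : linear g.
  move=> r x y; apply: (can_inj fK); rewrite gK linearP /=.
  by rewrite -[f (g x)]/(shom_fun f (g x)) -[f (g y)]/(shom_fun f (g y)) !gK.
have gM x y : g (amul x y) = amul (g x) (g y).
  by apply: (can_inj fK); rewrite shomM !gK.
have gS x : g (astar x) = astar (g x).
  by apply: (can_inj fK); rewrite shom_star !gK.
pose h := StarHom g_lin gM gS.
exists (Hmap H h) => x; rewrite -HmapM -[RHS]Hmap1; congr (Hmap H _ x);
  apply: starHom_eq => y; [exact: fK|exact: gK].
Qed.

Section Layer.
Variables (K : choiceType) (R : per K).

(** Under the identification of M_oo with a block algebra, the inclusion of
    layer i is a corner inclusion. *)
Lemma layer_bij i : bijective (Hmap H (block_map l (layer_embeds R i))).
Proof.
have toB : bijective (Hmap H (to_Minf l R)) := Hmap_bij (@to_MinfK l K R) (@of_MinfK l K R).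
have [to' toK Kto] := toB.
have cE x : Hmap H (corner (block_alg l R) i) x =
    Hmap H (to_Minf l R) (Hmap H (block_map l (layer_embeds R i)) x).
  rewrite -HmapM; congr (Hmap H _ x); apply: block_hom_eq => a b ab.
  rewrite [RHS]starHom_compE (block_mapE _ (layer_embeds R i) ab).
  by rewrite (block_homE (to_Minf_unitsP l R)).
apply: (eq_bij (bij_comp (Bijective Kto toK) (Hst (block_alg l R) i))) => x /=.
by rewrite cE toK.
Qed.

Lemma layer_inj i : injective (Hmap H (block_map l (layer_embeds R i))).
Proof. exact: bij_inj (layer_bij i). Qed.

(** An endomorphism that is given by conjugation with an isometry V induces the
    identity. Conjugation with diag(1, V, 1, ...) on M_oo fixes layer 0, which
    carries all of H, so it induces the identity; and it restricts to the given
    endomorphism on layer 1. *)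
Lemma Hmap_endo (j : K -> K) (je : embeds R R j) :
  (forall a, R a a -> R a (j a)) -> forall x, Hmap H (block_map l je) x = x.
Proof.
move=> Rj x.
pose J (p : (nat * K)%type) := if p.1 == 1%N then (1%N, j p.2) else p.
have RJ p : R p.2 p.2 -> R p.2 (J p).2 by rewrite /J; case: ifP => // _; exact: Rj.
have Je : embeds (inflate R) (inflate R) J.
  split=> [[n a] [m b] aa bb|p q pq].
    rewrite /J /=; case: eqP => [->|n1]; case: eqP => [->|m1] //.
    - by move=> [] /(embeds_inj je) ->.
    - by move=> [n1 _]; case: m1.
    - by move=> [m1 _]; case: n1.
  have qp : R q.2 p.2 by rewrite per_sym.
  apply: per_trans (_ : R _ p.2) _; first by rewrite per_sym; exact/RJ/(per_refl pq).
  by apply: per_trans pq _; exact/RJ/(per_refl qp).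
have J0 := Hmap_block_comp (layer_embeds R 0) Je (layer_embeds R 0) (fun a _ => erefl).
have J1 y : Hmap H (block_map l Je) y = y.
  by have [c cK Kc] := layer_bij 0; rewrite -(Kc y) -J0.
apply: (@layer_inj 1).
rewrite -(Hmap_block_comp je (layer_embeds R 1) (embeds_comp je (layer_embeds R 1)) (fun a _ => erefl)).
rewrite -[RHS]J1.
exact: (Hmap_block_comp (layer_embeds R 1) Je).
Qed.

End Layer.

(** Two inclusions that agree up to R' differ by an isometry, provided that
    there is room to extend it to the whole index set: on nat x K', send (0, j a)
    to (0, j' a) and move everything else one layer up. *)
Lemma Hmap_conj (K K' : choiceType) (R : per K) (R' : per K') (j j' : K -> K')
    (je : embeds R R' j) (je' : embeds R R' j') :
  (forall a, R a a -> R' (j a) (j' a)) ->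
  forall x, Hmap H (block_map l je) x = Hmap H (block_map l je') x.
Proof.
move=> jj' x; apply: (@layer_inj _ R' 0).
pose src (b : K') := `[< exists a, R a a /\ j a = b >].
have src_ex b : src b -> {a | R a a /\ j a = b}.
  by move=> bs; apply: cid; exact/asboolP.
(* The map j a |-> j' a; off the image of j it takes a default value. *)
pose pre b : K' := if pselect (src b) is left bs then j' (sval (src_ex b bs)) else b.
have preE a : R a a -> src (j a) /\ pre (j a) = j' a.
  move=> aa; have ja : src (j a) by apply/asboolP; exists a.
  split=> //; rewrite /pre; case: pselect => // bs.
  case: (src_ex _ _) => a' [a'a' aa'] /=.
  by rewrite (embeds_inj je _ _ aa').
pose J (p : (nat * K')%type) :=
  if (p.1 == 0) && src p.2 then (0%N, pre p.2) else (p.1.+1, p.2).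
have RJ p : R' p.2 p.2 -> R' p.2 (J p).2.
  rewrite /J; case: ifP => //= /andP[_ /src_ex[a [aa <-]]] _.
  by have [_ ->] := preE _ aa; exact: jj'.
have Je : embeds (inflate R') (inflate R') J.
  split=> [[n a] [m b] aa bb|p q pq].
    rewrite /J /=; case: ifP => [/andP[/eqP -> /src_ex[c [cc <-]]]|_];
      case: ifP => [/andP[/eqP -> /src_ex[d [dd <-]]]|_] //.
      have [_ ->] := preE _ cc; have [_ ->] := preE _ dd.
      by move=> [] /(embeds_inj je') ->.
    by move=> [-> ->].
  have qp : R' q.2 p.2 by rewrite per_sym.
  apply: per_trans (_ : R' _ p.2) _; first by rewrite per_sym; exact/RJ/(per_refl pq).
  by apply: per_trans pq _; exact/RJ/(per_refl qp).
have J1 y : Hmap H (block_map l Je) y = y by apply: Hmap_endo; exact: RJ.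
have je1 := embeds_comp je' (layer_embeds R' 0).
have je0 := embeds_comp je (layer_embeds R' 0).
rewrite -(Hmap_block_comp je' (layer_embeds R' 0) je1 (fun a _ => erefl)).
rewrite -(Hmap_block_comp je (layer_embeds R' 0) je0 (fun a _ => erefl)).
rewrite -[LHS]J1; apply/esym.
apply: (Hmap_block_comp je0 Je) => a aa.
by rewrite /J /=; have [-> ->] := preE _ aa.
Qed.

(** The inclusion of a full corner induces an isomorphism. Given a retraction
    rho of R' to R on the level of classes, and an injection nu of the support
    of R' into nat, the map a |-> (nu a, rho a) embeds R' in nat x R. Composed
    with j on either side, it becomes the inclusion of a layer up to
    conjugation. *)
Lemma Hmap_full (K K' : choiceType) (R : per K) (R' : per K') (j : K -> K')
    (je : embeds R R' j) (nu : K' -> nat) (rho : K' -> K) :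
  (forall a b, R' a a -> R' b b -> nu a = nu b -> a = b) ->
  (forall a b, R' a b -> R (rho a) (rho b)) ->
  (forall a, R' a a -> R' a (j (rho a))) ->
  (forall a, R a a -> R a (rho (j a))) ->
  bijective (Hmap H (block_map l je)).
Proof.
move=> nu_inj Rrho R'rho Rj.
have te : embeds R' (inflate R) (fun a => (nu a, rho a)).
  by split=> [a b aa bb []|a b ab]; [move=> /nu_inj -> //|exact: Rrho].
have je1 : embeds (inflate R) (inflate R') (fun p => (p.1, j p.2)).
  split=> [[n a] [m b] aa bb /= [->]|p q pq]; first by move/(embeds_inj je) ->.
  exact: (embeds_rel je).
have [c cK Kc] := layer_bij R 0; have [c' c'K Kc'] := layer_bij R' 0.
have tj x : Hmap H (block_map l te) (Hmap H (block_map l je) x) =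
            Hmap H (block_map l (layer_embeds R 0)) x.
  rewrite -(Hmap_block_comp je te (embeds_comp je te) (fun a _ => erefl)).
  apply: Hmap_conj => a aa; rewrite /inflate /= /inflate_rel /= per_sym; exact: Rj.
have jt x : Hmap H (block_map l je1) (Hmap H (block_map l te) x) =
            Hmap H (block_map l (layer_embeds R' 0)) x.
  rewrite -(Hmap_block_comp te je1 (embeds_comp te je1) (fun a _ => erefl)).
  apply: Hmap_conj => a aa; rewrite /inflate /= /inflate_rel /= per_sym; exact: R'rho.
exists (fun y => c (Hmap H (block_map l te) y)) => x; first by rewrite tj cK.
have t_inj : injective (Hmap H (block_map l te)).
  by move=> y z /(congr1 (fun w => c' (Hmap H (block_map l je1) w))); rewrite !jt !c'K.
by apply: t_inj; rewrite tj Kc.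
Qed.

End Morita.

(** * Additivity on orthogonal sums *)

Section ZeroHom.
Variables (l : invRing) (A B : starAlg l).

Definition zero_hom : starHom A B.
Proof.
exists (fun=> 0) => [a x y|x y|x]; first by rewrite scaler0 addr0.
  by rewrite amul0.
by rewrite astar0.
Defined.

End ZeroHom.

Section SumHom.
Variables (l : invRing) (A B : starAlg l) (f g : starHom A B).
Hypotheses (fg : forall x y, amul (f x) (g y) = 0)
  (gf : forall x y, amul (g x) (f y) = 0).

Definition sum_hom : starHom A B.
Proof.
exists (fun x => f x + g x) => [a x y|x y|x].
- by rewrite !linearP scalerDr addrACA.
- by rewrite !shomM amulDl !amulDr fg gf add0r addr0.
- by rewrite !shom_star astarD.
Defined.

End SumHom.

Section PairHom.
Variables (l : invRing) (A B C : starAlg l) (f : starHom A B) (g : starHom A C).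

Definition pair_hom : starHom A (prod_alg B C).
Proof.
exists (fun x => (f x, g x)) => [a x y|x y|x].
- by rewrite !linearP.
- by rewrite !shomM.
- by rewrite !shom_star.
Defined.

End PairHom.

Section Additivity.
Variables (l : invRing) (H : functor (starAlgCat l) Ab).
Hypothesis Hadd : additive_functor H.

Lemma Hmap_eq (A B : starAlg l) (f g : starHom A B) :
  (forall x, f x = g x) -> forall x, Hmap H f x = Hmap H g x.
Proof. by move=> /starHom_eq ->. Qed.

(** The zero endomorphism of A coequalizes the two projections of A x A, and
    additivity allows (u, 0) as their values. *)
Lemma Hmap_zero (A B : starAlg l) (f : starHom A B) :
  (forall x, f x = 0) -> forall x, Hmap H f x = 0.
Proof.
move=> f0 x.
have o0 (u : Hob H A) : Hmap H (zero_hom A A) u = 0.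
  have [c cK Kc] := Hadd A A.
  have [] := Kc (u, 0); set z := c _ => <- z2.
  rewrite -HmapM.
  rewrite (@Hmap_eq _ _ _ (starHom_comp (zero_hom A A) (prod_snd A A))) //.
  by rewrite HmapM z2 raddf0.
rewrite (@Hmap_eq _ _ _ (starHom_comp f (zero_hom A A))); last first.
  by move=> y; rewrite starHom_compE !f0.
by rewrite HmapM o0 raddf0.
Qed.

Lemma Hmap_fst (A B C : starAlg l) (f : starHom A B) (g : starHom A C) x :
  Hmap H (prod_fst B C) (Hmap H (pair_hom f g) x) = Hmap H f x.
Proof. by rewrite -HmapM; exact: Hmap_eq. Qed.

Lemma Hmap_snd (A B C : starAlg l) (f : starHom A B) (g : starHom A C) x :
  Hmap H (prod_snd B C) (Hmap H (pair_hom f g) x) = Hmap H g x.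
Proof. by rewrite -HmapM; exact: Hmap_eq. Qed.

(** The sum of orthogonal f and g factors through A x A as
    (x, y) |-> f x + g y after the diagonal, and H of the diagonal is the sum of
    H of the two axis inclusions. *)
Lemma Hmap_sum2 (A B : starAlg l) (f g : starHom A B)
    (fg : forall x y, amul (f x) (g y) = 0) (gf : forall x y, amul (g x) (f y) = 0) x :
  Hmap H (sum_hom fg gf) x = Hmap H f x + Hmap H g x.
Proof.
pose id1 := starHom_id A; pose o := zero_hom A A.
have o0 u : Hmap H o u = 0 by exact: Hmap_zero.
have dE : Hmap H (pair_hom id1 id1) x =
    Hmap H (pair_hom id1 o) x + Hmap H (pair_hom o id1) x.
  apply: (bij_inj (Hadd A A)).
  by rewrite !raddfD /= !Hmap_fst !Hmap_snd !o0 addr0 add0r.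
pose fh := starHom_comp f (prod_fst A A); pose gh := starHom_comp g (prod_snd A A).
have fgh u v : amul (fh u) (gh v) = 0 by exact: fg.
have gfh u v : amul (gh u) (fh v) = 0 by exact: gf.
transitivity (Hmap H (sum_hom fgh gfh) (Hmap H (pair_hom id1 id1) x)).
  by rewrite -HmapM; apply: Hmap_eq.
rewrite dE raddfD -!HmapM; congr (_ + _); apply: Hmap_eq => u /=.
  by rewrite raddf0 addr0.
by rewrite raddf0 add0r.
Qed.

Lemma Hmap_sum (A B : starAlg l) (I : eqType) (r : seq I) (f : I -> starHom A B)
    (g : starHom A B) :
  uniq r ->
  (forall i j x y, i \in r -> j \in r -> i != j -> amul (f i x) (f j y) = 0) ->
  (forall x, g x = \sum_(i <- r) f i x) ->
  forall x, Hmap H g x = \sum_(i <- r) Hmap H (f i) x.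
Proof.
move=> r_uniq fo gE x.
suff [h hE hx] : exists2 h : starHom A B, forall y, h y = \sum_(i <- r) f i y
    & Hmap H h x = \sum_(i <- r) Hmap H (f i) x.
  by rewrite -hx; apply: Hmap_eq => y; rewrite gE hE.
elim: r r_uniq fo {g gE} => [|i r IH] /= => [_ _|/andP[ir r_uniq] fo].
  exists (zero_hom A B); first by move=> y; rewrite big_nil.
  by rewrite big_nil Hmap_zero.
have [|h hE hx] := IH r_uniq.
  by move=> j k y z jr kr; apply: fo; rewrite inE ?jr ?kr orbT.
have ijr j : j \in r -> i != j by move=> jr; apply: contraNneq ir => ->.
have fh y z : amul (f i y) (h z) = 0.
  rewrite hE amul_sumr big1_seq // => j /andP[_ jr].
  by apply: fo; rewrite ?inE ?eqxx ?jr ?orbT //; exact: ijr.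
have hf y z : amul (h y) (f i z) = 0.
  rewrite hE amul_suml big1_seq // => j /andP[_ jr].
  by apply: fo; rewrite ?inE ?eqxx ?jr ?orbT // eq_sym; exact: ijr.
exists (sum_hom fh hf); first by move=> y; rewrite big_cons -hE.
by rewrite Hmap_sum2 big_cons hx.
Qed.

End Additivity.

(** * Projections and the maps from H(l) *)

Record projector (l : invRing) (A : starAlg l) := Projector {
  pval :> A;
  pidem : amul pval pval = pval;
  pstar : astar pval = pval
}.

Lemma base_amulE (l : invRing) (x y : l) :
  amul (x : base_alg l) (y : base_alg l) = x * y :> l.
Proof. by []. Qed.

Section Point.
Variables (l : invRing) (A : starAlg l) (p : projector A).

Definition point_hom : starHom (base_alg l) A.
Proof.
exists (fun x : base_alg l => (x : l) *: (p : A)) => [a x y|x y|x].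
- by rewrite scalerDl scalerA.
- by rewrite amulZl amulZr pidem scalerA.
- by rewrite astarZ pstar.
Defined.

Lemma point_homE (x : l) : point_hom x = x *: (p : A).
Proof. by []. Qed.

End Point.

Section PushProjector.
Variables (l : invRing) (A B : starAlg l) (f : starHom A B) (p : projector A).

Lemma push_idem : amul (f p) (f p) = f p.
Proof. by rewrite -shomM pidem. Qed.

Lemma push_star : astar (f p) = f p.
Proof. by rewrite -shom_star pstar. Qed.

Definition push : projector B := Projector push_idem push_star.

End PushProjector.

Section PointHomology.
Variables (l : invRing) (H : functor (starAlgCat l) Ab).

Lemma Hmap_pushE (A B : starAlg l) (f : starHom A B) (p : projector A)
    (q : projector B) : f p = q ->
  forall x, Hmap H f (Hmap H (point_hom p) x) = Hmap H (point_hom q) x.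
Proof.
move=> fp x; rewrite -HmapM; apply: Hmap_eq => y.
by rewrite starHom_compE !point_homE -fp linearZ_LR.
Qed.

Lemma Hmap_point_sum (Hadd : additive_functor H) (A : starAlg l) (I : eqType)
    (r : seq I) (p : I -> projector A) (q : projector A) :
  uniq r ->
  (forall i j, i \in r -> j \in r -> i != j -> amul (p i) (p j) = 0) ->
  (q : A) = \sum_(i <- r) (p i : A) ->
  forall x, Hmap H (point_hom q) x = \sum_(i <- r) Hmap H (point_hom (p i)) x.
Proof.
move=> r_uniq po qE; apply: Hmap_sum => // [i j x y ir jr ij|x].
  by rewrite !point_homE amulZl amulZr po // !scaler0.
by rewrite point_homE qE scaler_sumr.
Qed.

End PointHomology.

Section UnitProjector.
Variables (l : invRing) (K : choiceType) (R : per K).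

Lemma munit_diag_idem a : amul (munit l R a a) (munit l R a a) = munit l R a a.
Proof.
have [aa|naa] := boolP (R a a); first exact: munitM.
by rewrite /munit entry_out // amul0.
Qed.

Lemma munit_diag_star a : astar (munit l R a a) = munit l R a a.
Proof.
have [aa|naa] := boolP (R a a); first exact: munit_star.
by rewrite /munit entry_out // astar0.
Qed.

(** Off the support of R this is the zero projection. *)
Definition diag_unit a : projector (block_alg l R) :=
  Projector (munit_diag_idem a) (munit_diag_star a).

Lemma diag_unit_out a : ~~ R a a -> pval (diag_unit a) = 0.
Proof. by move=> naa; rewrite /= /munit entry_out. Qed.

Lemma diag_unit_orth a b : a != b -> amul (diag_unit a) (diag_unit b) = 0.
Proof.
move=> ab.
have [aa|naa] := boolP (R a a); last by rewrite (diag_unit_out naa) amul0.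
have [bb|nbb] := boolP (R b b); last by rewrite (diag_unit_out nbb) amulx0.
exact: munit0.
Qed.

Lemma point_hom_diagE a (x : l) : point_hom (diag_unit a) x = entry R x a a.
Proof. by rewrite point_homE entry_unit. Qed.

End UnitProjector.

Definition full_per (K : choiceType) : per K :=
  @Per K (fun _ _ => true) (fun _ _ => erefl) (fun _ _ _ _ _ => erefl).

Section Equivalence.
Variables (l : invRing) (H : functor (starAlgCat l) Ab).
Hypothesis Hst : Minf_stable H.

Lemma Hmap_diag_unit (K : choiceType) (R : per K) a b : R a b -> forall x,
  Hmap H (point_hom (diag_unit l R a)) x = Hmap H (point_hom (diag_unit l R b)) x.
Proof.
move=> ab x; have ba : R b a by rewrite per_sym.
have aa := per_refl ab; have bb := per_refl ba.
have ea : embeds (full_per unit) R (fun=> a) by split=> [[] []|].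
have eb : embeds (full_per unit) R (fun=> b) by split=> [[] []|].
rewrite -(Hmap_pushE (f := block_map l ea) (p := diag_unit l (full_per unit) tt));
  last exact: block_mapE.
rewrite -(Hmap_pushE (f := block_map l eb) (p := diag_unit l (full_per unit) tt));
  last exact: block_mapE.
exact: Hmap_conj.
Qed.

(** Equivalent projections induce the same map. In the special case w w = 0, p
    and q are orthogonal, so that p, q, w and w* already form 2 x 2 matrix units
    in A. *)
Lemma Hmap_point_equiv (A : starAlg l) (p q : projector A) (w : A) :
  amul (astar w) w = p -> amul w (astar w) = q -> amul q w = w -> amul w w = 0 ->
  forall x, Hmap H (point_hom p) x = Hmap H (point_hom q) x.
Proof.
move=> wp wq qw ww x.
(* All products of two of p, q, w, w* follow from the hypotheses. *)
have wpw : amul w p = w by rewrite -wp amulA wq.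
have pw : amul p (astar w) = astar w by rewrite -[in RHS]wpw astarM pstar.
have wsq : amul (astar w) q = astar w by rewrite -[in RHS]qw astarM pstar.
have wsws : amul (astar w) (astar w) = 0 by rewrite -astarM ww astar0.
have pw0 : amul p w = 0 by rewrite -wp -amulA ww amulx0.
have pq0 : amul p q = 0 by rewrite -wq amulA pw0 amul0.
have wq0 : amul w q = 0 by rewrite -wq amulA ww amul0.
have wsp0 : amul (astar w) p = 0 by rewrite -wp amulA wsws amul0.
have qws0 : amul q (astar w) = 0 by rewrite -wq -amulA wsws amulx0.
have qp0 : amul q p = 0 by rewrite -wp amulA qws0 amul0.
pose m (a b : bool) := if a then if b then (p : A) else astar w else
                       if b then w else q.
have mu : matrix_units (full_per bool) m.
  split=> [[] [] [] _ _|[] [] [] [] _ _|[] [] _] //=;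
  by rewrite ?pidem ?pstar ?astarK.
have mp : block_hom mu (diag_unit l (full_per bool) true) = p by exact: (block_homE mu).
have mq : block_hom mu (diag_unit l (full_per bool) false) = q by exact: (block_homE mu).
rewrite -(Hmap_pushE mp) -(Hmap_pushE mq); congr (Hmap H _ _).
exact: Hmap_diag_unit.
Qed.

End Equivalence.

(** * Block algebras with finite support *)

Section FiniteBlock.
Variables (l : invRing) (H : functor (starAlgCat l) Ab).
Hypotheses (Hst : Minf_stable H) (Hadd : additive_functor H).
Variables (K : choiceType) (R : per K) (s : seq K).
Hypothesis sR : forall a, R a a -> a \in s.

(** One representative for each class. The values of choose at related a and b
    agree because R a and R b are the same predicate. *)
Definition class_rep a := choose (R a) a.

Lemma class_repP a : R a a -> R a (class_rep a).
Proof. by move=> aa; exact: chooseP. Qed.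

Lemma class_rep_eq a b : R a b -> class_rep a = class_rep b.
Proof.
move=> ab; have ba : R b a by rewrite per_sym.
rewrite /class_rep (@eq_choose _ (R a) (R b)); last first.
  by move=> c; apply/idP/idP; exact: per_trans.
by apply: choose_id; [exact: ba|exact: per_refl ba].
Qed.

(** The representatives with the discrete relation: the block algebra is a
    direct sum of copies of l, and a full corner in that of R. *)
Definition rep_rel : rel K := fun a b => [&& a == b, R a a & class_rep a == a].

Lemma rep_sym : symmetric rep_rel.
Proof. by move=> a b; rewrite /rep_rel; case: eqVneq => [->|]. Qed.

Lemma rep_trans : transitive rep_rel.
Proof. by move=> a b c /andP[/eqP ->]. Qed.

Definition rep_per : per K := Per rep_sym rep_trans.

Lemma rep_perE a b : rep_per a b -> [/\ a = b, R a a & class_rep a = a].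
Proof. by move=> /and3P[/eqP -> ? /eqP]. Qed.

Lemma rep_embeds : embeds rep_per R id.
Proof. by split=> // a b /rep_perE[<-]. Qed.

Lemma rep_perP a : R a a -> rep_per (class_rep a) (class_rep a).
Proof.
move=> aa; have ar := class_repP aa.
apply/and3P; split=> //; first by apply: (per_refl (b := a)); rewrite per_sym.
by rewrite -(class_rep_eq ar).
Qed.

Lemma rep_bij : bijective (Hmap H (block_map l rep_embeds)).
Proof.
apply: (Hmap_full Hst rep_embeds (nu := index^~ s) (rho := class_rep)).
- by move=> a b aa bb; exact: (index_inj a (sR aa) (sR bb)).
- by move=> a b ab; rewrite -(class_rep_eq ab); apply: rep_perP; exact: per_refl ab.
- exact: class_repP.
- by move=> a aa; have [_ _ ->] := rep_perE aa.
Qed.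

Definition coord_units (a b c : K) : base_alg l := (b == a)%:R.

Lemma coord_unitsP a : matrix_units rep_per (coord_units a).
Proof.
split=> [b c d /rep_perE[<- _ _] _|b c d e /rep_perE[<- _ _] /rep_perE[<- _ _] bd|b c /rep_perE[<- _ _]];
  rewrite /coord_units.
- by rewrite base_amulE; case: eqP => _; rewrite ?mulr0 ?mulr1.
- rewrite base_amulE; case: (eqVneq b a) => [ba|]; last by rewrite mul0r.
  by rewrite -ba eq_sym (negbTE bd) mulr0.
- by case: eqP => _; [exact: rmorph1|exact: rmorph0].
Qed.

Definition coord_hom a : starHom (block_alg l rep_per) (base_alg l) :=
  block_hom (coord_unitsP a).

Lemma coord_homE c x a : rep_per a a ->
  coord_hom c (entry rep_per x a a) = x * (a == c)%:R :> l.
Proof.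
move=> aa; rewrite entry_unit.
have -> : coord_hom c (x *: munit l rep_per a a) =
    x *: coord_hom c (munit l rep_per a a) by exact: linearZ_LR.
by rewrite (block_homE (coord_unitsP c)).
Qed.

(** The identity of the block algebra of the representatives is the orthogonal
    sum of the endomorphisms that keep one diagonal entry. *)
Lemma coord_sum (y : Hob H (block_alg l rep_per)) :
  y = \sum_(a <- undup s) Hmap H (point_hom (diag_unit l rep_per a)) (Hmap H (coord_hom a) y).
Proof.
rewrite -[LHS]Hmap1.
have hE := @Hmap_sum l H Hadd _ _ _ (undup s)
  (fun a => starHom_comp (point_hom (diag_unit l rep_per a)) (coord_hom a)) (starHom_id _).
rewrite hE; first by apply: eq_bigr => a _; rewrite HmapM.
- exact: undup_uniq.
- move=> a b x z _ _ ab; rewrite !starHom_compE !point_homE amulZl amulZr.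
  by rewrite diag_unit_orth // !scaler0.
move=> {hE}; elim/block_ind=> [|x z IHx IHz|x a b ab].
- by rewrite big1 // => a _; rewrite shom0.
- rewrite shomD IHx IHz -big_split; apply: eq_bigr => a _.
  by rewrite shomD.
have [ba Raa _] := rep_perE ab; subst b.
rewrite (bigD1_seq a) ?mem_undup ?undup_uniq ?sR // big1_seq.
  by rewrite Monoid.mulm1 starHom_compE coord_homE // eqxx mulr1 point_hom_diagE.
move=> c /andP[ca _]; rewrite starHom_compE coord_homE // eq_sym (negbTE ca) mulr0.
by rewrite point_hom_diagE entry0.
Qed.

(** Together with block_ext: H of the block algebra of R is the sum of one copy
    of H(l) for each class of R, embedded by any diagonal unit of the class. *)
Lemma block_gen (M : zmodType) (f g : {additive Hob H (block_alg l R) -> M}) :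
  (forall a x, R a a -> f (Hmap H (point_hom (diag_unit l R a)) x) =
                        g (Hmap H (point_hom (diag_unit l R a)) x)) ->
  forall y, f y = g y.
Proof.
move=> fg y; have [c cK Kc] := rep_bij; rewrite -(Kc y) (coord_sum (c y)).
rewrite !raddf_sum /=; apply: eq_bigr => a _.
have [/[dup] aa /rep_perE[_ Raa _]|naa] := boolP (rep_per a a).
  rewrite (Hmap_pushE (q := diag_unit l R a)) ?fg //.
  exact: block_mapE.
rewrite (Hmap_zero Hadd (f := point_hom _)) ?raddf0 // => z.
by rewrite point_homE diag_unit_out // scaler0.
Qed.

Lemma block_ext (M : zmodType) (g : K -> {additive Hob H (base_alg l) -> M}) :
  (forall a b x, R a b -> g a x = g b x) ->
  exists psi : {additive Hob H (block_alg l R) -> M},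
    forall a x, R a a -> psi (Hmap H (point_hom (diag_unit l R a)) x) = g a x.
Proof.
move=> gR; have [c cK Kc] := rep_bij.
have cD : {morph c : x y / x + y} by move=> x y; apply: (can_inj cK); rewrite raddfD !Kc.
pose psi y := \sum_(a <- undup s) g a (Hmap H (coord_hom a) (c y)).
have psiB : zmod_morphism psi.
  move=> x y; rewrite /psi -sumrB; apply: eq_bigr => a _.
  rewrite cD; have -> : c (- y) = - c y.
    by apply: (can_inj cK); rewrite raddfN !Kc.
  by rewrite !raddfB.
pose psi' : {additive _ -> _} := HB.pack psi (GRing.isZmodMorphism.Build _ _ psi psiB).
exists psi' => a x aa; rewrite /psi' /= /psi.
rewrite (Hmap_diag_unit Hst (class_repP aa)).
set b := class_rep a; have bb : rep_per b b := rep_perP aa.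
have -> : Hmap H (point_hom (diag_unit l R b)) x =
    Hmap H (block_map l rep_embeds) (Hmap H (point_hom (diag_unit l rep_per b)) x).
  by rewrite (Hmap_pushE (q := diag_unit l R b)) //; exact: block_mapE.
have [_ Rbb _] := rep_perE bb.
rewrite cK (bigD1_seq b) ?mem_undup ?undup_uniq ?sR //= big1_seq.
  rewrite addr0 -HmapM (Hmap_eq (g := starHom_id _)) ?Hmap1.
    by apply/esym/gR; exact: class_repP.
  move=> y; rewrite starHom_compE point_hom_diagE coord_homE //.
  by rewrite eqxx mulr1.
move=> d /andP[db _]; rewrite -HmapM (Hmap_zero Hadd) ?raddf0 // => y.
rewrite starHom_compE point_hom_diagE coord_homE //.
by rewrite eq_sym (negbTE db) mulr0.
Qed.

End FiniteBlock.

(** * Leavitt path algebras *)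

Section OutEdges.
Variables (F : graph) (row_fin : row_finite F).

Definition outs (v : vert F) : seq (edge F) := fset_set (out_edges v).

Lemma mem_outs v e : e \in outs v <-> src e = v.
Proof.
rewrite /outs in_fset_set; last exact: row_fin.
by rewrite inE.
Qed.

Lemma src_outs e v : e \in outs v -> src e = v.
Proof. by move/mem_outs. Qed.

Lemma outs_src e : e \in outs (src e).
Proof. exact/mem_outs. Qed.

Lemma outs_uniq v : uniq (outs v).
Proof. exact: fset_uniq. Qed.

Lemma regular_outs v : regular_vertex v <-> outs v != [::].
Proof.
split=> [[_ [e ev]]|].
  by apply/eqP => o0; have := (mem_outs v e).2 ev; rewrite o0.
case o: (outs v) => [//|e r] _; split; first exact: row_fin.
by exists e; apply/mem_outs; rewrite o inE eqxx.
Qed.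

End OutEdges.

Section LeavittGenerators.
Variables (l : invRing) (F : graph).
Local Notation L := (leavitt l F).

Definition lvert (v : vert F) : L := \pi_(lpa l F) (LVert l v).
Definition ledge (e : edge F) : L := \pi_(lpa l F) (LEdge l e).

Lemma lghostE e : astar (ledge e) = \pi_(lpa l F) (LGhost l e) :> L.
Proof. exact: lpa_starE. Qed.

Let mulE (s t : lterm l F) :
  amul (\pi_(lpa l F) s : L) (\pi_(lpa l F) t) = \pi_(lpa l F) (LMul s t).
Proof. exact: lpa_mulE. Qed.

Lemma lvert_idem v : amul (lvert v) (lvert v) = lvert v.
Proof. by rewrite mulE; apply/lpaP; exact: lrel_vv. Qed.

Lemma lvert_orth v w : v <> w -> amul (lvert v) (lvert w) = 0.
Proof. by move=> vw; rewrite mulE; apply/lpaP; exact: lrel_vw. Qed.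

Lemma lvert_star v : astar (lvert v) = lvert v.
Proof. exact: lpa_starE. Qed.

Lemma lsrc_edge e : amul (lvert (src e)) (ledge e) = ledge e.
Proof. by rewrite mulE; apply/lpaP; exact: lrel_src_edge. Qed.

Lemma ledge_rng e : amul (ledge e) (lvert (rng e)) = ledge e.
Proof. by rewrite mulE; apply/lpaP; exact: lrel_edge_rng. Qed.

Lemma ledge_CK1 e : amul (astar (ledge e)) (ledge e) = lvert (rng e).
Proof. by rewrite lghostE mulE; apply/lpaP; exact: lrel_CK1. Qed.

Lemma ledge_CK1_neq e f : e <> f -> amul (astar (ledge e)) (ledge f) = 0.
Proof. by move=> ef; rewrite lghostE mulE; apply/lpaP; exact: lrel_CK1_neq. Qed.

Lemma lvert_CK2 (row_fin : row_finite F) v : outs v != [::] ->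
  lvert v = \sum_(e <- outs v) amul (ledge e) (astar (ledge e)).
Proof.
move=> vreg.
have -> : \sum_(e <- outs v) amul (ledge e) (astar (ledge e)) =
    \pi_(lpa l F) (\big[@LAdd l F/LZero l F]_(e <- outs v) LMul (LEdge l e) (LGhost l e)).
  rewrite (big_morph (\pi_(lpa l F)) (id1 := (0 : L)) (op1 := +%R)) //.
    by apply: eq_bigr => e _; rewrite lghostE mulE.
  by move=> s t; apply/esym; exact: lpa_addE.
apply/lpaP; apply: lrel_CK2.
- exact/regular_outs.
- exact: outs_uniq.
- by move=> e; exact: mem_outs.
Qed.

End LeavittGenerators.

Section LeavittUniversal.
Variables (l : invRing) (F : graph) (row_fin : row_finite F) (C : starAlg l).
Local Notation L := (leavitt l F).

Lemma leavitt_hom_eq (f g : starHom L C) :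
  (forall v, f (lvert l v) = g (lvert l v)) ->
  (forall e, f (ledge l e) = g (ledge l e)) -> f = g.
Proof.
move=> fgv fge; apply: starHom_eq; elim/quotW.
have addE (s t : lterm l F) : \pi_(lpa l F) (LAdd s t) = (\pi_(lpa l F) s : L) + \pi_(lpa l F) t.
  by apply/esym; exact: lpa_addE.
have oppE (s : lterm l F) : \pi_(lpa l F) (LOpp s) = - (\pi_(lpa l F) s : L).
  by apply/esym; exact: lpa_oppE.
have mulE (s t : lterm l F) :
    \pi_(lpa l F) (LMul s t) = amul (\pi_(lpa l F) s : L) (\pi_(lpa l F) t).
  by apply/esym; exact: lpa_mulE.
have scaleE a (s : lterm l F) : \pi_(lpa l F) (LScale a s) = a *: (\pi_(lpa l F) s : L).
  by apply/esym; exact: lpa_scaleE.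
elim=> [v|e|e||s IHs t IHt|s IHs|s IHs t IHt|a s IHs].
- exact: fgv.
- exact: fge.
- by rewrite -lghostE !shom_star fge.
- by rewrite -[\pi_(lpa l F) _]/(0 : L) !shom0.
- by rewrite addE !shomD IHs IHt.
- by rewrite oppE -!scaleN1r !shomZ IHs.
- by rewrite mulE !shomM IHs IHt.
- by rewrite scaleE !shomZ IHs.
Qed.

(** A family of generators for the universal property in the category of
    *-algebras. The relations that involve ghost edges only are the images under
    the involution of those listed. *)
Record leavitt_family (V : vert F -> C) (S : edge F -> C) : Prop := LeavittFamily {
  lfam_idem : forall v, amul (V v) (V v) = V v;
  lfam_orth : forall v w, v <> w -> amul (V v) (V w) = 0;
  lfam_star : forall v, astar (V v) = V v;
  lfam_src : forall e, amul (V (src e)) (S e) = S e;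
  lfam_rng : forall e, amul (S e) (V (rng e)) = S e;
  lfam_CK1 : forall e, amul (astar (S e)) (S e) = V (rng e);
  lfam_CK1_neq : forall e f, e <> f -> amul (astar (S e)) (S f) = 0;
  lfam_CK2 : forall v, outs v != [::] ->
    V v = \sum_(e <- outs v) amul (S e) (astar (S e))
}.

Variables (V : vert F -> C) (S : edge F -> C).
Hypothesis fam : leavitt_family V S.

Fixpoint leavitt_eval (s : lterm l F) : C :=
  match s with
  | LVert v => V v
  | LEdge e => S e
  | LGhost e => astar (S e)
  | LZero => 0
  | LAdd s t => leavitt_eval s + leavitt_eval t
  | LOpp s => - leavitt_eval s
  | LMul s t => amul (leavitt_eval s) (leavitt_eval t)
  | LScale a s => a *: leavitt_eval s
  end.

Lemma leavitt_eval_rel s t : lrel s t -> leavitt_eval s = leavitt_eval t.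
Proof.
elim=> {s t} //=; try by intros; congruence.
- by move=> *; rewrite addrA.
- by move=> *; rewrite addrC.
- by move=> *; rewrite add0r.
- by move=> *; rewrite addNr.
- by move=> *; rewrite scalerA.
- by move=> *; rewrite scale1r.
- by move=> *; rewrite scalerDr.
- by move=> *; rewrite scalerDl.
- by move=> *; rewrite amulA.
- by move=> *; rewrite amulDl.
- by move=> *; rewrite amulDr.
- by move=> *; rewrite amulZl.
- by move=> *; rewrite amulZr.
- by move=> *; rewrite (lfam_idem fam).
- by move=> *; rewrite (lfam_orth fam).
- by move=> *; rewrite (lfam_src fam).
- by move=> *; rewrite (lfam_rng fam).
- by move=> e; rewrite -{1}(lfam_star fam) -astarM (lfam_rng fam).
- by move=> e; rewrite -{1}(lfam_star fam) -astarM (lfam_src fam).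
- by move=> *; rewrite (lfam_CK1 fam).
- by move=> *; rewrite (lfam_CK1_neq fam).
move=> v es vreg es_uniq esv.
rewrite (lfam_CK2 fam); last exact/regular_outs.
rewrite (big_morph leavitt_eval (id1 := 0) (op1 := +%R)) //=; apply: perm_big.
apply: uniq_perm => //; first exact: outs_uniq.
by move=> e; apply/idP/idP => [/(mem_outs row_fin)/esv|/esv/(mem_outs row_fin)].
Qed.

Definition leavitt_hom_fun (x : lpa l F) : C := leavitt_eval (repr x).

Lemma leavitt_hom_funE s : leavitt_hom_fun (\pi_(lpa l F) s) = leavitt_eval s.
Proof. exact/leavitt_eval_rel/lrel_repr. Qed.

Definition leavitt_hom : starHom L C.
Proof.
exists leavitt_hom_fun.
- move=> a; elim/quotW => s; elim/quotW => t.
  rewrite [a *: _]lpa_scaleE [X in leavitt_hom_fun X]lpa_addE.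
  by rewrite !leavitt_hom_funE.
- elim/quotW => s; elim/quotW => t.
  by rewrite [amul _ _]lpa_mulE !leavitt_hom_funE.
- elim/quotW => s; rewrite [astar _]lpa_starE !leavitt_hom_funE.
  elim: s => //= [v|e||s -> t ->|s ->|s -> t ->|a s ->].
  + by rewrite (lfam_star fam).
  + by rewrite astarK.
  + by rewrite astar0.
  + by rewrite astarD.
  + by apply: (addIr (astar (leavitt_eval s))); rewrite addNr -astarD addNr astar0.
  + by rewrite astarM.
  + by rewrite astarZ.
Defined.

Lemma leavitt_hom_vert v : leavitt_hom (lvert l v) = V v.
Proof. exact: leavitt_hom_funE. Qed.

Lemma leavitt_hom_edge e : leavitt_hom (ledge l e) = S e.
Proof. exact: leavitt_hom_funE. Qed.

End LeavittUniversal.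

(** * Walks and cuts *)

Section Paths.
Variables (F : graph) (row_fin : row_finite F).
Implicit Types (u v w : vert F) (x y z : seq (edge F)).

Fixpoint walk v x := if x is e :: x' then (src e == v) && walk (rng e) x' else true.

Fixpoint walk_end v x := if x is e :: x' then walk_end (rng e) x' else v.

Lemma walk_cat v x y : walk v (x ++ y) = walk v x && walk (walk_end v x) y.
Proof. by elim: x v => //= e x IH v; rewrite IH andbA. Qed.

Lemma walk_end_cat v x y : walk_end v (x ++ y) = walk_end (walk_end v x) y.
Proof. by elim: x v => //=. Qed.

Lemma sink_walk v x : outs v = [::] -> walk v x -> x = [::].
Proof.
case: x => //= e x v0 /andP[/eqP ev _].
by have := (mem_outs row_fin v e).2 ev; rewrite v0.
Qed.

Fixpoint cut d v : seq (seq (edge F)) :=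
  if d is d'.+1 then
    if outs v is [::] then [:: [::]]
    else [seq e :: x | e <- outs v, x <- cut d' (rng e)]
  else [:: [::]].

Lemma cut_sink d v : outs v = [::] -> cut d v = [:: [::]].
Proof. by case: d => //= d ->. Qed.

Lemma cutS d v : outs v != [::] ->
  cut d.+1 v = [seq e :: x | e <- outs v, x <- cut d (rng e)].
Proof. by rewrite /=; case: (outs v). Qed.

Lemma big_cutS (M : zmodType) d v (G : seq (edge F) -> M) : outs v != [::] ->
  \sum_(x <- cut d.+1 v) G x = \sum_(e <- outs v) \sum_(x <- cut d (rng e)) G (e :: x).
Proof. by move=> vreg; rewrite cutS // big_allpairs_dep. Qed.

Lemma mem_cut d v x : x \in cut d v =
  walk v x && ((size x == d) || (size x < d)%N && (outs (walk_end v x) == [::])).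
Proof.
elim: d v x => [|d IH] v x; first by rewrite inE ltn0 orbF; case: x => //= e x; rewrite andbF.
have [v0|vreg] := eqVneq (outs v) [::].
  rewrite cut_sink // inE; apply/idP/idP => [/eqP ->|/andP[/(sink_walk v0) -> //]].
  by rewrite /= v0 eqxx.
rewrite cutS //; apply/allpairsPdep/idP => [[e [y [ev yr ->]]]|].
  by rewrite /= (src_outs row_fin ev) eqxx eqSS ltnS; rewrite IH in yr.
case: x => [|e x] /= => [/negPn|/andP[/andP[/eqP ev xw] xs]].
  by rewrite (negbTE vreg).
exists e, x; split=> //; first exact/mem_outs.
by rewrite IH xw; move: xs; rewrite eqSS ltnS.
Qed.

Lemma cut_uniq d v : uniq (cut d v).
Proof.
elim: d v => [//|d IH] v.
have [v0|vreg] := eqVneq (outs v) [::]; first by rewrite cut_sink.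
rewrite cutS //; apply: allpairs_uniq_dep => [|e _|].
- exact: outs_uniq.
- exact: IH.
- by move=> [e x] [f y] _ _ /= [-> ->].
Qed.

(** A walk in the cut of depth d' has a unique initial part in the cut of depth
    d; this makes the transition maps of the stages compose. *)
Lemma cut_cut (M : zmodType) d d' v (G : seq (edge F) -> M) : (d <= d')%N ->
  \sum_(x <- cut d v) \sum_(y <- cut (d' - size x) (walk_end v x)) G (x ++ y) =
  \sum_(z <- cut d' v) G z.
Proof.
elim: d d' v G => [|d IH] d' v G; first by rewrite big_seq1 subn0.
have [v0|vreg] := eqVneq (outs v) [::].
  by rewrite (cut_sink d.+1 v0) big_seq1 subn0.
case: d' => // d' dd'; rewrite !big_cutS //; apply: eq_bigr => e _.
by rewrite -(IH d' (rng e) (fun x => G (e :: x))) ?subSS.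
Qed.

(** Iterating a relation of the form G x = sum_e G (x e) from the root down to a
    cut. It serves both for the Cuntz-Krieger relation in L(F) and for its
    image in the target of a map on H(L(F)). *)
Lemma cut_sum (M : zmodType) d v (G : seq (edge F) -> M) :
  (forall x, walk v x -> outs (walk_end v x) != [::] ->
     G x = \sum_(e <- outs (walk_end v x)) G (rcons x e)) ->
  G [::] = \sum_(x <- cut d v) G x.
Proof.
elim: d v G => [|d IH] v G GE; first by rewrite big_seq1.
have [v0|vreg] := eqVneq (outs v) [::]; first by rewrite cut_sink // big_seq1.
rewrite big_cutS // GE // !big_seq; apply: eq_bigr => e /(src_outs row_fin) ev.
rewrite -(IH _ (fun x => G (e :: x))) // => x xw xreg.
by rewrite GE //= ev eqxx.
Qed.

End Paths.

(** * The stages of a graph with levels *)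

Section LevelGraph.
Variables (l : invRing) (F : graph) (row_fin : row_finite F).
Variable lev : vert F -> int.
Hypothesis levE : forall e, lev (rng e) = lev (src e) + 1.

(** A start vertex with a list of edges; wpath says that they form a path. *)
Definition gpath : choiceType := (vert F * seq (edge F))%type.
Implicit Types (a b c : gpath) (v w : vert F) (x y z : seq (edge F)) (n : int).

Definition tip a := walk_end a.1 a.2.
Definition wpath a := walk a.1 a.2.
Definition ext a x : gpath := (a.1, a.2 ++ x).

Lemma tip_ext a x : tip (ext a x) = walk_end (tip a) x.
Proof. exact: walk_end_cat. Qed.

Lemma wpath_ext a x : wpath (ext a x) = wpath a && walk (tip a) x.
Proof. exact: walk_cat. Qed.

Lemma ext0 a : ext a [::] = a.
Proof. by rewrite /ext cats0 -surjective_pairing. Qed.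

Lemma ext_ext a x y : ext (ext a x) y = ext a (x ++ y).
Proof. by rewrite /ext /= catA. Qed.

Lemma ext_inj a : injective (ext a).
Proof. by move=> x y [] /eqP; rewrite eqseq_cat // eqxx => /eqP. Qed.

Lemma lev_walk v x : walk v x -> lev (walk_end v x) = lev v + (size x)%:Z.
Proof.
elim: x v => [|e x IH] v /=; first by rewrite addr0.
by move=> /andP[/eqP <- /IH ->]; rewrite levE; lia.
Qed.

Definition maxpath n a :=
  wpath a && ((lev (tip a) == n) || ((lev (tip a) < n) && (outs (tip a) == [::]))).

Lemma maxpath_walk n a : maxpath n a -> wpath a.
Proof. by case/andP. Qed.

Lemma maxpath_lev n a : maxpath n a -> lev (tip a) <= n.
Proof. by case/andP => _ /orP[/eqP->|/andP[/ltW]]. Qed.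

Definition ncut n v := cut `|n - lev v| v.

Lemma mem_ncut n a x : wpath a -> lev (tip a) <= n ->
  (x \in ncut n (tip a)) = maxpath n (ext a x).
Proof.
move=> aw an; rewrite mem_cut // /maxpath wpath_ext aw tip_ext /=.
case xw: (walk _ x) => //=; rewrite (lev_walk xw).
by congr (_ || _ && _); lia.
Qed.

Lemma ncut_max n a : maxpath n a -> ncut n (tip a) = [:: [::]].
Proof.
case/andP => _ /orP[/eqP an|/andP[_ /eqP a0]]; first by rewrite /ncut an subrr.
exact: cut_sink.
Qed.

Lemma ncut_ncut (M : zmodType) n n' v (G : seq (edge F) -> M) :
  lev v <= n -> n <= n' ->
  \sum_(x <- ncut n v) \sum_(y <- ncut n' (walk_end v x)) G (x ++ y) =
  \sum_(z <- ncut n' v) G z.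
Proof.
move=> vn nn'; rewrite -(@cut_cut _ _ `|n - lev v| `|n' - lev v|); last by lia.
rewrite [LHS]big_seq [RHS]big_seq; apply: eq_bigr => x.
rewrite mem_cut // => /andP[xw xs]; rewrite /ncut (lev_walk xw).
rewrite (_ : `|n' - _|%N = (`|n' - lev v| - size x)%N) //.
have : (size x <= `|n - lev v|)%N by case/orP: xs => [/eqP->|/andP[/ltnW]].
move: (size _) => k kn.
lia.
Qed.

(** A path that is maximal for n has no proper prolongation that is: it would
    have to leave level n upwards, or to leave a sink. The hypothesis is that a
    and b have a common prolongation, of any length; this is the source of all
    orthogonality relations. *)
Lemma maxpath_prefix n a b x y : maxpath n a -> maxpath n b ->
  (size b.2 <= size a.2)%N -> ext a x = ext b y -> a = b.
Proof.
case: a b => [v x'] [w y'] am bm /= sz [vw xy]; subst w.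
have [z x'E] : exists z, x' = y' ++ z.
  exists (drop (size y') x'); rewrite -{1}(cat_take_drop (size y') x'); congr (_ ++ _).
  have := congr1 (take (size y')) xy; rewrite take_cat take_size_cat //.
  case: ltnP => // sz'.
  have -> : size y' = size x' by apply/eqP; rewrite eqn_leq sz sz'.
  by rewrite subnn take0 cats0 take_size => ->.
subst x'; congr (_, _).
have [amw bmw] := (maxpath_walk am, maxpath_walk bm).
have zw : walk (tip (v, y')) z by move: amw; rewrite -[(v, _)]/(ext (v, y') z) wpath_ext => /andP[].
have lz := lev_walk zw; rewrite -tip_ext in lz.
case/andP: bm => _ /orP[/eqP bn|/andP[_ /eqP b0]]; 
  last by rewrite (sink_walk row_fin b0 zw) cats0.
have := maxpath_lev am; rewrite -[(v, _)]/(ext (v, y') z) lz bn => zn.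
have /size0nil -> : size z = 0%N by lia.
by rewrite cats0.
Qed.

Lemma maxpath_eq n a b x y : maxpath n a -> maxpath n b -> ext a x = ext b y -> a = b.
Proof.
move=> am bm abxy; have [sz|/ltnW sz] := leqP (size b.2) (size a.2).
  exact: maxpath_prefix am bm sz abxy.
by apply/esym; apply: (maxpath_prefix bm am sz); exact: esym abxy.
Qed.

Definition stage : Type := ({fset vert F} * int)%type.
HB.instance Definition _ := Choice.on stage.
Implicit Types (i j : stage).

Definition stage_in i a := (a.1 \in i.1) && maxpath i.2 a.
Definition stage_rel i : rel gpath :=
  fun a b => [&& stage_in i a, stage_in i b & tip a == tip b].

Lemma stage_sym i : symmetric (stage_rel i).
Proof. by move=> a b; rewrite /stage_rel andbCA eq_sym. Qed.

Lemma stage_trans i : transitive (stage_rel i).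
Proof.
move=> b a c /and3P[ai bi /eqP ab] /and3P[_ ci /eqP bc].
by rewrite /stage_rel ai ci ab bc eqxx.
Qed.

Definition stage_per i : per gpath := Per (@stage_sym i) (@stage_trans i).
Definition stage_alg i := block_alg l (stage_per i).

Lemma stage_perP i a b : reflect
  [/\ a.1 \in i.1, b.1 \in i.1, maxpath i.2 a, maxpath i.2 b & tip a = tip b]
  (stage_per i a b).
Proof.
by apply: (iffP and3P) => [[/andP[? ?] /andP[? ?] /eqP]|[? ? ? ? ->]];
  split=> //; exact/andP.
Qed.

Definition stage_paths i : seq gpath := [seq (v, x) | v <- i.1, x <- ncut i.2 v].

Lemma stage_pathsP i a : stage_per i a a -> a \in stage_paths i.
Proof.
case: a => v x /stage_perP[/= vi _ am _ _]; apply/allpairsPdep; exists v, x; split=> //.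
have vn : lev v <= i.2.
  by apply: le_trans (maxpath_lev am); rewrite (lev_walk (maxpath_walk am)) lerDl.
by rewrite (@mem_ncut _ (v, [::])).
Qed.

Definition stage_le i j : Prop := (i.1 `<=` j.1)%fset /\ i.2 <= j.2.

Lemma stage_ext i j a b x : stage_le i j -> stage_per i a b -> x \in ncut j.2 (tip a) ->
  stage_per j (ext a x) (ext b x).
Proof.
move=> [ijX ijn] /stage_perP[aX bX am bm ab] xa.
have aw := maxpath_walk am; have bw := maxpath_walk bm.
have an : lev (tip a) <= j.2 by apply: le_trans ijn; exact: maxpath_lev.
apply/stage_perP; split; rewrite ?tip_ext ?ab //; try exact: (fsubsetP ijX).
  by rewrite -mem_ncut.
by rewrite -mem_ncut // -ab.
Qed.

(** At level n', the partial isometry a b* is the sum of the (a x)(b x)*, over the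
    prolongations x of a and b from their common end to level n'. *)
Definition trans_units j a b : stage_alg j :=
  \sum_(x <- ncut j.2 (tip a)) munit l (stage_per j) (ext a x) (ext b x).

Lemma trans_unitsP i j : stage_le i j -> matrix_units (stage_per i) (trans_units j).
Proof.
move=> ij; split=> [a b c ab bc|a b c d ab cd bc|a b ab]; rewrite /trans_units.
- have /stage_perP[_ _ _ _ tab] := ab.
  rewrite amul_suml; apply: eq_big_seq => x xa.
  rewrite amul_sumr (bigD1_seq x) ?cut_uniq -?tab // big1_seq.
    by rewrite Monoid.mulm1 munitM //; [exact: (stage_ext ij)|apply: (stage_ext ij); rewrite -?tab].
  move=> y /andP[yx ya]; rewrite munit0 //.
  + exact: (stage_ext ij).
  + by apply: (stage_ext ij); rewrite -?tab.
  + by apply: contra yx => /eqP/ext_inj ->.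
- rewrite amul_suml big1_seq // => x /andP[_ xa].
  rewrite amul_sumr big1_seq // => y /andP[_ yc].
  have /stage_perP[_ _ _ bm _] := ab; have /stage_perP[_ _ cm _ _] := cd.
  rewrite munit0 //; try exact: (stage_ext ij).
  by apply: contra bc => /eqP/(maxpath_eq bm cm) ->.
- have /stage_perP[_ _ _ _ tab] := ab; rewrite astar_sum -tab.
  by apply: eq_big_seq => x xa; rewrite munit_star //; exact: (stage_ext ij).
Qed.

Definition trans i j (ij : stage_le i j) : starHom (stage_alg i) (stage_alg j) :=
  block_hom (trans_unitsP ij).

Lemma transE i j (ij : stage_le i j) a b : stage_per i a b ->
  trans ij (munit l (stage_per i) a b) = trans_units j a b.
Proof. exact: block_homE. Qed.

Lemma stage_le_refl i : stage_le i i.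
Proof. by split. Qed.

Lemma stage_le_trans i j k : stage_le j k -> stage_le i j -> stage_le i k.
Proof.
by move=> [jkX jkn] [ijX ijn]; split; [exact: fsubset_trans ijX jkX|exact: le_trans ijn jkn].
Qed.

Definition stage_cat : category.
refine (@Category stage stage_le stage_le_refl (fun i j k => @stage_le_trans i j k) _ _ _);
  by intros; apply: Prop_irrelevance.
Defined.

Lemma trans_id i (ii : stage_le i i) : trans ii = starHom_id (stage_alg i).
Proof.
apply: block_hom_eq => a b ab; rewrite transE // /trans_units.
have /stage_perP[_ _ am _ _] := ab.
by rewrite (ncut_max am) big_seq1 !ext0.
Qed.

Lemma trans_comp i j k (ij : stage_le i j) (jk : stage_le j k) (ik : stage_le i k) :
  trans ik = starHom_comp (trans jk) (trans ij).
Proof.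
apply: block_hom_eq => a b ab; rewrite starHom_compE !transE // /trans_units.
have /stage_perP[_ _ am bm tab] := ab.
have an := maxpath_lev am; have [_ ijn] := ij; have [_ jkn] := jk.
rewrite shom_sum -(ncut_ncut _ (le_trans an ijn) jkn); apply: eq_big_seq => x xa.
rewrite transE; last exact: (stage_ext ij).
by rewrite /trans_units tip_ext; apply: eq_bigr => y _; rewrite !ext_ext.
Qed.

Definition stage_functor : functor stage_cat (starAlgCat l).
refine (@Functor stage_cat (starAlgCat l) stage_alg (fun i j => @trans i j) _ _).
- by move=> i; exact: trans_id.
- by move=> i j k jk ij; exact: trans_comp.
Defined.

Lemma stage_small : small stage_cat.
Proof.
split; first by exists stage, id.
by move=> i j; exists unit, (fun=> tt) => h h' _; exact: (@Prop_irrelevance (stage_le i j)).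
Qed.

Definition stage_join i j : stage := ((i.1 `|` j.1)%fset, Order.max i.2 j.2).

Lemma stage_joinl i j : stage_le i (stage_join i j).
Proof. by split; [exact: fsubsetUl|rewrite le_max lexx]. Qed.

Lemma stage_joinr i j : stage_le j (stage_join i j).
Proof. by split; [exact: fsubsetUr|rewrite le_max lexx orbT]. Qed.

Lemma stage_filtering : filtering stage_cat.
Proof.
split; first by exists; exact: (fset0, 0).
  move=> i j; exists (stage_join i j).
  by split; exists; [exact: stage_joinl|exact: stage_joinr].
move=> i j f g; exists j, (stage_le_refl j); exact: (@Prop_irrelevance (stage_le i j)).
Qed.

End LevelGraph.

(** * L(F) as the colimit of the stages *)

Section PathElements.
Variables (l : invRing) (F : graph) (row_fin : row_finite F).
Implicit Types (v w : vert F) (x y : seq (edge F)).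
Local Notation L := (leavitt l F).

Fixpoint lpath v x : L :=
  if x is e :: x' then amul (ledge l e) (lpath (rng e) x') else lvert l v.

Lemma lpath_src v x : walk v x -> amul (lvert l v) (lpath v x) = lpath v x.
Proof.
case: x => [_|e x /andP[/eqP <- _]]; first exact: lvert_idem.
by rewrite amulA lsrc_edge.
Qed.

Lemma lpath_cat v x y : walk v (x ++ y) ->
  lpath v (x ++ y) = amul (lpath v x) (lpath (walk_end v x) y).
Proof.
elim: x v => [|e x IH] v; first by move/lpath_src => ->.
by move=> /andP[_ xy]; rewrite cat_cons !/(lpath _ (_ :: _)) -/lpath IH // amulA.
Qed.

Lemma lpath1 e : lpath (src e) [:: e] = ledge l e.
Proof. exact: ledge_rng. Qed.

Lemma lpath_rcons v x e : walk v x -> src e = walk_end v x ->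
  lpath v (rcons x e) = amul (lpath v x) (ledge l e).
Proof.
move=> xw ex; rewrite -cats1 lpath_cat; first by rewrite -ex lpath1.
by rewrite walk_cat xw /= ex eqxx.
Qed.

Lemma lpath_end v x : walk v x -> amul (lpath v x) (lvert l (walk_end v x)) = lpath v x.
Proof. by move=> xw; rewrite -[lvert l _]/(lpath _ [::]) -lpath_cat cats0. Qed.

Lemma lpath_isometry v x : walk v x ->
  amul (astar (lpath v x)) (lpath v x) = lvert l (walk_end v x).
Proof.
elim: x v => [|e x IH] v; first by rewrite lvert_star lvert_idem.
move=> /andP[_ xw]; rewrite [lpath _ _]/(amul _ _) -/lpath astarM -amulA.
by rewrite [amul _ (amul (ledge l e) _)]amulA ledge_CK1 lpath_src // IH.
Qed.

(** When two paths separate, e* f = 0 occurs at the first edges where they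
    differ, or the product of two vertices if they start at different ones. *)
Lemma lpath_orth v w x y : walk v x -> walk w y ->
  (forall x' y', (v, x ++ x') <> (w, y ++ y')) ->
  amul (astar (lpath v x)) (lpath w y) = 0.
Proof.
elim: x v w y => [|e x IH] v w y xw yw xy.
  have vw : v <> w by move=> vw; apply: (xy y [::]); rewrite vw cats0.
  by rewrite lvert_star -(lpath_src yw) amulA lvert_orth // amul0.
case: y yw xy => [_ xy|f y /andP[/eqP fw yw] xy].
  have vw : v <> w by move=> vw; apply: (xy [::] (e :: x)); rewrite vw cats0.
  rewrite -(lpath_src xw) astarM lvert_star -amulA [lpath w _]/(lvert l w).
  by rewrite lvert_orth // amulx0.
move: xw => /andP[/eqP ev xw].
rewrite [lpath v _]/(amul _ _) [lpath w _]/(amul _ _) -/lpath astarM -amulA.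
rewrite [amul _ (amul (ledge l f) _)]amulA.
have [ef|/eqP ef] := eqVneq e f; last by rewrite ledge_CK1_neq // amul0 amulx0.
subst f; rewrite ledge_CK1 lpath_src //; apply: IH => // x' y' [xy'].
by apply: (xy x' y'); rewrite -ev fw /= xy'.
Qed.

(** Needed to apply Hmap_point_equiv to paths. *)
Lemma lpath_nil2 v x : walk v x -> walk_end v x <> v -> amul (lpath v x) (lpath v x) = 0.
Proof.
move=> xw vx; rewrite -{1}(lpath_end xw) -amulA -{2}(lpath_src xw).
by rewrite [amul (lvert l _) _]amulA lvert_orth // amul0 amulx0.
Qed.

End PathElements.

Section Colimit.
Variables (l : invRing) (F : graph) (row_fin : row_finite F).
Variable lev : vert F -> int.
Hypothesis levE : forall e, lev (rng e) = lev (src e) + 1.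
Implicit Types (a b c d : gpath F) (v w : vert F) (x y z : seq (edge F)) (n : int).
Implicit Types (i j : stage F).
Local Notation L := (leavitt l F).
Local Notation stage_per := (stage_per lev).
Local Notation stage_alg := (stage_alg l lev).
Local Notation munit i := (munit l (stage_per i)).
Local Notation trans := (trans l row_fin levE).
Local Notation D := (stage_functor l row_fin levE).

Definition pathel a : L := lpath l a.1 a.2.

Lemma pathel_orth a b : wpath a -> wpath b -> (forall x y, ext a x <> ext b y) ->
  amul (astar (pathel a)) (pathel b) = 0.
Proof. exact: lpath_orth. Qed.

Lemma pathel_isometry a : wpath a -> amul (astar (pathel a)) (pathel a) = lvert l (tip a).
Proof. exact: lpath_isometry. Qed.

Lemma pathel_tip a : wpath a -> amul (pathel a) (lvert l (tip a)) = pathel a.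
Proof. exact: lpath_end. Qed.

Definition cone_units a b : L := amul (pathel a) (astar (pathel b)).

Lemma cone_unitsP i : matrix_units (stage_per i) cone_units.
Proof.
have mE a b c d : amul (cone_units a b) (cone_units c d) =
    amul (pathel a) (amul (amul (astar (pathel b)) (pathel c)) (astar (pathel d))).
  by rewrite /cone_units !amulA.
split=> [a b c|a b c d|a b]; last by rewrite /cone_units astarM astarK.
- move=> /stage_perP[_ _ am bm ab] /stage_perP[_ _ _ cm bc].
  rewrite mE (pathel_isometry (maxpath_walk bm)) -ab /cone_units.
  by rewrite amulA pathel_tip // (maxpath_walk am).
- move=> /stage_perP[_ _ am bm ab] /stage_perP[_ _ cm dm cd] bc.
  rewrite mE pathel_orth ?(maxpath_walk bm) ?(maxpath_walk cm) ?amul0 ?amulx0 //.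
  move=> x y xy; apply: (negP bc); apply/eqP.
  exact: (maxpath_eq row_fin levE bm cm xy).
Qed.

Definition cone i : starHom (stage_alg i) L := block_hom (cone_unitsP i).

Lemma coneE i a b : stage_per i a b -> cone i (munit i a b) = cone_units a b.
Proof. exact: block_homE. Qed.

(** The identity a b* = sum_x (a x)(b x)* in L(F): the second Cuntz-Krieger
    relation, applied repeatedly. *)
Lemma cone_trans i j (ij : stage_le i j) :
  starHom_comp (cone j) (trans ij) = cone i.
Proof.
apply: block_hom_eq => a b ab; rewrite starHom_compE transE // coneE // /trans_units shom_sum.
have /stage_perP[_ _ am bm tab] := ab.
have aw := maxpath_walk am; have bw := maxpath_walk bm.
rewrite -[a in RHS]ext0 -[b in RHS]ext0.
rewrite (@cut_sum _ row_fin _ `|j.2 - lev (tip a)| (tip a)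
          (fun x => cone_units (ext a x) (ext b x))).
  by apply: eq_big_seq => x xa; rewrite coneE //; exact: (stage_ext row_fin levE ij ab xa).
move=> x xw xreg.
have xw' : walk (tip b) x by rewrite -tab.
have rE c e : wpath c -> walk (tip c) x -> src e = walk_end (tip c) x ->
    pathel (ext c (rcons x e)) = amul (pathel (ext c x)) (ledge l e).
  move=> cw cx ex; rewrite /pathel /= -rcons_cat; apply: lpath_rcons.
    by rewrite walk_cat cx andbT.
  by rewrite ex walk_end_cat.
transitivity (amul (amul (pathel (ext a x)) (lvert l (walk_end (tip a) x)))
                   (astar (pathel (ext b x)))).
  by rewrite -tip_ext pathel_tip // wpath_ext aw.
rewrite (lvert_CK2 l row_fin xreg) amul_sumr amul_suml; apply: eq_big_seq => e.
move=> /(src_outs row_fin) ex.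
by rewrite /cone_units !rE -?tab // astarM !amulA.
Qed.

Lemma cone_is_cocone : is_cocone (D := D) cone.
Proof. by move=> i j ij; exact: cone_trans. Qed.

Section Factor.
Variables (C : starAlg l) (k : forall i, starHom (stage_alg i) C).
Hypothesis kT : forall i j (ij : stage_le i j), starHom_comp (k j) (trans ij) = k i.

(** The pairs for which a b* is a partial isometry in L(F). *)
Definition good a b := [&& wpath a, wpath b & tip a == tip b].

(** The smallest stage with the matrix unit e_(a,b). *)
Definition home a b : stage F := ([fset a.1; b.1]%fset, lev (tip a)).

(** The image of a b* under the homomorphism from L(F) to C that is to be
    constructed. *)
Definition value a b : C := k (home a b) (munit (home a b) a b).

Lemma home_per a b : good a b -> stage_per (home a b) a b.
Proof.
case/and3P => aw bw /eqP ab; apply/stage_perP; split=> //.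
- by rewrite in_fset2 eqxx.
- by rewrite in_fset2 eqxx orbT.
- by rewrite /maxpath aw eqxx.
- by rewrite /maxpath bw -ab eqxx.
Qed.

(** This is the compatibility of k, for the transition from home a b to i. *)
Lemma value_expand i a b : good a b -> a.1 \in i.1 -> b.1 \in i.1 -> lev (tip a) <= i.2 ->
  value a b = \sum_(x <- ncut lev i.2 (tip a)) k i (munit i (ext a x) (ext b x)).
Proof.
move=> gab aX bX an.
have ij : stage_le (home a b) i.
  by split=> //; apply/fsubsetP => v; rewrite in_fset2 => /orP[] /eqP ->.
rewrite /value -(kT ij) starHom_compE transE; last exact: home_per.
by rewrite shom_sum.
Qed.

Lemma value_stage i a b : stage_per i a b -> k i (munit i a b) = value a b.
Proof.
case/stage_perP => aX bX am bm ab; rewrite (@value_expand i) //.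
- by rewrite (ncut_max am) big_seq1 !ext0.
- by rewrite /good (maxpath_walk am) (maxpath_walk bm) ab eqxx.
- exact: maxpath_lev.
Qed.

Lemma value_star a b : good a b -> astar (value a b) = value b a.
Proof.
move=> gab; have hab := home_per gab.
rewrite {1}/value -shom_star munit_star // value_stage //.
by rewrite per_sym.
Qed.

(** The rule (a b* ) ((b x) c* ) = (a x) c*. The factors live at different
    levels. At the level of c, the first one is the sum of the (a y)(b y)*, and
    only y = x survives the multiplication. *)
Lemma value_mul a b c x : good a b -> good (ext b x) c ->
  amul (value a b) (value (ext b x) c) = value (ext a x) c.
Proof.
move=> gab gbc; have [aw bw /eqP ab] := and3P gab.
have [bxw cw /eqP bxc] := and3P gbc.
have xw : walk (tip b) x by move: bxw; rewrite wpath_ext => /andP[].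
pose i : stage F := ([fset a.1; b.1; c.1]%fset, lev (tip c)).
have aX : a.1 \in i.1 by rewrite !inE eqxx.
have bX : b.1 \in i.1 by rewrite !inE eqxx orbT.
have cX : c.1 \in i.1 by rewrite !inE eqxx orbT.
have bn : lev (tip b) <= i.2 by rewrite /= -bxc tip_ext (lev_walk levE xw) lerDl.
have cm : maxpath lev i.2 c by rewrite /maxpath cw eqxx.
have bxm : maxpath lev i.2 (ext b x) by rewrite /maxpath bxw bxc eqxx.
have axw : wpath (ext a x) by rewrite wpath_ext aw ab.
have axE : tip (ext a x) = tip c by rewrite tip_ext ab -tip_ext.
have axm : maxpath lev i.2 (ext a x) by rewrite /maxpath axw axE eqxx.
have pbc : stage_per i (ext b x) c by apply/stage_perP.
have pac : stage_per i (ext a x) c by apply/stage_perP.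
have pab y : y \in ncut lev i.2 (tip a) -> stage_per i (ext a y) (ext b y).
  move=> ya; apply/stage_perP; split=> //; last by rewrite !tip_ext ab.
    by rewrite -mem_ncut // ab.
  by rewrite -mem_ncut // -ab.
have xa : x \in ncut lev i.2 (tip a) by rewrite mem_ncut // ab.
rewrite -(value_stage pbc) -(value_stage pac) (value_expand gab aX bX) ?ab // -ab.
rewrite amul_suml (bigD1_seq x) ?cut_uniq // big1_seq.
  by rewrite Monoid.mulm1 -shomM munitM // pab.
move=> y /andP[yx ya]; rewrite -shomM munit0 ?shom0 ?pab //.
by apply: contra yx => /eqP/ext_inj ->.
Qed.

(** Moving both factors to a common stage; there, no b x is equal to any c y. *)
Lemma value_orth a b c d : good a b -> good c d -> (forall x y, ext b x <> ext c y) ->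
  amul (value a b) (value c d) = 0.
Proof.
move=> gab gcd bc; have [aw bw /eqP ab] := and3P gab.
have [cw dw /eqP cd] := and3P gcd.
pose i := stage_join (home a b) (home c d).
have aX : a.1 \in i.1 by rewrite !inE eqxx.
have bX : b.1 \in i.1 by rewrite !inE eqxx !orbT.
have cX : c.1 \in i.1 by rewrite !inE eqxx !orbT.
have dX : d.1 \in i.1 by rewrite !inE eqxx !orbT.
have an : lev (tip a) <= i.2 by rewrite le_max lexx.
have cn : lev (tip c) <= i.2 by rewrite le_max lexx orbT.
have pE a' b' x : good a' b' -> a'.1 \in i.1 -> b'.1 \in i.1 -> lev (tip a') <= i.2 ->
    x \in ncut lev i.2 (tip a') -> stage_per i (ext a' x) (ext b' x).
  case/and3P => aw' bw' /eqP ab' aX' bX' an' xa; apply/stage_perP; split=> //.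
  - by rewrite -mem_ncut.
  - by rewrite -mem_ncut // -ab'.
  - by rewrite !tip_ext ab'.
rewrite (value_expand gab aX bX an) (value_expand gcd cX dX cn).
rewrite amul_suml big1_seq // => x /andP[_ xa]; rewrite amul_sumr big1_seq // => y /andP[_ yc].
rewrite -shomM munit0 ?shom0 //; try exact: pE.
by apply/eqP; exact: bc.
Qed.

Definition vpath v : gpath F := (v, [::]).
Definition epath (e : edge F) : gpath F := (src e, [:: e]).

Lemma good_vpath v : good (vpath v) (vpath v).
Proof. by rewrite /good eqxx. Qed.

Lemma good_epath e : good (epath e) (vpath (rng e)).
Proof. by rewrite /good /wpath /tip /= !eqxx. Qed.

Lemma value_mul0 a b c : good a b -> good b c -> amul (value a b) (value b c) = value a c.
Proof. by have := @value_mul a b c [::]; rewrite !ext0; apply. Qed.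

Lemma good_sym a b : good a b = good b a.
Proof. by rewrite /good andbCA eq_sym. Qed.

(** Each Leavitt relation is an instance of value_mul, value_star or value_orth,
    except for the second Cuntz-Krieger relation, which is value_expand for one
    further level. *)
Lemma value_family : leavitt_family (fun v => value (vpath v) (vpath v))
  (fun e => value (epath e) (vpath (rng e))).
Proof.
have ge := good_epath; have gv := good_vpath.
have ge' e : good (vpath (rng e)) (epath e) by rewrite good_sym.
split=> [v|v w vw|v|e|e|e|e f ef|v vreg].
- exact: value_mul0.
- by rewrite value_orth // => x y [].
- exact: value_star.
- exact: (@value_mul (vpath (src e)) (vpath (src e)) (vpath (rng e)) [:: e] (gv _) (ge e)).
- exact: value_mul0.
- by rewrite value_star // value_mul0.
- by rewrite value_star // value_orth // => x y [].
pose i : stage F := ((v |` [fset rng e | e in outs v])%fset, lev v + 1).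
have vX : v \in i.1 by rewrite !inE eqxx.
rewrite (value_expand (i := i)) //=; last by rewrite lerDl.
rewrite /ncut (_ : `|_|%N = 1%N); last by rewrite /tip /=; lia.
rewrite big_cutS //; apply: eq_big_seq => e /(src_outs row_fin) ev; rewrite big_seq1.
have {}ev : src e = v := ev.
have em : maxpath lev i.2 (epath e) by rewrite /maxpath /wpath /tip /= eqxx levE ev eqxx.
have ei : stage_per i (epath e) (epath e) by apply/stage_perP; split; rewrite //= ev.
by rewrite value_star // value_mul0 // -(value_stage ei) /ext /= /epath ev.
Qed.

Definition factor : starHom L C := leavitt_hom row_fin value_family.

Lemma factor_lpath v x : walk v x ->
  factor (lpath l v x) = value (v, x) (vpath (walk_end v x)).
Proof.
elim: x v => [|e x IH] v; first by move=> _; exact: leavitt_hom_vert.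
move=> /andP[/eqP ev xw]; rewrite [lpath _ _ _]/(amul _ _) -/lpath shomM IH //.
rewrite [X in amul X _]leavitt_hom_edge.
rewrite [LHS](@value_mul (epath e) (vpath (rng e)) (vpath (walk_end (rng e) x)) x).
- by rewrite /ext /= ev.
- exact: good_epath.
- by apply/and3P; split=> //; exact: xw.
Qed.

Lemma factor_cone i : starHom_comp factor (cone i) = k i.
Proof.
apply: block_hom_eq => a b ab; rewrite starHom_compE coneE // (value_stage ab).
have /stage_perP[_ _ am bm tab] := ab.
have aw := maxpath_walk am; have bw := maxpath_walk bm.
have g c : wpath c -> good c (vpath (tip c)) by move=> cw; rewrite /good cw eqxx.
have pE c : wpath c -> factor (pathel c) = value c (vpath (tip c)).
  by case: c => v x; exact: factor_lpath.
rewrite /cone_units shomM shom_star !pE // value_star ?g // -tab value_mul0 ?g //.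
by rewrite good_sym tab g.
Qed.

End Factor.

(** A cocone factors through L(F) because the generators lie in the images of
    the stages and satisfy the relations there; the factorization is unique for
    the same reason. *)
Lemma cone_colimit : is_colimit (D := D) cone.
Proof.
split; first exact: cone_is_cocone.
move=> C k kT; exists (factor kT); split; first by move=> i; exact: factor_cone.
move=> u uk; apply: leavitt_hom_eq => [v|e].
- have hv := home_per (good_vpath v).
  have vE : cone (home (vpath v) (vpath v)) (munit _ (vpath v) (vpath v)) = lvert l v.
    rewrite coneE // -[LHS]/(amul (lvert l v) (astar (lvert l v))).
    by rewrite lvert_star lvert_idem.
  have fu i : starHom_comp (factor kT) (cone i) = starHom_comp u (cone i).
    by rewrite factor_cone -uk.
  have := congr1 (fun h => shom_fun h (munit _ (vpath v) (vpath v))) (fu (home (vpath v) (vpath v))).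
  by rewrite !starHom_compE vE.
- have he := home_per (good_epath e).
  have eE : cone (home (epath e) (vpath (rng e))) (munit _ (epath e) (vpath (rng e))) = ledge l e.
    rewrite coneE // -[LHS]/(amul (amul (ledge l e) (lvert l (rng e))) (astar (lvert l (rng e)))).
    by rewrite lvert_star -amulA lvert_idem ledge_rng.
  have fu i : starHom_comp (factor kT) (cone i) = starHom_comp u (cone i).
    by rewrite factor_cone -uk.
  have := congr1 (fun h => shom_fun h (munit _ (epath e) (vpath (rng e)))) (fu (home (epath e) (vpath (rng e)))).
  by rewrite !starHom_compE eE.
Qed.

End Colimit.

(** * The homology of L(F) by generators and relations *)

Section VertexProjector.
Variables (l : invRing) (F : graph).

Definition vproj (v : vert F) : projector (leavitt l F) :=
  Projector (lvert_idem l v) (lvert_star l v).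

End VertexProjector.

Section LeavittHomology.
Variables (l : invRing) (H : functor (starAlgCat l) Ab).
Hypotheses (Hst : Minf_stable H) (Hadd : additive_functor H).
Hypothesis Hcolim : preserves_filtering_colimits H.
Variables (F : graph) (row_fin : row_finite F).

Section EdgeProjector.
Variable e : edge F.
Let w := ledge l e.

Lemma eproj_idem : amul (amul w (astar w)) (amul w (astar w)) = amul w (astar w).
Proof. by rewrite amulA -[amul (amul w _) w]amulA ledge_CK1 ledge_rng. Qed.

Lemma eproj_star : astar (amul w (astar w)) = amul w (astar w).
Proof. by rewrite astarM astarK. Qed.

Definition eproj : projector (leavitt l F) := Projector eproj_idem eproj_star.

End EdgeProjector.

(** The vertex v is the orthogonal sum of the e e*, and e* is an equivalence from
    e e* to r(e). It has square zero because e is not a loop. *)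
Lemma vertex_relation (v : vert F) : (forall e : edge F, rng e <> src e) ->
  outs v != [::] ->
  forall x, Hmap H (point_hom (vproj l v)) x = \sum_(e <- outs v) Hmap H (point_hom (vproj l (rng e))) x.
Proof.
move=> no_loop vreg x.
rewrite (Hmap_point_sum Hadd (r := outs v) (p := eproj)).
- apply: eq_bigr => e _; apply: (Hmap_point_equiv Hst (w := astar (ledge l e))).
  + by rewrite astarK.
  + by rewrite astarK; exact: ledge_CK1.
  + by rewrite -[RHS](congr1 (@astar _ _) (ledge_rng l e)) astarM lvert_star.
  + rewrite -astarM -{1}(ledge_rng l e) -amulA -{2}(lsrc_edge l e) [amul (lvert l _) _]amulA.
    by rewrite lvert_orth ?amul0 ?amulx0 ?astar0 //; exact: no_loop.
- exact: outs_uniq.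
- move=> e f _ _ ef; rewrite -amulA [X in amul _ X]amulA ledge_CK1_neq; last exact/eqP.
  by rewrite amul0 amulx0.
- exact: lvert_CK2.
Qed.

Variable lev : vert F -> int.
Hypothesis levE : forall e, lev (rng e) = lev (src e) + 1.

Local Notation D := (stage_functor l row_fin levE).
Local Notation cone := (cone l row_fin levE).

Lemma Hcone_colimit : is_colimit (D := functor_comp H D) (fun i => Hmap H (cone i)).
Proof.
exact: (Hcolim (stage_small F) (stage_filtering F) (cone_colimit l row_fin levE)).
Qed.

(** The projection a a* is equivalent to the end of a. *)
Lemma cone_diag i a x : stage_per lev i a a ->
  Hmap H (cone i) (Hmap H (point_hom (diag_unit l (stage_per lev i) a)) x) =
  Hmap H (point_hom (vproj l (tip a))) x.
Proof.
move=> aa; have /stage_perP[_ _ am _ _] := aa.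
have aw := maxpath_walk am.
rewrite (Hmap_pushE (q := push (cone i) (diag_unit l (stage_per lev i) a))) //.
have pE : (push (cone i) (diag_unit l (stage_per lev i) a) : leavitt l F) =
    amul (pathel l a) (astar (pathel l a)) by exact: coneE.
have [a0|a1] := eqVneq a.2 [::].
  apply: Hmap_eq => y; rewrite !point_homE pE; congr (_ *: _).
  by rewrite /pathel /tip a0 lvert_star lvert_idem.
apply: (Hmap_point_equiv Hst (w := astar (pathel l a))).
- by rewrite astarK.
- by rewrite astarK pathel_isometry.
- by rewrite -{2}(pathel_tip l aw) astarM lvert_star.
- rewrite -astarM (_ : amul _ _ = 0) ?astar0 //; apply: lpath_nil2 => // tE.
  have := lev_walk levE aw; rewrite tE => /eqP.
  by rewrite -[X in X == _]addr0 (inj_eq (addrI _)) eq_sym; case: (a.2) a1.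
Qed.

(** By the uniqueness part of the colimit property of H(L(F)). *)
Lemma leavitt_gen (M : zmodType) (f g : {additive Hob H (leavitt l F) -> M}) :
  (forall v x, f (Hmap H (point_hom (vproj l v)) x) = g (Hmap H (point_hom (vproj l v)) x)) ->
  forall y, f y = g y.
Proof.
move=> fg; have [kk ku] := Hcone_colimit.
pose kf (i : stage_cat F) : {additive Hob H (stage_alg l lev i) -> M} := f \o Hmap H (cone i).
have kfT : is_cocone (C := Ab) (D := functor_comp H D) (c := M) kf.
  move=> i j ij; apply: additive_eq => x.
  have := congr1 (fun h : {additive _ -> _} => h x) (kk i j ij).
  by rewrite /= => ->.
have [u [_ u_uniq]] := ku M kf kfT.
have uf : u = f by apply: u_uniq => i; exact: additive_eq.
have ug : u = g.
  apply: u_uniq => i; apply: additive_eq => y; apply/esym; move: y.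
  apply: (block_gen Hst Hadd (@stage_pathsP F row_fin lev levE i) (f := kf i) (g := g \o Hmap H (cone i))).
  by move=> a x aa; rewrite /= !cone_diag.
by move=> y; rewrite -uf -ug.
Qed.

(** Such a family g defines maps on the stages, by the end vertices of paths. The
    relation for g, iterated along cuts, says that they form a cocone. *)
Lemma leavitt_ext (M : zmodType) (g : vert F -> {additive Hob H (base_alg l) -> M}) :
  (forall v x, outs v != [::] -> g v x = \sum_(e <- outs v) g (rng e) x) ->
  exists psi : {additive Hob H (leavitt l F) -> M},
    forall v x, psi (Hmap H (point_hom (vproj l v)) x) = g v x.
Proof.
move=> gE.
have psi_ex (i : stage_cat F) : {psi : {additive Hob H (stage_alg l lev i) -> M} |
    forall a x, stage_per lev i a a ->
      psi (Hmap H (point_hom (diag_unit l (stage_per lev i) a)) x) = g (tip a) x}.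
  apply: cid; apply: (block_ext Hst Hadd (@stage_pathsP F row_fin lev levE i) (g := fun a => g (tip a))).
  by move=> a b x /stage_perP[_ _ _ _ ->].
pose psi i := sval (psi_ex i).
have psiE i a x (aa : stage_per lev i a a) :
    psi i (Hmap H (point_hom (diag_unit l (stage_per lev i) a)) x) = g (tip a) x.
  exact: (svalP (psi_ex i)).
have [kk ku] := Hcone_colimit.
have psiT : is_cocone (C := Ab) (D := functor_comp H D) (c := M) psi.
  move=> i j ij; apply: additive_eq.
  apply: (block_gen Hst Hadd (@stage_pathsP F row_fin lev levE i)
            (f := psi j \o Hmap H (trans l row_fin levE ij)) (g := psi i)) => a x aa.
  have /stage_perP[_ _ am _ _] := aa.
  pose d (y : seq (edge F)) := diag_unit l (stage_per lev j) (ext a y).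
  pose q := push (trans l row_fin levE ij) (diag_unit l (stage_per lev i) a).
  rewrite psiE // -[LHS]/(psi j (Hmap H (trans l row_fin levE ij) _)).
  rewrite (Hmap_pushE (q := q)) // (Hmap_point_sum Hadd (r := ncut lev j.2 (tip a)) (p := d)).
  - have -> : g (tip a) x = \sum_(y <- ncut lev j.2 (tip a)) g (walk_end (tip a) y) x.
      apply: (@cut_sum _ row_fin _ _ (tip a) (fun y => g (walk_end (tip a) y) x)) => y yw yreg.
      by rewrite gE //; apply: eq_bigr => e _; rewrite -cats1 walk_end_cat.
    rewrite raddf_sum; apply: eq_big_seq => y ya; rewrite -tip_ext; apply: psiE.
    exact: (stage_ext row_fin levE ij aa ya).
  - exact: cut_uniq.
  - by move=> y z _ _ yz; apply: diag_unit_orth; apply: contra yz => /eqP/ext_inj ->.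
  - exact: transE.
have [u [uk _]] := ku M psi psiT.
exists u => v x.
have vv := home_per lev (good_vpath v).
rewrite -[v in LHS]/(tip (vpath v)) -(cone_diag x vv) -(psiE _ _ x vv).
by rewrite -(uk (home lev (vpath v) (vpath v))).
Qed.

End LeavittHomology.

(** * Tensor products, free modules and cokernels *)

Section TensorUniversal.
Variables (R : pzRingType) (M : lmodType R) (A N : zmodType).

Lemma tensB m : zmod_morphism (@tens R M A m).
Proof. by move=> a b; rewrite -{2}(subrK b a) [X in _ = X - _]tensDr addrK. Qed.

Lemma tens0l (a : A) : tens (0 : M) a = 0.
Proof. by apply: (addIr (tens (0 : M) a)); rewrite -tensDl !add0r. Qed.

Lemma tensBl (a : A) : {morph (fun m : M => tens m a) : m m' / m - m'}.
Proof. by move=> m m'; rewrite -{2}(subrK m' m) [X in _ = X - _]tensDl addrK. Qed.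

Lemma tens_suml (I : Type) (r : seq I) (f : I -> M) (a : A) :
  tens (\sum_(i <- r) f i) a = \sum_(i <- r) tens (f i) a.
Proof.
apply: (big_morph (fun m => tens m a)) => [m m'|]; [exact: tensDl|exact: tens0l].
Qed.

Lemma tensor_gen (f g : {additive tensor M A -> N}) :
  (forall m a, f (tens m a) = g (tens m a)) -> forall t, f t = g t.
Proof.
move=> fg; elim/quotW; elim/malg_ind => [|x y IHx IHy|z k].
- by rewrite !raddf0.
- by rewrite !raddfD /= IHx IHy.
- by rewrite pi_tensorU !raddfMz fg.
Qed.

Lemma tensor_lift (b : M -> A -> N) :
  (forall m, {morph b m : a a' / a + a'}) ->
  (forall a, {morph b^~ a : m m' / m + m'}) ->
  exists f : {additive tensor M A -> N}, forall m a, f (tens m a) = b m a.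
Proof.
move=> bDr bDl.
pose c (k : (M * A)%type) (z : int) : N := b k.1 k.2 *~ z.
have cD k : {morph c k : z z' / z + z'} by move=> z z'; rewrite /c mulrzDr.
have cB : {morph lin c : x y / x - y} by move=> x y; rewrite linD // linN.
have c1 m a : lin c << (m, a) >> = b m a by rewrite linU //= /c mulr1z.
have c_rel x : tens_rel x -> lin c x = 0.
  elim=> [|{}x y _ x0 _ y0|m m' a|m a a'].
  - exact: lin0.
  - by rewrite cB x0 y0 subr0.
  - by rewrite !cB !c1 bDl addrAC addrK subrr.
  - by rewrite !cB !c1 bDr addrAC addrK subrr.
pose f (t : tensor M A) := lin c (repr t).
have fE x : f (\pi_(tensor M A) x) = lin c x.
  have /tensor_eqP xr : \pi_(tensor M A) (repr (\pi_(tensor M A) x)) == \pi_(tensor M A) x.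
    by rewrite reprK.
  by apply/eqP; rewrite -subr_eq0 -cB; apply/eqP; exact: c_rel.
have fB : zmod_morphism f.
  elim/quotW => x; elim/quotW => y.
  have -> : \pi_(tensor M A) x - \pi_(tensor M A) y = \pi_(tensor M A) (x - y).
    by rewrite [RHS]raddfB.
  by rewrite !fE cB.
exists (HB.pack f (GRing.isZmodMorphism.Build _ _ f fB) : {additive _ -> _}).
by move=> m a; rewrite [LHS]fE.
Qed.

End TensorUniversal.

Section FreeModule.
Variables (R : comNzRingType) (I : choiceType).

Lemma free_scaleU (r : R) (i : I) : << r *g i >> = r *: << i >> :> {malg R[I]}.
Proof. by apply/malgP => j; rewrite mcoeffZ !mcoeffU mulr_natr. Qed.

Lemma free_lift (N : lmodType R) (h : I -> N) :
  exists f : {linear {malg R[I]} -> N}, forall i, f << i >> = h i.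
Proof.
have [f0 fD fU] : exists2 f0 : {malg R[I]} -> N, {morph f0 : x y / x + y} &
    forall r i, f0 << r *g i >> = r *: h i.
  exists (lin (fun i r => r *: h i)); first by apply: linD => i r s; rewrite scalerDl.
  by move=> r i; rewrite linU // => j s t; rewrite scalerDl.
have f0Z r x : f0 (r *: x) = r *: f0 x.
  elim/malg_ind: x => [|x y IHx IHy|s i].
  - have f00 : f0 0 = 0 by apply: (addIr (f0 0)); rewrite -fD !add0r.
    by rewrite [r *: 0]scaler0 f00 scaler0.
  - by rewrite [r *: (x + y)]scalerDr !fD IHx IHy scalerDr.
  - by rewrite (free_scaleU s) [r *: (s *: _)]scalerA -!free_scaleU !fU scalerA.
have f0L : linear f0 by move=> r x y; rewrite fD f0Z.
exists (HB.pack f0 (GRing.isLinear.Build _ _ _ _ f0 f0L) : {linear _ -> _}) => i.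
by rewrite [LHS]fU scale1r.
Qed.

Lemma free_gen0 (N : lmodType R) (g : {linear {malg R[I]} -> N}) :
  (forall i, g << i >> = 0) -> forall x, g x = 0.
Proof.
move=> g0; elim/malg_ind => [|x y IHx IHy|r i].
- exact: linear0.
- by rewrite (linearD g) IHx IHy addr0.
- by rewrite free_scaleU (linearZ_LR g) g0 scaler0.
Qed.

End FreeModule.

Section CokerUniversal.
Variables (R : pzRingType) (U V : lmodType R) (f : {linear U -> V}).

Lemma coker_lift (N : zmodType) (g : {additive V -> N}) : (forall u, g (f u) = 0) ->
  exists h : {additive coker f -> N}, forall x, h (\pi_(coker f) x) = g x.
Proof.
move=> gf; pose h (t : coker f) := g (repr t).
have hE x : h (\pi_(coker f) x) = g x.
  have /coker_eqP[u xu] : \pi_(coker f) (repr (\pi_(coker f) x)) == \pi_(coker f) x.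
    by rewrite reprK.
  by apply/eqP; rewrite -subr_eq0 -raddfB /= xu gf.
have hB : zmod_morphism h.
  elim/quotW => x; elim/quotW => y.
  have -> : \pi_(coker f) x - \pi_(coker f) y = \pi_(coker f) (x - y).
    by rewrite [RHS]raddfB.
  by rewrite !hE raddfB.
by exists (HB.pack h (GRing.isZmodMorphism.Build _ _ h hB) : {additive _ -> _}).
Qed.

Definition coker_pi (x : V) : coker f := \pi_(coker f) x.

Lemma coker_piZ r x : coker_pi (r *: x) = r *: coker_pi x.
Proof. by rewrite [RHS]coker_scaleE. Qed.

Lemma coker_piB : zmod_morphism coker_pi.
Proof. by move=> x y; rewrite [LHS]raddfB. Qed.

HB.instance Definition _ := GRing.isZmodMorphism.Build V (coker f) coker_pi coker_piB.

Lemma coker_pi0 u : coker_pi (f u) = 0.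
Proof. by rewrite -(raddf0 coker_pi); apply/eqP/coker_eqP; exists u; rewrite subr0. Qed.

End CokerUniversal.

(** * The Bowen-Franks module and the covering *)

Section BowenFranksRelation.
Variables (E : graph) (row_fin : row_finite E).
Local Notation free := {malg Zsigma[vert E]}.

Definition bf_gen (v : vert E) : BF_gr E := coker_pi _ (<< v >> : free).

Lemma BF_column (v : reg E) :
  mxact (@BF_matrix E) << v >> =
  << val v >> - sigma *: \sum_(e <- outs (val v)) << rng e >> :> free.
Proof.
apply/malgP => w; rewrite mxactE; last exact: BF_matrix_colfin.
rewrite msuppU oner_eq0 big_seq_fset1 mcoeffUU mulr1.
rewrite mcoeffB mcoeffU mcoeffZ /BF_matrix /idmat eq_sym.
have -> : ((\sum_(e <- outs (val v)) << rng e >> : free)@_w : Zsigma) =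
    (adjacency v w)%:~R; last by case: (val v == w).
rewrite (raddf_sum (mcoeff w)).
transitivity (\sum_(e <- outs (val v)) (rng e == w)%:R : Zsigma).
  by apply: eq_bigr => e _; exact: mcoeffU.
rewrite -natr_sum -pmulrn; congr (_%:R).
rewrite -big_mkcond sum1_count -size_filter; apply/perm_size/uniq_perm.
- exact/filter_uniq/outs_uniq.
- exact: fset_uniq.
set S := (X in fset_set X).
move=> e; rewrite mem_filter (@in_fset_set _ S); last first.
  by apply: sub_finite_set (row_fin (val v)) => f [].
apply/andP/idP => [[/eqP ew ev]|].
  by rewrite inE /=; split=> //; apply: (src_outs row_fin).
by rewrite inE => -[/= <- /eqP ew]; split=> //; exact: outs_src.
Qed.

(** The relations in the cokernel have the shape of those between the vertices
    of the covering, with sigma in place of the change of level. *)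
Lemma bf_relation (v : vert E) : outs v != [::] ->
  bf_gen v = \sum_(e <- outs v) sigma *: bf_gen (rng e).
Proof.
move=> vreg.
have vr : `[< regular_vertex v >] by apply/asboolP; exact/(regular_outs row_fin).
pose v' : reg E := Sub v vr.
have : coker_pi _ (mxact (@BF_matrix E) << v' >>) = 0 :> BF_gr E by exact: coker_pi0.
rewrite BF_column coker_piB coker_piZ => /eqP; rewrite subr_eq0 => /eqP.
by rewrite (raddf_sum (coker_pi _)) scaler_sumr.
Qed.

End BowenFranksRelation.

Section Covering.
Variables (l : invRing) (E : graph) (H : functor (starAlgCat l) Ab).
Hypotheses (row_fin : row_finite E) (Hst : Minf_stable H) (Hadd : additive_functor H)
  (Hcolim : preserves_filtering_colimits H).

Local Notation F := (unit_covering E).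
Local Notation A := (Hob H (base_alg l)).
Local Notation HL := (HL_covering H E).

Definition clev (v : vert F) : int := v.2.

Lemma clevE (e : edge F) : clev (rng e) = clev (src e) + 1.
Proof. by []. Qed.

Lemma covering_row_finite : row_finite F.
Proof.
move=> [v n]; apply: (sub_finite_set (B := ((fun e => (e, n)) @` out_edges v)%classic)).
  by move=> [e m] [/= ev <-]; exists e.
exact/finite_image/row_fin.
Qed.

Lemma no_loop (e : edge F) : rng e <> src e.
Proof. by move=> /(congr1 snd) /=; lia. Qed.

Lemma outs_covering (v : vert E) (n : int) :
  perm_eq (outs ((v, n) : vert F)) [seq (e, n) | e <- outs v].
Proof.
apply: uniq_perm.
- exact: outs_uniq.
- by rewrite map_inj_uniq ?outs_uniq // => e f [].
move=> [e m]; apply/idP/mapP => [/(src_outs covering_row_finite) [ev mn]|[f fv [-> ->]]].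
  by exists e; [rewrite -ev; exact: outs_src|rewrite mn].
by apply/(mem_outs covering_row_finite); rewrite /= (src_outs row_fin fv).
Qed.

Lemma big_outs_covering (M : zmodType) (v : vert E) (n : int) (G : edge F -> M) :
  \sum_(e <- outs ((v, n) : vert F)) G e = \sum_(e <- outs v) G (e, n).
Proof. by rewrite (perm_big _ (outs_covering v n)) big_map. Qed.

Lemma outs_covering_neq0 (v : vert E) (n : int) :
  (outs ((v, n) : vert F) != [::]) = (outs v != [::]).
Proof. by rewrite -!size_eq0 (perm_size (outs_covering v n)) size_map. Qed.

Definition spow (n : int) : Zsigma := << (1 : int) *g n >>.

Lemma spowD m n : spow (m + n) = spow m * spow n.
Proof. by rewrite [RHS]grmulU mulr1. Qed.

(** The powers of sigma generate the additive group of Z[sigma]. *)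
Lemma spow_ind (P : Zsigma -> Prop) :
  (forall r s, P r -> P s -> P (r - s)) -> (forall n, P (spow n)) -> forall r, P r.
Proof.
move=> PB PS; have P0 : P 0 by rewrite -(subrr (spow 0)); apply: PB.
have PN r : P r -> P (- r) by move=> Pr; rewrite -sub0r; exact: PB.
have PD r s : P r -> P s -> P (r + s) by move=> Pr Ps; rewrite -[s]opprK; apply: PB => //; exact: PN.
elim/malg_ind => // z n.
have -> : << z *g n >> = spow n *~ z.
  by rewrite /spow -(raddfMz (mkmalgU n)) intz.
have PM k : P (spow n *+ k) by elim: k => // k IH; rewrite mulrS; exact: PD.
by case: z => k; [exact: PM|exact/PN/PM].
Qed.

Lemma BF_ind (P : BF_gr E -> Prop) :
  P 0 -> (forall m m', P m -> P m' -> P (m - m')) ->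
  (forall v n, P (spow n *: bf_gen v)) -> forall m, P m.
Proof.
move=> P0 PB PS; pose p := coker_pi (mxact (@BF_matrix E)).
suff Pp x : P (p x) by elim/quotW => x; exact: Pp.
have pD y z : p (y + z) = p y + p z by exact: raddfD.
elim/malg_ind: x => [|x y Px Py|r v].
- by have -> : p 0 = 0 by exact: raddf0.
- have PN : P (- p y) by rewrite -sub0r; exact: PB.
  by rewrite pD -[p y]opprK; exact: PB.
have -> : p << r *g v >> = r *: bf_gen v by rewrite free_scaleU; exact: coker_piZ.
elim/spow_ind: r => [r s Pr Ps|n]; last exact: PS.
have -> : (r - s) *: bf_gen v = r *: bf_gen v - s *: bf_gen v by exact: scalerBl.
exact: (PB _ _ Pr Ps).
Qed.

Definition vclass (v : vert E) (n : int) (a : A) : HL :=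
  Hmap H (point_hom (vproj l ((v, n) : vert F))) a.

Lemma vclassD v n : {morph vclass v n : a b / a + b}.
Proof. exact: raddfD. Qed.

Lemma spow_vclass m v n a : spow m *: vclass v n a = vclass v (n + m) a.
Proof.
rewrite [LHS]actscaleU mulr1z; apply: Hmap_pushE.
exact: leavitt_mapE.
Qed.

Lemma vclass_relation v n a : outs v != [::] ->
  vclass v n a = \sum_(e <- outs v) vclass (rng e) (n + 1) a.
Proof.
move=> vreg; rewrite [LHS](vertex_relation Hst Hadd covering_row_finite no_loop).
  by rewrite big_outs_covering.
by rewrite outs_covering_neq0.
Qed.

(** The vertex v_n goes to the class of sigma^n v. *)
Lemma to_tensor_exists : exists psi : {additive Hob H (leavitt l F) -> tensor (BF_gr E) A},
  forall v n a, psi (vclass v n a) = tens (spow n *: bf_gen v) a.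
Proof.
pose g0 (v : vert F) (a : A) : tensor (BF_gr E) A := tens (spow v.2 *: bf_gen v.1) a.
have gB v : zmod_morphism (g0 v).
  exact: tensB.
pose g v : {additive A -> tensor (BF_gr E) A} :=
  HB.pack (g0 v) (GRing.isZmodMorphism.Build _ _ (g0 v) (gB v)).
have [|psi psiE] := @leavitt_ext l H Hst Hadd Hcolim F covering_row_finite clev clevE _ g.
  move=> [v n] a; rewrite outs_covering_neq0 => vreg /=.
  rewrite (big_outs_covering v n (fun e : edge F => g0 (rng e.1, e.2 + 1) a)) /g0 /=.
  rewrite (bf_relation row_fin vreg) scaler_sumr.
  by rewrite tens_suml; apply: eq_bigr => e _; rewrite scalerA spowD.
by exists psi => v n a; exact: psiE.
Qed.

(** For fixed a, the images of the columns vanish by the relation between the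
    vertices of level 0 and those of level 1. *)
Lemma free_map_BF a (f : {linear {malg Zsigma[vert E]} -> HL}) :
  (forall v, f << v >> = vclass v 0 a) -> forall u, f (mxact (@BF_matrix E) u) = 0.
Proof.
move=> fE; apply: (free_gen0 (g := f \o mxact (@BF_matrix E))) => v.
rewrite -[LHS]/(f (mxact (@BF_matrix E) << v >>)) (BF_column row_fin).
rewrite (linearB f) (linearZ_LR f) (linear_sum f) fE.
have vreg : outs (val v) != [::] by apply/(regular_outs row_fin); exact/asboolP/(valP v).
rewrite (vclass_relation _ _ vreg) scaler_sumr.
rewrite [X in _ - X](eq_bigr (fun e => vclass (rng e) (0 + 1) a)) ?subrr ?scaler0 //.
by move=> e _; rewrite fE -[sigma]/(spow 1) spow_vclass.
Qed.

(** Descending from the free module to the cokernel, and from there to the tensor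
    product, one fixes a, and checks additivity in a afterwards. *)
Lemma of_tensor_exists : exists phi : {additive tensor (BF_gr E) A -> Hob H (leavitt l F)},
  forall v n a, phi (tens (spow n *: bf_gen v) a) = vclass v n a.
Proof.
have f_ex a : {f : {linear {malg Zsigma[vert E]} -> HL} | forall v, f << v >> = vclass v 0 a}.
  by apply: cid; exact: free_lift.
pose f a := sval (f_ex a); have fE a v : f a << v >> = vclass v 0 a by exact: (svalP (f_ex a)).
have h_ex a : {h : {additive BF_gr E -> HL} | forall x, h (coker_pi _ x) = f a x}.
  by apply: cid; apply: coker_lift; exact: free_map_BF.
pose b (m : BF_gr E) (a : A) : HL := sval (h_ex a) m.
have bE a x : b (coker_pi _ x) a = f a x by exact: (svalP (h_ex a)).
have fD x : {morph f^~ x : a a' / a + a'}.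
  move=> a a'; elim/malg_ind: x => [|x y IHx IHy|r v].
  - by rewrite !raddf0 addr0.
  - by rewrite !raddfD /= IHx IHy addrACA.
  - by rewrite free_scaleU !linearZ_LR !fE vclassD scalerDr.
have [phi phiE] : exists g : {additive tensor (BF_gr E) A -> HL},
    forall m a, g (tens m a) = b m a.
  apply: tensor_lift => [m a a'|a m m']; last by rewrite /b raddfD.
  elim/quotW: m => x; rewrite -[\pi_ _ _]/(coker_pi (mxact (@BF_matrix E)) x) !bE.
  exact: fD.
exists phi => v n a; rewrite phiE /bf_gen -coker_piZ bE linearZ_LR fE.
by rewrite [LHS]spow_vclass add0r.
Qed.

End Covering.

Theorem theorem5p2 (l : invRing) (E : graph) (H : functor (starAlgCat l) Ab)
    (E_row_finite : row_finite E)
    (H_stable : Minf_stable H)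
    (H_additive : additive_functor H)
    (H_colimits : preserves_filtering_colimits H) :
  exists f : {linear HL_covering H E -> tensor (BF_gr E) (Hob H (base_alg l))},
    bijective f.
Proof.
have [psi psiE] := to_tensor_exists E_row_finite H_stable H_additive H_colimits.
have [phi phiE] := of_tensor_exists E_row_finite H_stable H_additive.
pose F := unit_covering E.
have gen (M : zmodType) (f g : {additive Hob H (leavitt l F) -> M}) :
    (forall v n a, f (vclass v n a) = g (vclass v n a)) -> forall y, f y = g y.
  move=> fg; apply: (leavitt_gen H_stable H_additive H_colimits
    (covering_row_finite E_row_finite) (@clevE E)) => -[v n]; exact: fg.
have psiK : cancel psi phi.
  apply: (gen _ (phi \o psi) idfun) => v n a.
  by rewrite /= psiE phiE.
have phiK : cancel phi psi.
  apply: (tensor_gen (f := psi \o phi) (g := idfun)) => m a /=.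
  elim/BF_ind: m => [|m m' IH IH'|v n].
  - by rewrite tens0l !raddf0.
  - have -> : tens (m - m') a = tens m a - tens m' a by exact: tensBl.
    have -> : phi (tens m a - tens m' a) = phi (tens m a) - phi (tens m' a).
      exact: raddfB.
    exact: (etrans (raddfB psi _ _) (congr2 (fun t t' => t - t') IH IH')).
  - by rewrite phiE psiE.
have psiZ (r : Zsigma) (x : HL_covering H E) :
    psi (r *: x) = r *: (psi x : tensor (BF_gr E) _).
  elim/spow_ind: r x => [r s IHr IHs|n] x.
    rewrite !scalerBl.
    exact: (etrans (raddfB psi _ _) (congr2 (fun t t' => t - t') (IHr x) (IHs x))).
  have rhoE y : spow n *: (y : HL_covering H E) = HL_action H E n y.
    by rewrite [LHS]actscaleU mulr1z.
  rewrite rhoE.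
  apply: (gen _ (psi \o HL_action H E n) ( *:%R (spow n) \o psi)) => v m a /=.
  rewrite -rhoE spow_vclass !psiE tensorZ scalerA -spowD addrC //.
have psi_lin : linear (psi : HL_covering H E -> tensor (BF_gr E) _).
  by move=> r x y; rewrite raddfD psiZ.
pose psi_lmod := GRing.isLinear.Build Zsigma (HL_covering H E)
  (tensor (BF_gr E) (Hob H (base_alg l))) _ _ psi_lin.
exists (HB.pack_for {linear HL_covering H E -> tensor (BF_gr E) (Hob H (base_alg l))}
  (psi : HL_covering H E -> tensor (BF_gr E) (Hob H (base_alg l))) psi_lmod).
by exists phi.
Qed.
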